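(* Let $\theta \in (0,1)$ be irrational, with continued fraction convergents $\theta_n = \frac{p_n}{q_n}$ ($n \ge 0$). Let $\alpha_1, \alpha_{-1}, \beta_1, \beta_{-1} \in \mathbb{C}$ and $M = \max\{|\alpha_{1}|, |\alpha_{-1}|, |\beta_{1}|, |\beta_{-1}|\}$. Let $$H_{\theta} = \alpha_1 U_{\theta} + \alpha_{-1} U_{\theta}^* + \beta_1 V_{\theta} + \beta_{-1} V_{\theta}^* \in A_\theta,$$ $$h_{\theta_n} = \alpha_1 u_{\theta_n} + \alpha_{-1} u_{\theta_n}^* + \beta_1 v_{\theta_n} + \beta_{-1} v_{\theta_n}^* \in M_{q_n}(\mathbb{C}).$$ Then for every integer $n \geq 1$: (1) For each $\varepsilon > 0$, $$\Big(\sigma^{(\varepsilon)}(h_{\theta_{n-1}}) \cup \sigma^{(\varepsilon)}(h_{\theta_{n}})\Big) \subset \sigma^{(\varepsilon + \varepsilon_n)}(H_{\theta}) \subset \Big(\sigma^{(\varepsilon + 2\varepsilon_n)}(h_{\theta_{n-1}}) \cup \sigma^{(\varepsilon + 2\varepsilon_n)}(h_{\theta_{n}})\Big),$$ where $\varepsilon_n = 204M\left(\frac{1}{q_{n-1}} + \frac{1}{q_{n}}\right)$. (2) If $h_{\theta_{n-1}}$, $h_{\theta_{n}}$ and $H_{\theta}$ are all normal, then $$d_H \big(\sigma (h_{\theta_{n-1}}) \cup \sigma (h_{\theta_{n}}),\ \sigma (H_{\theta})\big) \leq 204M\left(\frac{1}{q_{n-1}} + \frac{1}{q_{n}}\right)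.$$
   Context: Continued fractions: for irrational $\theta\in(0,1)$ there are unique positive integers $a_1,a_2,\ldots$ with $\theta = \lim_{n\to\infty}[a_1,\ldots,a_n]$, where $[a_1,\ldots,a_n] = \frac{1}{a_1+\frac{1}{a_2+\frac{1}{\ddots+\frac{1}{a_n}}}}$. The integers $p_n, q_n$ are defined by $p_0=0$, $p_1=1$, $q_0=1$, $q_1=a_1$, and $p_n = a_np_{n-1}+p_{n-2}$, $q_n = a_nq_{n-1}+q_{n-2}$ for $n\ge 2$; then $[a_1,\ldots,a_n]=p_n/q_n$ for $n\ge1$. Irrational rotation algebra: $A_\theta$ is the universal C$^*$-algebra generated by two unitaries $U_\theta,V_\theta$ subject to $U_\theta V_\theta = e^{2\pi i\theta}V_\theta U_\theta$. Matrices: for integers $p,q$ with $q\geq 1$ and $0\le p\le q$, let $\omega = e^{2\pi i p/q}$. Then $u_{p/q}\in M_q(\mathbb{C})$ is the cyclic shift matrix with entries $1$ at positions $(j,j+1)$ for $1\le j\le q-1$ and at position $(q,1)$, and $0$ elsewhere; and $v_{p/q} = \mathrm{diag}(1,\omega,\omega^2,\ldots,\omega^{q-1})\in M_q(\mathbb{C})$. For $q=1$ both are the $1\times1$ matrix $(1)$. Write $u_{\theta_n} = u_{p_n/q_n}$, $v_{\theta_n} = v_{p_n/q_n}$, of size $q_n\times q_n$. Spectra: $\sigma(T)$ is the spectrum of $T$. For $\varepsilon>0$ the $\varepsilon$-pseudospectrum of a bounded Hilbert space operator (or of an element of a unital C$^*$-algebra, viewed as an operator via any faithful unital representation) is $\sigma^{(\varepsilon)}(T)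 = \{\lambda\in\mathbb{C} : \|(\lambda-T)^{-1}\|\ge \frac1\varepsilon\}$, with the convention $\|X^{-1}\|=\infty$ if $X$ is not invertible; matrices carry the operator norm. Hausdorff distance: for compact $\Sigma,\Lambda\subset\mathbb{C}$, $d_H(\Sigma,\Lambda) = \max\{\sup_{\sigma\in\Sigma}d(\sigma,\Lambda),\ \sup_{\lambda\in\Lambda}d(\lambda,\Sigma)\}$, where $d(\sigma,\Lambda)=\inf_{\lambda\in\Lambda}|\sigma-\lambda|$. *)

(* Defs.v *)
From HB Require Import structures.
From mathcomp Require Import all_boot all_order all_algebra.
From mathcomp Require Import complex.
From mathcomp Require Import all_classical all_reals all_analysis.

Set Implicit Arguments.
Unset Strict Implicit.
Unset Printing Implicit Defensive.

Import Order.TTheory GRing.Theory Num.Theory.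
Import numFieldNormedType.Exports.

Local Open Scope classical_set_scope.
Local Open Scope ring_scope.
Local Open Scope complex_scope.
Local Open Scope sesquilinear_scope.

(** Complex numbers *)

Definition cabs (R : realType) (z : R[i]) : R := ComplexField.Normc.normc z.

(* e^{2 pi i t} *)
Definition expi2pi (R : realType) (t : R) : R[i] :=
  cos (2 * pi * t) +i* sin (2 * pi * t).

(** Continued fractions.  A sequence a : nat -> nat stands for a_1, a_2, ...;
    the value a 0 is never used. *)

Fixpoint cfrac (R : realType) (s : seq nat) : R :=
  if s is x :: s' then (x%:R + cfrac R s')^-1 else 0.

Definition cf_expansion (R : realType) (theta : R) (a : nat -> nat) : Prop :=
  (forall k, (0 < k)%N -> (0 < a k)%N) /\
  (fun n => cfrac R [seq a k | k <- iota 1 n]) @ \oo --> theta.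

Fixpoint cf_p (a : nat -> nat) (n : nat) : nat :=
  match n with
  | 0 => 0
  | 1 => 1
  | (m.+1 as k).+1 => a n * cf_p a k + cf_p a m
  end.

Fixpoint cf_q (a : nat -> nat) (n : nat) : nat :=
  match n with
  | 0 => 1
  | 1 => a 1
  | (m.+1 as k).+1 => a n * cf_q a k + cf_q a m
  end.

(** Unital C*-algebras.  They are nonzero, since algebras here satisfy 1 != 0.
    The norm is real-valued and the completeness axiom is stated with Cauchy
    sequences: a normed module over R[i] with a ring structure cannot be
    declared as a Hierarchy Builder structure, because numDomainType already
    inherits from both normed modules and rings. *)

HB.mixin Record isCStar (R : realType) A of GRing.UnitAlgebra R[i] A := {
  star : A -> A ;
  cnorm : A -> R ;
  starK : involutive star ;
  star_antilinear : forall (c : R[i]) (x y : A),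
    star (c *: x + y) = c^* *: star x + star y ;
  starM : forall x y : A, star (x * y) = star y * star x ;
  cnorm0_eq0 : forall x : A, cnorm x = 0 -> x = 0 ;
  cnormD : forall x y : A, cnorm (x + y) <= cnorm x + cnorm y ;
  cnormZ : forall (c : R[i]) (x : A), cnorm (c *: x) = cabs c * cnorm x ;
  cnormM : forall x y : A, cnorm (x * y) <= cnorm x * cnorm y ;
  cnorm_cstar : forall x : A, cnorm (star x * x) = cnorm x ^+ 2 ;
  cnorm_complete : forall u : nat -> A,
    (forall e, 0 < e -> exists N, forall m n, (N <= m)%N -> (N <= n)%N ->
       cnorm (u m - u n) < e) ->
    exists l, (fun n => cnorm (u n - l)) @ \oo --> (0 : R)
}.

#[short(type="cstarAlgType")]
HB.structure Definition CStar (R : realType) :=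
  {A of GRing.UnitAlgebra R[i] A & isCStar R A}.

Section CStarAlgebra.
Context {R : realType}.
Implicit Types A B : cstarAlgType R.

Definition cunitary A (u : A) : Prop := star u * u = 1 /\ u * star u = 1.

Definition cnormal A (x : A) : Prop := star x * x = x * star x.

Definition star_subalgebra A (S : set A) : Prop :=
  [/\ S 1,
      forall (c : R[i]) x y, S x -> S y -> S (c *: x + y),
      forall x y, S x -> S y -> S (x * y)
    & forall x, S x -> S (star x)].

Definition norm_dense A (S : set A) : Prop :=
  forall x (e : R), 0 < e -> exists2 y, S y & cnorm (x - y) < e.

Definition cspectrum A (x : A) : set R[i] :=
  [set l | l%:A - x \isn't a GRing.unit].

Definition cpseudospectrum A (e : R) (x : A) : set R[i] :=
  [set l | l%:A - x \isn't a GRing.unit \/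
           e^-1 <= cnorm (l%:A - x)^-1].

Definition rotation_pair (theta : R) A (U V : A) : Prop :=
  [/\ cunitary U, cunitary V & U * V = expi2pi theta *: (V * U)].

(* A, with generators U and V, is the universal C*-algebra A_theta: it is
   generated by a rotation pair, and every rotation pair in a unital
   C*-algebra B is the image of (U, V) under a unital *-homomorphism, which
   is unique because U and V generate A. *)
Definition is_rotation_algebra (theta : R) A (U V : A) : Prop :=
  [/\ rotation_pair theta U V,
      forall S : set A, star_subalgebra S -> S U -> S V -> norm_dense S
    & forall B (u v : B), rotation_pair theta u v ->
        exists phi : {lrmorphism A -> B},
          [/\ forall x, phi (star x) = star (phi x), phi U = u & phi V = v]].

Definition rotation_elt A (al1 alm1 be1 bem1 : R[i]) (U V : A) : A :=
  al1 *: U + alm1 *: star U + be1 *: V + bem1 *: star V.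

End CStarAlgebra.

(** Matrices, acting on column vectors with the Euclidean norm *)

Section Matrices.
Context {R : realType}.

Definition l2norm q (x : 'cV[R[i]]_q) : R :=
  Num.sqrt (\sum_(j < q) cabs (x j ord0) ^+ 2).

Definition opnorm q (X : 'M[R[i]]_q) : R :=
  sup [set l2norm (X *m x) | x in [set x : 'cV[R[i]]_q | l2norm x <= 1]].

Definition mxspectrum q (X : 'M[R[i]]_q) : set R[i] :=
  [set l | l%:M - X \notin unitmx].

Definition mxpseudospectrum q (e : R) (X : 'M[R[i]]_q) : set R[i] :=
  [set l | l%:M - X \notin unitmx \/ e^-1 <= opnorm (invmx (l%:M - X))].

(* ordS is the cyclic successor on 'I_q *)
Definition shift_mx q : 'M[R[i]]_q := \matrix_(i, j) (j == ordS i)%:R.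

Definition clock_mx (p q : nat) : 'M[R[i]]_q :=
  diag_mx (\row_j expi2pi (p%:R / q%:R) ^+ j).

Definition rotation_mx (al1 alm1 be1 bem1 : R[i]) (p q : nat) : 'M[R[i]]_q :=
  al1 *: shift_mx q + alm1 *: (shift_mx q)^t* +
  be1 *: clock_mx p q + bem1 *: (clock_mx p q)^t*.

End Matrices.

(** Hausdorff distance, as an extended real *)

Section Hausdorff.
Context {R : realType}.
Implicit Types S T : set R[i].

Definition dist_to (z : R[i]) T : \bar R :=
  ereal_inf [set (cabs (z - w))%:E | w in T].

Definition hausdorff_dist S T : \bar R :=
  maxe (ereal_sup [set dist_to s T | s in S])
       (ereal_sup [set dist_to t S | t in T]).

End Hausdorff.

(* Main.v *)
Require Import Defs.
From HB Require Import structures.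
From mathcomp Require Import all_boot all_order all_algebra.
From mathcomp Require Import complex.
From mathcomp Require Import all_classical all_reals all_analysis.
From mathcomp Require Import ring lra zify.

Set Implicit Arguments.
Unset Strict Implicit.
Unset Printing Implicit Defensive.

Import Order.TTheory GRing.Theory Num.Theory.
Import numFieldNormedType.Exports.

Local Open Scope classical_set_scope.
Local Open Scope ring_scope.

(** Write e(t) for exp(2 pi i t), X for lam - H and Y for lam - h, where h is the
    matrix attached to a convergent p/q.  A point lam lies outside the
    eps-pseudospectrum exactly when the operator is invertible and bounded below
    by some c > eps.  The theorem follows from a comparison of lower bounds: as
    |theta - p/q| <= 1/q^2 with p and q coprime, a lower bound c of X gives the
    lower bound c - 204 M / q of Y, and conversely.  Both halves are then read off
    with p/q equal to one of the two convergents.  The comparison goes through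
    sequences.

    Sequences.  For each phase t the finitely supported sequences on the integers
    carry the rotation pair (U xi)(j) = xi(j + 1), (V xi)(j) = e(theta j + t) xi(j).
    The norm of the algebra on noncommutative Laurent polynomials in U and V is the
    supremum over t of the operator norms on these sequences ([evalA_le_evalZ] and
    [evalZ_le_evalA]).  Both are C*-norms, and each of them bounds the coefficients
    of a polynomial: on the algebra by averaging the conjugates by powers of U and V
    ([coef_le_cnorm]), on sequences by averaging over the phases t = k theta
    ([coef_le_normZ]).  A polynomial of degree d has at most (2d + 1)^2 coefficients,
    so the two norms agree up to a factor polynomial in d.  On the 2^k-th power of a
    self-adjoint polynomial this factor grows polynomially in 2^k, and it disappears
    in the 2^k-th root ([pow_growth]).  Lower bounds on sequences, for a polynomial
    and its adjoint, thus become inverses in the algebra ([lower_to_inverse]);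
    conversely inverses become lower bounds, as they are limits of polynomials
    ([inverse_to_lower]).

    Localisation.  On a window of fewer than q consecutive integers, the shift is
    the cyclic shift of size q, and V is the clock matrix times a phase, up to an
    error q |theta - p/q| = O(1/q).  As p and q are coprime, a cyclic relabelling
    multiplies the clock matrix by any q-th root of unity, so that the phase also
    costs O(1/q) only.  Cutting a sequence with all translates of a tent function of
    width of order q and summing the squares costs another O(1/q), because the
    increments of the tent are small against its size ([tent_average]).  This yields
    [rep_to_matrix] and [matrix_to_rep].

    Normal elements.  If H and h are normal, lower bounds are distances to spectra.
    For matrices this is the spectral theorem ([normal_mxlower]); in the algebra it is
    Rickart's argument, which averages a resolvent over roots of unity
    ([normal_inverse_bound]). *)

(** * The modulus and the characters of the circle *)

Section ComplexModulus.
Context {R : realType}.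
Implicit Types (z w : R[i]) (x y t : R).

Lemma cabsE z : `|z| = (cabs z)%:C%C.
Proof. by []. Qed.

Lemma cabs_ge0 z : 0 <= cabs z.
Proof. by case: z => a b; rewrite /cabs /=; exact: sqrtr_ge0. Qed.
Hint Resolve cabs_ge0 : core.

Lemma cabs0 : cabs (0 : R[i]) = 0. Proof. exact: ComplexField.Normc.normc0. Qed.
Lemma cabs1 : cabs (1 : R[i]) = 1. Proof. exact: ComplexField.Normc.normc1. Qed.
Lemma cabsM z w : cabs (z * w) = cabs z * cabs w.
Proof. exact: ComplexField.Normc.normcM. Qed.
Lemma cabsD z w : cabs (z + w) <= cabs z + cabs w.
Proof. exact: le_normcD. Qed.
Lemma cabsN z : cabs (- z) = cabs z.
Proof. exact: normcN. Qed.
Lemma cabsB z w : cabs (z - w) <= cabs z + cabs w.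
Proof. by rewrite -(cabsN w); exact: cabsD. Qed.
Lemma cabs_distC z w : cabs (z - w) = cabs (w - z).
Proof. by rewrite -cabsN opprB. Qed.
Lemma cabsV z : cabs z^-1 = (cabs z)^-1.
Proof. exact: ComplexField.Normc.normcV. Qed.
Lemma cabsX z n : cabs (z ^+ n) = cabs z ^+ n.
Proof. by elim: n => [|n IH]; rewrite ?expr0 ?cabs1// !exprS cabsM IH. Qed.
Lemma cabs_eq0 z : cabs z = 0 -> z = 0.
Proof. exact: ComplexField.Normc.eq0_normc. Qed.
Lemma cabs_gt0 z : z != 0 -> 0 < cabs z.
Proof.
by move=> z0; rewrite lt_def cabs_ge0 andbT; apply: contra z0 => /eqP/cabs_eq0->.
Qed.
Lemma cabs_conj z : cabs z^* = cabs z.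
Proof. by apply: complexI; rewrite -!cabsE norm_conjC. Qed.
Lemma cabs_real x : cabs x%:C%C = `|x|.
Proof. by rewrite /cabs /= expr0n /= addr0 sqrtr_sqr. Qed.
Lemma cabs_sqr z : (cabs z ^+ 2)%:C%C = z^* * z.
Proof. by rewrite rmorphXn /= -cabsE normCK mulrC. Qed.
Lemma cabs_le_ReIm x y : cabs (x +i* y)%C <= `|x| + `|y|.
Proof.
rewrite /cabs /= -[leRHS]ger0_norm ?addr_ge0// -sqrtr_sqr ler_sqrt ?sqr_ge0//.
rewrite -(real_normK (num_real x)) -(real_normK (num_real y)).
by have := mulr_ge0 (normr_ge0 x) (normr_ge0 y); nra.
Qed.
Lemma cabs_sum I (r : seq I) (F : I -> R[i]) :
  cabs (\sum_(i <- r) F i) <= \sum_(i <- r) cabs (F i).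
Proof.
elim: r => [|i r IH]; first by rewrite !big_nil cabs0.
by rewrite !big_cons (le_trans (cabsD _ _))// lerD2l.
Qed.
Lemma cabs_lerB z w : cabs z - cabs w <= cabs (z - w).
Proof. by rewrite lerBlDr -{1}(subrK w z) cabsD. Qed.

Local Notation e := (@expi2pi R).

Lemma expi2piD x y : e (x + y) = e x * e y.
Proof. by rewrite /expi2pi mulrDr cosD sinD; simpc; congr (_ +i* _)%C; ring. Qed.

Lemma expi2pi0 : e 0 = 1.
Proof. by rewrite /expi2pi mulr0 cos0 sin0. Qed.

Lemma conj_expi2pi x : (e x)^* = e (- x).
Proof. by rewrite /expi2pi mulrN cosN sinN. Qed.

Lemma cabs_expi2pi x : cabs (e x) = 1.
Proof. by rewrite /cabs /expi2pi /= cos2Dsin2 sqrtr1. Qed.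

Lemma expi2pi_neq0 x : e x != 0.
Proof. by apply: contra_eqN (cabs_expi2pi x) => /eqP->; rewrite cabs0 eq_sym oner_eq0. Qed.

Lemma expi2piN x : e (- x) = (e x)^-1.
Proof.
by apply: (mulIf (expi2pi_neq0 x)); rewrite -expi2piD addNr expi2pi0 mulVf ?expi2pi_neq0.
Qed.

Lemma expi2piMn x n : e (x * n%:R) = e x ^+ n.
Proof.
elim: n => [|n IH]; first by rewrite mulr0 expi2pi0 expr0.
by rewrite -natr1 mulrDr mulr1 expi2piD IH exprSr.
Qed.

Lemma expi2pi1 : e 1 = 1.
Proof.
rewrite /expi2pi mulr1 mulrC mulr_natr cos2pi.
by rewrite -[pi *+ 2]add0r sinD2pi sin0.
Qed.

Lemma expi2pi_int (m : int) : e m%:~R = 1.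
Proof.
have en n : e n%:R = 1 by rewrite -[n%:R]mul1r expi2piMn expi2pi1 expr1n.
case: m => n; first exact: en.
by rewrite NegzE mulrNz expi2piN en invr1.
Qed.

Lemma expi2piDint x (m : int) : e (x + m%:~R) = e x.
Proof. by rewrite expi2piD expi2pi_int mulr1. Qed.

Lemma lip_trig (f df : R -> R) : (forall x, is_derive x 1 f (df x)) ->
  (forall x, `|df x| <= 1) -> forall x y, `|f x - f y| <= `|x - y|.
Proof.
move=> fd df1 x y; wlog: x y / y <= x.
  move=> H; case: (leP y x) => [/H//|/ltW/H].
  by rewrite distrC [in leRHS]distrC.
move=> yx.
have [c _ ->] := @MVT_segment R f df y x yx (fun x _ => fd x)
  (continuous_subspaceT (fun x => @differentiable_continuous _ _ _ _ _
    (proj1 (@derivable1_diffP _ _ _ _) (@ex_derive _ _ _ _ _ _ _ (fd x))))).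
by rewrite normrM ler_piMl.
Qed.

(** 16 is a round majorant of 2 (2 pi): each coordinate is 2 pi-Lipschitz
    and pi < 4. *)
Lemma expi2pi_lip x y : cabs (e x - e y) <= 16 * `|x - y|.
Proof.
rewrite /expi2pi; simpc.
apply: (le_trans (cabs_le_ReIm _ _)).
have lc : `|cos (2 * pi * x) - cos (2 * pi * y)| <= `|2 * pi * x - 2 * pi * y|.
  apply: (@lip_trig _ (fun x => - sin x)) => z; rewrite normrN.
  by rewrite -sqrtr_sqr -[leRHS]sqrtr1 ler_wsqrtr// sin2cos2 lerBlDr lerDl sqr_ge0.
have ls : `|sin (2 * pi * x) - sin (2 * pi * y)| <= `|2 * pi * x - 2 * pi * y|.
  apply: (@lip_trig _ (fun x => cos x)) => z; exact: cos_max.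
have p4 : (pi : R) <= 4.
  by have := @pihalf_lt2 R; rewrite ltr_pdivrMr// => /ltW/le_trans; apply; lra.
move: lc ls; rewrite -mulrBr normrM ger0_norm ?mulr_ge0 ?pi_ge0//.
have := normr_ge0 (x - y); have := @pi_ge0 R; nra.
Qed.

Lemma expi2pi_eq1 x : e x = 1 -> exists m : int, x = m%:~R.
Proof.
move=> ex; exists (Num.floor x).
set y := x - (Num.floor x)%:~R.
have ey : e y = 1.
  by rewrite /y -mulrNz expi2piDint.
have y01 : 0 <= y < 1.
  rewrite /y subr_ge0 ltrBlDl floor_le/= .
  by have := floorD1_gt x; rewrite intrD1 addrC.
have H (z : R) : 0 <= z <= 1 / 2 -> e z = 1 -> z = 0.
  move=> /andP[z0 z1]; rewrite /expi2pi => -[cz _].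
  have pp := @pi_gt0 R.
  have: 2 * pi * z = 0 by apply: cos_inj; rewrite ?cos0// in_itv /= ?lexx ?pi_ge0//; apply/andP; split; nra.
  by move/eqP; rewrite mulf_eq0 mulf_eq0 (gt_eqF pp) pnatr_eq0 /= => /eqP.
suff: y = 0 by move/eqP; rewrite subr_eq0 => /eqP.
have [y2|y2] := leP y (1/2); first by apply: H => //; apply/andP; split; lra.
have: 1 - y = 0.
  apply: H; first by apply/andP; split; lra.
  by rewrite expi2piD expi2piN ey invr1 mulr1 expi2pi1.
lra.
Qed.

(** Irrationality of theta enters through this alone: the means over k of
    e(k theta r) then tend to 0 for r <> 0. *)
Lemma expi2pi_irr (theta : R) (r : int) : irrational theta -> r != 0 ->
  e (theta * r%:~R) != 1.
Proof.
move=> ith r0; apply/eqP => /expi2pi_eq1[m mE]; apply: ith.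
exists (m%:~R / r%:~R) => //; rewrite fmorph_div /= !ratr_int -mE mulfK//.
by rewrite intr_eq0.
Qed.

(** A geometric sum whose ratio e(j/n) is an n-th root of unity other than
    1. *)
Lemma root_sum (n j : nat) : (0 < j < n)%N ->
  \sum_(k < n) e (k%:R / n%:R : R) ^+ j = 0.
Proof.
move=> /andP[j0 jn].
have n0 : n%:R != 0 :> R by rewrite pnatr_eq0; lia.
pose z : R[i] := e (j%:R / n%:R).
have -> : \sum_(k < n) e (k%:R / n%:R : R) ^+ j = \sum_(k < n) z ^+ k.
  by apply: eq_bigr => k _; rewrite /z -!expi2piMn; congr e; field.
have z1 : z != 1.
  apply/eqP => /expi2pi_eq1[m mE].
  have : j%:R = (m * n%:Z)%:~R :> R.
    by rewrite intrM -mE -pmulrn divfK.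
  rewrite pmulrn => /intr_inj jE.
  have [m0|m0] := leP m 0; nia.
apply: (mulfI (x := z - 1)); first by rewrite subr_eq0.
rewrite -subrX1 mulr0 /z -expi2piMn divfK// -[j%:R]/(j%:Z%:~R : R).
by rewrite expi2pi_int subrr.
Qed.

End ComplexModulus.
#[global] Hint Extern 0 (is_true (0 <= cabs _)) => exact: cabs_ge0 : core.

(** * Finitely supported sequences on the integers *)

(** Locked: membership and uniqueness must not be computed from the
    enumeration. *)
HB.lock Definition zball (b : nat) : seq int := [seq i%:Z - b%:Z | i <- iota 0 b.*2.+1].
Canonical zball_unlock := Unlockable zball.unlock.

Section L2.
Context {R : realType}.

Lemma sum_sqr_CS I (r : seq I) (a b : I -> R) :
  (forall i, 0 <= a i) -> (forall i, 0 <= b i) ->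
  (\sum_(i <- r) a i * b i) ^+ 2 <=
  (\sum_(i <- r) a i ^+ 2) * (\sum_(i <- r) b i ^+ 2).
Proof.
move=> a0 b0; elim: r => [|i r]; first by rewrite !big_nil expr0n mul0r.
rewrite !big_cons.
set S := \sum_(j <- r) _; set A := \sum_(j <- r) _ ^+ 2; set B := \sum_(j <- r) _ ^+ 2.
have S0 : 0 <= S by apply: sumr_ge0 => j _; exact: mulr_ge0.
have A0 : 0 <= A by apply: sumr_ge0 => j _; exact: sqr_ge0.
have B0 : 0 <= B by apply: sumr_ge0 => j _; exact: sqr_ge0.
have := a0 i; have := b0 i; move: (a i) (b i) => x y y0 x0 IH.
suff: 2 * S * (x * y) <= A * y ^+ 2 + B * x ^+ 2 by nra.
rewrite -ler_sqr ?nnegrE; [|by rewrite !mulr_ge0|by rewrite addr_ge0// mulr_ge0// sqr_ge0].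
have := sqr_ge0 (A * y ^+ 2 - B * x ^+ 2).
have : S ^+ 2 * (x * y) ^+ 2 <= A * B * (x * y) ^+ 2 by rewrite ler_wpM2r// sqr_ge0.
nra.
Qed.

Definition l2 I (r : seq I) (f : I -> R[i]) : R :=
  Num.sqrt (\sum_(i <- r) cabs (f i) ^+ 2).

Section Seq.
Context {I : eqType}.
Implicit Types (r : seq I) (f g : I -> R[i]).

Lemma l2_ge0 r f : 0 <= l2 r f. Proof. exact: sqrtr_ge0. Qed.

Lemma l2_sqr r f : l2 r f ^+ 2 = \sum_(i <- r) cabs (f i) ^+ 2.
Proof. by rewrite sqr_sqrtr// sumr_ge0// => i _; exact: sqr_ge0. Qed.

Lemma l2_CS r f g : \sum_(i <- r) cabs (f i) * cabs (g i) <= l2 r f * l2 r g.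
Proof.
rewrite -ler_sqr ?nnegrE ?mulr_ge0 ?l2_ge0 ?sumr_ge0//; last first.
  by move=> i _; rewrite mulr_ge0.
by rewrite exprMn !l2_sqr sum_sqr_CS.
Qed.

Lemma l2_triangle r f g : l2 r (fun i => f i + g i) <= l2 r f + l2 r g.
Proof.
rewrite -ler_sqr ?nnegrE ?addr_ge0 ?l2_ge0// sqrrD !l2_sqr.
have := l2_CS r f g.
suff : \sum_(i <- r) cabs (f i + g i) ^+ 2 <= \sum_(i <- r) cabs (f i) ^+ 2
   + (\sum_(i <- r) cabs (f i) * cabs (g i)) *+ 2 + \sum_(i <- r) cabs (g i) ^+ 2 by lra.
rewrite -sumrMnl -!big_split /= ler_sum// => i _.
by rewrite -sqrrD ler_sqr ?nnegrE ?addr_ge0// cabsD.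
Qed.

Lemma l2_scale r (c : R[i]) f : l2 r (fun i => c * f i) = cabs c * l2 r f.
Proof.
rewrite /l2; under eq_bigr do rewrite cabsM exprMn.
by rewrite -mulr_sumr sqrtrM ?sqr_ge0// sqrtr_sqr ger0_norm.
Qed.

Lemma l2_le r f g : {in r, forall i, cabs (f i) <= cabs (g i)} -> l2 r f <= l2 r g.
Proof.
move=> fg; apply: ler_wsqrtr; rewrite big_seq [leRHS]big_seq ler_sum// => i ir.
by rewrite ler_sqr ?nnegrE// fg.
Qed.

Lemma eq_l2 r f g : {in r, f =1 g} -> l2 r f = l2 r g.
Proof.
by move=> fg; congr Num.sqrt; rewrite big_seq [RHS]big_seq; apply: eq_bigr => i /fg->.
Qed.

End Seq.

Lemma mem_zball b j : (j \in zball b) = (`|j| <= b)%N.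
Proof.
rewrite unlock; apply/mapP/idP => [[i + ->]|jb]; first by rewrite mem_iota; lia.
by exists (absz (j + b%:Z)%R); rewrite ?mem_iota; lia.
Qed.

Lemma uniq_zball b : uniq (zball b).
Proof. by rewrite unlock map_inj_uniq ?iota_uniq// => i j; lia. Qed.

Lemma size_zball b : size (zball b) = b.*2.+1.
Proof. by rewrite unlock size_map size_iota. Qed.

Lemma zball0 : zball 0 = [:: 0 : int].
Proof. by rewrite unlock /= subrr. Qed.

Definition supp_in (V : zmodType) (b : nat) (f : int -> V) :=
  forall j, (b < `|j|)%N -> f j = 0.

Lemma supp_inW (V : zmodType) b b' (f : int -> V) : (b <= b')%N ->
  supp_in b f -> supp_in b' f.
Proof. by move=> bb' fb j /(leq_ltn_trans bb')/fb. Qed.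

Definition fin_supp (V : zmodType) (f : int -> V) := exists b, supp_in b f.

Lemma sumZ_zball (V : zmodType) b (f : int -> V) : supp_in b f ->
  \sum_(j \in [set: int]) f j = \sum_(j <- zball b) f j.
Proof.
move=> fb; rewrite (fsbigE (zball b)) ?uniq_zball//.
  by apply: eq_bigl => i; rewrite in_setT.
by move=> i _; rewrite mem_zball -ltnNge => /fb.
Qed.

Lemma bij_addz (k : int) : bijective (fun j : int => j + k).
Proof. by exists (fun j => j - k) => j; rewrite ?addrK ?subrK. Qed.

Lemma sumZ_shift (V : zmodType) (k : int) (f : int -> V) :
  \sum_(j \in [set: int]) f (j + k) = \sum_(j \in [set: int]) f j.
Proof. by rewrite [RHS](reindex_fsbigT (fun j => j + k))//; exact: bij_addz. Qed.

Lemma fin_supp2 (V W : zmodType) (f : int -> V) (g : int -> W) : fin_supp f -> fin_supp g ->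
  exists b, supp_in b f /\ supp_in b g.
Proof.
move=> [b fb] [c gc]; exists (maxn b c); split; apply: supp_inW; last by eassumption.
- exact: leq_maxl.
- by eassumption.
- exact: leq_maxr.
Qed.

Lemma supp_in_shift (V : zmodType) b (f : int -> V) (k : int) :
  supp_in b f -> supp_in (b + `|k|) (fun j => f (j + k)).
Proof. by move=> fb j jb; apply: fb; lia. Qed.

Lemma fin_supp_shift (V : zmodType) (f : int -> V) (k : int) :
  fin_supp f -> fin_supp (fun j => f (j + k)).
Proof. by move=> [b fb]; exists (b + `|k|)%N; exact: supp_in_shift. Qed.

Lemma fin_suppD (V : zmodType) (f g : int -> V) :
  fin_supp f -> fin_supp g -> fin_supp (fun j => f j + g j).
Proof.
move=> ff fg; have [b [fb gb]] := fin_supp2 ff fg.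
by exists b => j jb; rewrite fb// gb// addr0.
Qed.

Lemma fin_suppM (f g : int -> R[i]) :
  fin_supp f -> fin_supp (fun j => g j * f j).
Proof. by move=> [b fb]; exists b => j jb; rewrite fb// mulr0. Qed.

Implicit Types x y z : int -> R[i].

Definition normZ x : R := Num.sqrt (\sum_(j \in [set: int]) cabs (x j) ^+ 2).
Definition dotZ x y : R[i] := \sum_(j \in [set: int]) (x j)^* * y j.

Lemma normZ_ge0 x : 0 <= normZ x. Proof. exact: sqrtr_ge0. Qed.

Lemma normZ_zball b x : supp_in b x -> normZ x = l2 (zball b) x.
Proof.
by move=> xb; rewrite /normZ (@sumZ_zball _ b)// => j /xb ->; rewrite cabs0 expr0n.
Qed.

Lemma normZ_triangle x y : fin_supp x -> fin_supp y ->
  normZ (fun j => x j + y j) <= normZ x + normZ y.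
Proof.
move=> fx fy; have [b [xb yb]] := fin_supp2 fx fy.
rewrite (normZ_zball xb) (normZ_zball yb) (@normZ_zball b) ?l2_triangle// => j jb.
by rewrite xb// yb// addr0.
Qed.

Lemma eq_cabs_normZ x y : (forall j, cabs (x j) = cabs (y j)) -> normZ x = normZ y.
Proof. by move=> xy; congr Num.sqrt; apply: eq_fsbigr => j _; rewrite xy. Qed.

Lemma normZ_scale (c : R[i]) x : normZ (fun j => c * x j) = cabs c * normZ x.
Proof.
rewrite /normZ -(ger0_norm (cabs_ge0 c)) -sqrtr_sqr -sqrtrM ?sqr_ge0//.
by congr Num.sqrt; rewrite mulr_fsumr; apply: eq_fsbigr => j _; rewrite cabsM exprMn.
Qed.

Lemma normZ_shift x k : normZ (fun j => x (j + k)) = normZ x.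
Proof. by rewrite /normZ (sumZ_shift k (fun j => cabs (x j) ^+ 2)). Qed.

Lemma dotZ_zball b x y : supp_in b x -> dotZ x y = \sum_(j <- zball b) (x j)^* * y j.
Proof. by move=> xb; apply: sumZ_zball => j /xb ->; rewrite conjC0 mul0r. Qed.

Lemma dotZ_rngr b x y : supp_in b y -> dotZ x y = \sum_(j <- zball b) (x j)^* * y j.
Proof. by move=> xb; apply: sumZ_zball => j /xb ->; rewrite mulr0. Qed.

Lemma dotZ_CS x y : fin_supp x -> fin_supp y -> cabs (dotZ x y) <= normZ x * normZ y.
Proof.
move=> fx fy; have [b [xb yb]] := fin_supp2 fx fy.
rewrite (dotZ_zball _ xb) (normZ_zball xb) (normZ_zball yb).
rewrite (le_trans (cabs_sum _ _))// (le_trans _ (l2_CS _ _ _))// ler_sum// => i _.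
by rewrite cabsM cabs_conj.
Qed.

Lemma dotZ_self x : fin_supp x -> dotZ x x = (normZ x ^+ 2)%:C%C.
Proof.
move=> [b xb]; rewrite (dotZ_zball _ xb) (normZ_zball xb) l2_sqr rmorph_sum /=.
by apply: eq_bigr => j _; rewrite cabs_sqr.
Qed.

Lemma dotZDl x y z : fin_supp x -> fin_supp y ->
  dotZ (fun j => x j + y j) z = dotZ x z + dotZ y z.
Proof.
move=> fx fy; have [b [xb yb]] := fin_supp2 fx fy.
rewrite (dotZ_zball _ xb) (dotZ_zball _ yb) (@dotZ_zball b) -?big_split /=; last first.
  by move=> j jb; rewrite xb// yb// addr0.
by apply: eq_bigr => j _; rewrite rmorphD mulrDl.
Qed.

Lemma dotZDr x y z : fin_supp x -> fin_supp y ->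
  dotZ z (fun j => x j + y j) = dotZ z x + dotZ z y.
Proof.
move=> fx fy; have [b [xb yb]] := fin_supp2 fx fy.
rewrite (dotZ_rngr _ xb) (dotZ_rngr _ yb) (@dotZ_rngr b) -?big_split /=; last first.
  by move=> j jb; rewrite xb// yb// addr0.
by apply: eq_bigr => j _; rewrite mulrDr.
Qed.

Lemma dotZ_shift x y k : dotZ (fun j => x (j + k)) y = dotZ x (fun j => y (j - k)).
Proof.
rewrite /dotZ -(sumZ_shift k (fun j => (x j)^* * y (j - k))).
by apply: eq_fsbigr => j _; rewrite addrK.
Qed.

Lemma dotZ_mul x y (f : int -> R[i]) :
  dotZ (fun j => f j * x j) y = dotZ x (fun j => (f j)^* * y j).
Proof. by apply: eq_fsbigr => j _; rewrite rmorphM /=; ring. Qed.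

Lemma eq_dotZ x x' y y' : x =1 x' -> y =1 y' -> dotZ x y = dotZ x' y'.
Proof. by move=> xx' yy'; apply: eq_fsbigr => j _; rewrite xx' yy'. Qed.

Lemma eq_normZ x y : x =1 y -> normZ x = normZ y.
Proof. by move=> xy; apply: eq_cabs_normZ => j; rewrite xy. Qed.

End L2.

(** * Localisation by a tent function *)

Section Tent.
Context {R : realType}.

Lemma sum_zball (V : zmodType) L (F : int -> V) :
  \sum_(k <- zball L) F k = F 0 + \sum_(i < L) (F i.+1%:Z + F (- i.+1%:Z)).
Proof.
elim: L => [|L IH].
  by rewrite big_ord0 zball0 big_seq1 addr0.
rewrite big_ord_recr /= addrA -IH.
rewrite (perm_big [:: L.+1%:Z, - L.+1%:Z & zball L]); last first.
  apply: uniq_perm; first exact: uniq_zball.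
    by rewrite !cons_uniq uniq_zball !inE !mem_zball; lia.
  by move=> j; rewrite !inE !mem_zball; lia.
rewrite !big_cons; exact: (etrans (addrA _ _ _) (addrC _ _)).
Qed.

(** Half-width L and slope 1; the tent vanishes from distance L on. *)
Definition tent (L : nat) (k : int) : R := (L - `|k|)%N%:R.

Lemma tent_out L (k : int) : (L <= `|k|)%N -> tent L k = 0.
Proof. by rewrite /tent -subn_eq0 => /eqP->. Qed.

Lemma tent_diff L (k : int) : (tent L (k + 1) - tent L k) ^+ 2 <= 1.
Proof.
have H (m n : nat) : (m <= n.+1)%N -> (n <= m.+1)%N -> (m%:R - n%:R) ^+ 2 <= (1 : R).
  by rewrite -(ler_nat R) -[(n <= _)%N](ler_nat R) -!natr1 => *; nra.
by apply: H; lia.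
Qed.

(** The sum of the squares is L (2 L^2 + 1) / 3.  Against the 2 L unit
    increments of the tent, this makes the relative cost of the cut-off of
    order 1/L. *)
Lemma tent_sum L : (0 < L)%N ->
  2 * L%:R ^+ 3 <= 3 * \sum_(k <- zball L) tent L k ^+ 2.
Proof.
move=> L0; rewrite sum_zball /tent absz0 subn0.
have -> : \sum_(i < L) ((L - `|i.+1%:Z|)%N%:R ^+ 2 + (L - `|- i.+1%:Z|)%N%:R ^+ 2 : R)
   = \sum_(i < L) (i%:R ^+ 2 + i%:R ^+ 2).
  rewrite (reindex_inj rev_ord_inj) /=; apply: eq_bigr => i _.
  by rewrite !subnSK// !subKn// ltnW.
have H n : 3 * \sum_(i < n) (i%:R ^+ 2 + i%:R ^+ 2 : R) = 2 * n%:R ^+ 3 - 3 * n%:R ^+ 2 + n%:R.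
  elim: n => [|n IH]; first by rewrite big_ord0; ring.
  by rewrite big_ord_recr /= mulrDr IH -natr1; ring.
by rewrite mulrDr H; have : (0:R) <= L%:R by []; nra.
Qed.

End Tent.

Section Jacobi.
Context {R : realType}.
Implicit Types (xi f : int -> R[i]) (d : int -> R[i]) (a b lam : R[i]).

(** In the position representation lam - H is a Jacobi operator: V and its
    adjoint act diagonally, U and its adjoint by shifts. *)
Definition jacobi (a a' : R[i]) d xi (j : int) : R[i] :=
  d j * xi j - a * xi (j + 1) - a' * xi (j - 1).

Lemma fin_supp_jacobi (a a' : R[i]) d xi : fin_supp xi -> fin_supp (jacobi a a' d xi).
Proof.
move=> [n xn]; exists n.+1 => j jn; rewrite /jacobi !xn ?mulr0 ?subr0//; lia.
Qed.

(** Only the diagonal entries on the support of xi matter, so that a local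
    approximation of the diagonal suffices for a localised vector. *)
Lemma jacobi_diag_pert (a a' : R[i]) d (d' : int -> R[i]) xi e : fin_supp xi ->
  (forall j, xi j != 0 -> cabs (d j - d' j) <= e) ->
  normZ (jacobi a a' d xi) <= normZ (jacobi a a' d' xi) + e * normZ xi.
Proof.
move=> fx dd.
have -> : normZ (jacobi a a' d xi) = normZ (fun j => jacobi a a' d' xi j + (d j - d' j) * xi j).
  by apply: eq_normZ => j; rewrite /jacobi; ring.
apply: le_trans (normZ_triangle (fin_supp_jacobi _ _ _ fx) (fin_suppM _ fx)) _.
rewrite lerD2l.
have [e0|e0] := leP 0 e.
  rewrite -{1}(ger0_norm e0) -cabs_real -normZ_scale.
  have [m xm] := fx.
  rewrite !(@normZ_zball _ m) ?l2_le//; last first.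
  - by move=> j /xm->; rewrite mulr0.
  - by move=> j /xm->; rewrite mulr0.
  - move=> j _; rewrite !cabsM; have [->|xj] := eqVneq (xi j) 0; first by rewrite cabs0 !mulr0.
    by rewrite ler_wpM2r// cabs_real ger0_norm// dd.
have x0 : xi =1 (fun=> 0).
  move=> j; apply/eqP/negPn/negP => /dd /(le_trans (cabs_ge0 _)).
  by rewrite leNgt e0.
have nz0 f : (forall j, f j = 0) -> normZ f = 0.
  by move=> f0; rewrite (@normZ_zball _ 0) ?zball0 /l2 ?big_seq1 ?f0 ?cabs0 ?expr0n ?sqrtr0// => j _.
by rewrite (nz0 xi)// nz0 ?mulr0// => j; rewrite x0 mulr0.
Qed.

Lemma l2_allpairs (I J : eqType) (r : seq I) (s : seq J) (F : I -> J -> R[i]) :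
  l2 [seq (w, j) | w <- r, j <- s] (fun p => F p.1 p.2) ^+ 2 =
  \sum_(w <- r) l2 s (F w) ^+ 2.
Proof. by rewrite l2_sqr big_allpairs; apply: eq_bigr => w _; rewrite l2_sqr. Qed.

(** The localisation principle.  If the operator is bounded below by c on
    every tent-shaped piece of xi, it is bounded below on xi itself up to 6
    M / L.  Summing the squares over all positions w of the tent recovers
    the norms of xi and of its image, by invariance under translation; the
    commutators of the shifts with the tent contribute its increments, and
    sqrt (2 L + 1) <= (3 / L) sqrt (sum of the squared tent) bounds their
    share.  The list r of positions is an interval for finitely supported xi
    and a period for periodic xi. *)
Lemma tent_average (r : seq int) L (a a' : R[i]) (M : R) d xi c :
  (0 < L)%N -> cabs a <= M -> cabs a' <= M ->
  (forall k, (`|k| <= L.+1)%N -> l2 r (fun w => xi (w + k)) = l2 r xi) ->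
  (forall k, (`|k| <= L.+1)%N ->
     l2 r (fun w => jacobi a a' d xi (w + k)) = l2 r (jacobi a a' d xi)) ->
  (forall w, w \in r ->
     c * normZ (fun j => (tent L j)%:C%C * xi (j + w)) <=
     normZ (jacobi a a' (fun j => d (j + w)) (fun j => (tent L j)%:C%C * xi (j + w)))) ->
  (c - 6 * M / L%:R) * l2 r xi <= l2 r (jacobi a a' d xi).
Proof.
move=> L0 aM a'M invx inve loc.
have M0 : 0 <= M by apply: le_trans aM.
have Lr : 0 < L%:R :> R by rewrite ltr0n.
have [c0|c0] := leP c 0.
  apply: le_trans (l2_ge0 _ _); rewrite mulr_le0_ge0 ?l2_ge0//.
  by rewrite subr_le0 (le_trans c0)// divr_ge0// mulr_ge0.
pose P := [seq (w, j) | w <- r, j <- zball L].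
pose f w j : R[i] := (tent L j)%:C%C * xi (j + w).
pose g w := jacobi a a' (fun j => d (j + w)) (f w).
have fsupp w : supp_in L (f w).
  by move=> j jL; rewrite /f tent_out ?mul0r// ltnW.
have fsupp' w j : (L <= `|j|)%N -> f w j = 0.
  by move=> jL; rewrite /f tent_out ?mul0r.
have gsupp w : supp_in L (g w).
  by move=> j jL; rewrite /g /jacobi !fsupp' ?mulr0 ?subr0//; lia.
set S := \sum_(k <- zball L) (tent L k : R) ^+ 2.
have S0 : 0 <= S by apply: sumr_ge0 => k _; exact: sqr_ge0.
have weight (u : int -> R) (h : int -> R[i]) (m : int) : (`|m| <= 1)%N ->
    (forall k, (`|k| <= L.+1)%N -> l2 r (fun w => h (w + k)) = l2 r h) ->
    l2 P (fun p => (u p.2)%:C%C * h (p.2 + p.1 + m)) =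
    Num.sqrt (\sum_(k <- zball L) u k ^+ 2) * l2 r h.
  move=> m1 invh; rewrite /l2 /P big_allpairs exchange_big /= -sqrtrM ?sumr_ge0//; last first.
    by move=> k _; exact: sqr_ge0.
  congr Num.sqrt; rewrite mulr_suml big_seq [RHS]big_seq; apply: eq_bigr => k.
  rewrite mem_zball => kL.
  have := invh (k + m); rewrite -[l2 r h]/(l2 r h) => /(_ _) ih.
  have {}ih : l2 r (fun w => h (w + (k + m))) ^+ 2 = l2 r h ^+ 2 by rewrite ih//; lia.
  move: ih; rewrite !l2_sqr => <-; rewrite mulr_sumr; apply: eq_bigr => w _.
  rewrite cabsM exprMn cabs_real real_normK ?num_real//; congr (_ * cabs (h _) ^+ 2); lia.
have lF : l2 P (fun p => f p.1 p.2) = Num.sqrt S * l2 r xi.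
  rewrite -(@weight (tent L) xi 0)//; apply: eq_l2 => p _ /=; by rewrite /f addr0.
have lH : l2 P (fun p => (tent L p.2)%:C%C * jacobi a a' d xi (p.2 + p.1)) = Num.sqrt S * l2 r (jacobi a a' d xi).
  by rewrite -(@weight (tent L) (jacobi a a' d xi) 0)//; apply: eq_l2 => p _ /=; rewrite addr0.
have lFG : c * l2 P (fun p => f p.1 p.2) <= l2 P (fun p => g p.1 p.2).
  rewrite -ler_sqr ?nnegrE ?mulr_ge0 ?l2_ge0 ?(ltW c0)// exprMn !l2_allpairs mulr_sumr.
  rewrite big_seq [leRHS]big_seq ler_sum// => w wr.
  rewrite -!normZ_zball// -exprMn ler_sqr ?nnegrE ?mulr_ge0 ?normZ_ge0 ?(ltW c0)//.
  exact: loc.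
pose G1 (p : int * int) := - a * ((tent L (p.2 + 1) - tent L p.2)%:C%C * xi (p.2 + p.1 + 1)).
pose G2 (p : int * int) := - a' * ((tent L (p.2 - 1) - tent L p.2)%:C%C * xi (p.2 + p.1 - 1)).
have gE : l2 P (fun p => g p.1 p.2) =
   l2 P (fun p => (tent L p.2)%:C%C * jacobi a a' d xi (p.2 + p.1) + (G1 p + G2 p)).
  apply: eq_l2 => -[w j] _ /=; rewrite /g /jacobi /f /G1 /G2 /= !rmorphB /=.
  have -> : j + 1 + w = j + w + 1 by ring.
  have -> : j - 1 + w = j + w - 1 by ring.
  ring.
have cb (u : int -> R) (m : int) (aa : R[i]) : (`|m| <= 1)%N -> cabs aa <= M ->
   (forall k, u k ^+ 2 <= 1) ->
   l2 P (fun p => - aa * ((u p.2)%:C%C * xi (p.2 + p.1 + m)))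
   <= M * (Num.sqrt (L.*2.+1)%:R * l2 r xi).
  move=> m1 aaM u1; rewrite l2_scale weight// cabsN ler_pM ?mulr_ge0 ?l2_ge0 ?sqrtr_ge0//.
  rewrite ler_wpM2r ?l2_ge0// ler_wsqrtr//.
  apply: (@le_trans _ _ (\sum_(k <- zball L) 1)); first exact: ler_sum.
  by rewrite big_const_seq count_predT size_zball iter_addr_0.
have b1 : l2 P G1 <= M * (Num.sqrt (L.*2.+1)%:R * l2 r xi).
  by apply: (cb (fun k => tent L (k + 1) - tent L k) 1) => // k; exact: tent_diff.
have b2 : l2 P G2 <= M * (Num.sqrt (L.*2.+1)%:R * l2 r xi).
  apply: (cb (fun k => tent L (k - 1) - tent L k) (-1)) => // k.
  by rewrite -sqrrN opprB -{1}(subrK 1 k); exact: tent_diff.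
have tri : c * (Num.sqrt S * l2 r xi) <= Num.sqrt S * l2 r (jacobi a a' d xi)
     + 2 * (M * (Num.sqrt (L.*2.+1)%:R * l2 r xi)).
  rewrite -lF (le_trans lFG)// gE (le_trans (l2_triangle _ _ _))// lH lerD2l.
  rewrite (le_trans (l2_triangle _ _ _))//; lra.
have sS : Num.sqrt (L.*2.+1)%:R <= 3 / L%:R * Num.sqrt S.
  rewrite -ler_sqr ?nnegrE ?mulr_ge0 ?divr_ge0 ?sqrtr_ge0// exprMn !sqr_sqrtr//.
  have := @tent_sum R L L0; rewrite -/S => hS.
  rewrite expr_div_n mulrAC ler_pdivlMr ?exprn_gt0//.
  rewrite -muln2 -addn1 natrD natrM.
  have : 1 <= L%:R :> R by rewrite ler1n.
  by move: hS; set l := L%:R; nra.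
have sqS : 0 < Num.sqrt S.
  rewrite sqrtr_gt0; have := @tent_sum R L L0; rewrite -/S => hS.
  by have := exprn_gt0 3 Lr; lra.
rewrite -(ler_pM2l sqS).
have := l2_ge0 r xi; move: tri sS; set q1 := Num.sqrt S; set q2 := Num.sqrt _.
set N := l2 r xi; move=> tri sS N0.
have : M * (q2 * N) <= M * (3 / L%:R * q1 * N) by rewrite ler_wpM2l// ler_wpM2r.
have -> : q1 * ((c - 6 * M / L%:R) * N) = c * (q1 * N) - 2 * (M * (3 / L%:R * q1 * N)) by ring.
lra.
Qed.

End Jacobi.

(** * Periodic sequences and the comparison with finitely supported ones *)

Section PeriodicSums.

Definition iotaz (q : nat) : seq int := [seq i%:Z | i <- iota 0 q].

Lemma mem_iotaz q j : (j \in iotaz q) = (0 <= j < q%:Z).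
Proof.
apply/mapP/idP => [[i + ->]|jq]; first by rewrite mem_iota; lia.
by exists (absz (j : int)); rewrite ?mem_iota; lia.
Qed.

Lemma uniq_iotaz q : uniq (iotaz q).
Proof. by rewrite map_inj_uniq ?iota_uniq// => i j; lia. Qed.

Definition periodic_by (T : Type) (q : nat) (x : int -> T) := forall m, x (m + q%:Z) = x m.

Lemma sum_iotaz (V : zmodType) q (F : int -> V) :
  \sum_(i <- iotaz q) F i = \sum_(i < q) F i%:Z.
Proof. by rewrite big_map -{1}[q]subn0 big_mkord. Qed.

Lemma periodic_sum_shift (V : zmodType) q (g : int -> V) (k : int) :
  periodic_by q g -> \sum_(i <- iotaz q) g (i + k) = \sum_(i <- iotaz q) g i.
Proof.
move=> gq.
have step (h : int -> V) : periodic_by q h -> \sum_(i <- iotaz q) h (i + 1) = \sum_(i <- iotaz q) h i.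
  move=> hq; rewrite !sum_iotaz.
  case: q hq {gq} => [|q] hq; first by rewrite !big_ord0.
  rewrite big_ord_recr [RHS]big_ord_recl /= addrC; congr (_ + _).
    by rewrite -[RHS]hq; congr h; lia.
  by apply: eq_bigr => i _; congr h; rewrite /bump /=; lia.
have pn (n : nat) : forall h : int -> V, periodic_by q h ->
    \sum_(i <- iotaz q) h (i + n%:Z) = \sum_(i <- iotaz q) h i.
  elim: n => [|n IH] h hq; first by apply: eq_bigr => i _; rewrite addr0.
  rewrite -(step h hq) -(IH (fun i => h (i + 1))); last first.
    by move=> m; rewrite -[in RHS]hq; congr h; lia.
  by apply: eq_bigr => i _; congr h; lia.
case: k => n; first exact: pn.
rewrite -(pn n.+1 (fun i => g (i + Negz n))); last first.
  by move=> m; rewrite -[in RHS]gq; congr g; lia.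
by apply: eq_bigr => i _; congr g; rewrite NegzE; lia.
Qed.

Lemma modz_eqP (n r k : int) (q : nat) : n = k * q%:Z + r -> 0 <= r < q%:Z ->
  (n %% q%:Z)%Z = r.
Proof. by move=> -> rq; rewrite modzMDl modz_small//; lia. Qed.

Lemma modz_bounds (n : int) (q : nat) : (0 < q)%N -> 0 <= (n %% q%:Z)%Z < q%:Z.
Proof. by move=> q0; rewrite modz_ge0 ?ltz_pmod//; lia. Qed.

Lemma modz_succ (n : int) (q : nat) : (0 < q)%N ->
  ((n + 1) %% q%:Z)%Z = if (n %% q%:Z)%Z + 1 == q%:Z then 0 else (n %% q%:Z)%Z + 1.
Proof.
move=> q0; have := modz_bounds n q0; have := divz_eq n q%:Z.
set r := (n %% _)%Z; set k := (n %/ _)%Z => nE rq; case: ifP => /eqP rE.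
  by apply: (@modz_eqP _ _ (k + 1)); [rewrite nE; nia|lia].
by apply: (@modz_eqP _ _ k); [rewrite nE; lia|lia].
Qed.

Lemma modz_pred (n : int) (q : nat) : (0 < q)%N ->
  ((n - 1) %% q%:Z)%Z = if (n %% q%:Z)%Z == 0 then q%:Z - 1 else (n %% q%:Z)%Z - 1.
Proof.
move=> q0; have := modz_bounds n q0; have := divz_eq n q%:Z.
set r := (n %% _)%Z; set k := (n %/ _)%Z => nE rq; case: ifP => /eqP rE.
  by apply: (@modz_eqP _ _ (k - 1)); [rewrite nE; nia|lia].
by apply: (@modz_eqP _ _ k); [rewrite nE; lia|lia].
Qed.

(** Wrapping the line around a circle of length q is a bijection from any
    window of q consecutive integers. *)
Lemma fold_sum (V : zmodType) (q L : nat) (G : int -> V) (k : int) : (0 < q)%N ->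
  (forall j, ~~ (- L%:Z <= j < q%:Z - L%:Z) -> G j = 0) ->
  \sum_(i <- iotaz q) G (((i + k) %% q%:Z)%Z - L%:Z) = \sum_(j \in [set: int]) G j.
Proof.
move=> q0 Gs; rewrite (@periodic_sum_shift _ _ (fun i => G ((i %% q%:Z)%Z - L%:Z))); last first.
  by move=> m; rewrite modzDr.
rewrite -(sumZ_shift (- L%:Z)) (fsbigE (iotaz q)) ?uniq_iotaz//=.
  rewrite [RHS](eq_bigl xpredT); last by move=> i; rewrite in_setT.
  rewrite big_seq [RHS]big_seq; apply: eq_bigr => i; rewrite mem_iotaz => iq.
  by rewrite modz_small//; lia.
by move=> i _; rewrite mem_iotaz => iq; apply: Gs; lia.
Qed.

End PeriodicSums.

Section Transfer.
Context {R : realType}.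
Variables (a a' b b' lam : R[i]) (M : R).
Hypotheses (aM : cabs a <= M) (a'M : cabs a' <= M) (bM : cabs b <= M) (b'M : cabs b' <= M).
Implicit Types (xi x : int -> R[i]) (theta t c : R) (p q : nat).

(** The diagonal of lam - H at a site where V acts as e(u). *)
Definition pdiag (u : R) : R[i] := lam - b * expi2pi u - b' * expi2pi (- u).

Let M0 : 0 <= M. Proof. exact: le_trans aM. Qed.

Lemma pdiag_lip (u v : R) : cabs (pdiag u - pdiag v) <= 32 * M * `|u - v|.
Proof.
have -> : pdiag u - pdiag v = - (b * (expi2pi u - expi2pi v))
     - b' * (expi2pi (- u) - expi2pi (- v)) by rewrite /pdiag; ring.
apply: le_trans (cabsB _ _) _; rewrite cabsN !cabsM.
have h1 : cabs b * cabs (expi2pi u - expi2pi v) <= M * (16 * `|u - v|).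
  by rewrite ler_pM// expi2pi_lip.
have h2 : cabs b' * cabs (expi2pi (- u) - expi2pi (- v)) <= M * (16 * `|u - v|).
  by rewrite ler_pM// (le_trans (expi2pi_lip _ _))// -opprD normrN.
lra.
Qed.

Lemma pdiagDint (u : R) (m : int) : pdiag (u + m%:~R) = pdiag u.
Proof. by rewrite /pdiag opprD -mulrNz !expi2piDint. Qed.

Definition rep_op theta t := jacobi a a' (fun j => pdiag (theta * j%:~R + t)).
Definition per_op p q := jacobi a a' (fun j => pdiag (p%:R * j%:~R / q%:R)).

Lemma per_op_periodic p q x : (0 < q)%N -> periodic_by q x -> periodic_by q (per_op p q x).
Proof.
move=> q0 xq m; rewrite /per_op /jacobi xq.
have -> : m + q%:Z + 1 = m + 1 + q%:Z by ring.
have -> : m + q%:Z - 1 = m - 1 + q%:Z by ring.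
rewrite !xq; congr (_ * _ - _ - _).
rewrite -[RHS](pdiagDint _ p); congr pdiag; rewrite intrD /= mulrDr mulrDl; congr (_ + _).
by rewrite mulfK// pnatr_eq0 -lt0n.
Qed.

Lemma l2_periodic_shift q x (k : int) : periodic_by q x ->
  l2 (iotaz q) (fun w => x (w + k)) = l2 (iotaz q) x.
Proof.
move=> xq; rewrite /l2 (@periodic_sum_shift _ _ (fun w => cabs (x w) ^+ 2))// => m.
by rewrite xq.
Qed.

Lemma fin_supp_tent L xi (w : int) : fin_supp (fun j => (tent L j)%:C%C * xi (j + w)).
Proof. by exists L => j jL; rewrite tent_out ?mul0r// ltnW. Qed.

Lemma tent_neq0 L xi (w j : int) : (tent L j)%:C%C * xi (j + w) != 0 -> (`|j| < L)%N.
Proof.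
by rewrite ltnNge; apply: contraNN => jL; rewrite tent_out ?mul0r.
Qed.

Lemma natz_absz_le (j : int) (n : nat) : (`|j| <= n)%N -> `|j%:~R| <= n%:R :> R.
Proof. by move=> jn; rewrite -intr_norm -abszE -(pmulrn 1) ler_nat. Qed.

(** A periodic vector is cut by tents of half-width q.  Within such a tent
    theta j + t differs from p (j + w) / q by at most 1/q, provided that the
    phase is t = p w / q. *)
Lemma rep_to_matrix theta p q c : (0 < q)%N ->
  `|theta - p%:R / q%:R| <= (q%:R ^+ 2)^-1 ->
  (forall t xi, fin_supp xi -> c * normZ xi <= normZ (rep_op theta t xi)) ->
  forall x, periodic_by q x -> (c - 38 * M / q%:R) * l2 (iotaz q) x <= l2 (iotaz q) (per_op p q x).
Proof.
move=> q0 thq hyp x xq.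
have Q0 : 0 < q%:R :> R by rewrite ltr0n.
have -> : c - 38 * M / q%:R = (c - 32 * M / q%:R) - 6 * M / q%:R by ring.
apply: tent_average => //.
- by move=> k _; exact: l2_periodic_shift.
- by move=> k _; apply: l2_periodic_shift; exact: per_op_periodic.
move=> w _; set f := fun j => _.
have ff : fin_supp f by exact: fin_supp_tent.
rewrite mulrBl lerBlDr.
apply: le_trans (hyp (p%:R * w%:~R / q%:R) f ff) _.
apply: jacobi_diag_pert => // j /tent_neq0 jq.
apply: le_trans (pdiag_lip _ _) _.
rewrite ler_wpM2l ?mulr_ge0//.
have -> : theta * j%:~R + p%:R * w%:~R / q%:R - p%:R * (j + w)%:~R / q%:R
   = (theta - p%:R / q%:R) * j%:~R.
  by rewrite intrD; field; rewrite gt_eqF.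
rewrite normrM (le_trans (ler_pM _ _ thq (natz_absz_le (ltnW jq))))//.
by rewrite expr2 invfM -mulrA mulVf ?mulr1// gt_eqF.
Qed.

(** A vector living on fewer than q consecutive sites, with one free site at
    each end, is a vector on the circle of length q: neither the shift nor
    its adjoint moves anything across the seam.  The integer s rotates the
    circle. *)
Lemma fold_lower p q c (s : int) L f : (0 < q)%N -> (L.*2 < q)%N ->
  (forall x, periodic_by q x -> c * l2 (iotaz q) x <= l2 (iotaz q) (per_op p q x)) ->
  (forall j : int, (L <= `|j|)%N -> f j = 0) ->
  c * normZ f <= normZ (jacobi a a' (fun j => pdiag (p%:R * (j + s)%:~R / q%:R)) f).
Proof.
move=> q0 Lq hyp f0.
set g := jacobi _ _ _ f.
have g0 (j : int) : (L < `|j|)%N -> g j = 0.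
  by move=> jL; rewrite /g /jacobi !f0 ?mulr0 ?subr0//; lia.
pose J (m : int) : int := ((m + (L%:Z - s)) %% q%:Z)%Z - L%:Z.
have Jq m : J (m + q%:Z) = J m.
  rewrite /J; have -> : m + q%:Z + (L%:Z - s) = (m + (L%:Z - s)) + q%:Z by ring.
  by rewrite modzDr.
have nJ (h : int -> R[i]) : (forall j : int, (L < `|j|)%N -> h j = 0) ->
    l2 (iotaz q) (fun m => h (J m)) = normZ h.
  move=> h0; rewrite /l2 /J; congr Num.sqrt.
  apply: (@fold_sum _ q L (fun j => cabs (h j) ^+ 2)) => // j jL.
  by rewrite h0 ?cabs0 ?expr0n//; lia.
have := hyp (fun m => f (J m)) (fun m => congr1 f (Jq m)).
rewrite (nJ f); last by move=> j /ltnW/f0.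
rewrite -(nJ g)//; congr (_ <= _); apply: eq_l2 => m _.
rewrite /per_op /g /jacobi; congr (_ * _ - _ * _ - _ * _).
- have := divz_eq (m + (L%:Z - s)) q%:Z; rewrite /J.
  set r := (_ %% _)%Z; set k := (_ %/ _)%Z => mE.
  have -> : m = r - L%:Z + s + k * q%:Z by lia.
  rewrite intrD mulrDr mulrDl -[RHS](pdiagDint _ (p%:Z * k)); congr pdiag; congr (_ + _).
  by rewrite !intrM -!pmulrn; field; rewrite pnatr_eq0 -lt0n.
- rewrite /J (_ : m + 1 + _ = m + (L%:Z - s) + 1); last by ring.
  rewrite modz_succ//.
  have := modz_bounds (m + (L%:Z - s)) q0; case: ifP => /eqP rE rq; last by congr f; lia.
  by rewrite !f0//; lia.
- rewrite /J (_ : m - 1 + _ = m + (L%:Z - s) - 1); last by ring.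
  rewrite modz_pred//.
  have := modz_bounds (m + (L%:Z - s)) q0; case: ifP => /eqP rE rq; last by congr f; lia.
  by rewrite !f0//; lia.
Qed.

Lemma jacobi_upper d B xi : fin_supp xi -> (forall j, cabs (d j) <= B) ->
  normZ (jacobi a a' d xi) <= (B + 2 * M) * normZ xi.
Proof.
move=> fx dB.
have -> : normZ (jacobi a a' d xi) = normZ (fun j => (d j * xi j + (- a) * xi (j + 1)) + (- a') * xi (j - 1)).
  by apply: eq_normZ => j; rewrite /jacobi; ring.
have f1 : fin_supp (fun j => d j * xi j) by exact: fin_suppM.
have f2 : fin_supp (fun j => - a * xi (j + 1)) by apply: fin_suppM; exact: fin_supp_shift.
have f3 : fin_supp (fun j => - a' * xi (j - 1)) by apply: fin_suppM; exact: fin_supp_shift.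
apply: le_trans (normZ_triangle (fin_suppD f1 f2) f3) _.
apply: le_trans (lerD (normZ_triangle f1 f2) (lexx _)) _.
rewrite !normZ_scale !normZ_shift !cabsN.
have h1 : normZ (fun j => d j * xi j) <= B * normZ xi.
  have B0 : 0 <= B by apply: le_trans (dB 0).
  rewrite -{1}(ger0_norm B0) -cabs_real -normZ_scale.
  have [m xm] := fx; rewrite !(@normZ_zball _ m) ?l2_le//.
  - by move=> j _; rewrite !cabsM ler_wpM2r// cabs_real ger0_norm.
  - by move=> j /xm->; rewrite mulr0.
  - by move=> j /xm->; rewrite mulr0.
have h2 := ler_wpM2r (normZ_ge0 xi) aM.
have h3 := ler_wpM2r (normZ_ge0 xi) a'M.
lra.
Qed.

Lemma pdiag_upper u : cabs (pdiag u) <= cabs lam + 2 * M.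
Proof.
have h1 : cabs (b * expi2pi u) <= M by rewrite cabsM cabs_expi2pi mulr1.
have h2 : cabs (b' * expi2pi (- u)) <= M by rewrite cabsM cabs_expi2pi mulr1.
have h3 := cabsB (lam - b * expi2pi u) (b' * expi2pi (- u)).
have h4 := cabsB lam (b * expi2pi u).
rewrite /pdiag; lra.
Qed.

(** The four terms of H have total norm at most 4 M. *)
Lemma rep_op_lower theta t xi : fin_supp xi ->
  (cabs lam - 4 * M) * normZ xi <= normZ (rep_op theta t xi).
Proof.
move=> fx.
have e0 : normZ (fun j => lam * xi j) <= normZ (rep_op theta t xi)
     + normZ (jacobi a a' (fun j => pdiag (theta * j%:~R + t) - lam) xi).
  have -> : normZ (jacobi a a' (fun j => pdiag (theta * j%:~R + t) - lam) xi) =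
     normZ (fun j => -1 * jacobi a a' (fun j => pdiag (theta * j%:~R + t) - lam) xi j).
    by rewrite normZ_scale cabsN cabs1 mul1r.
  apply: le_trans (normZ_triangle (fin_supp_jacobi _ _ _ fx) (fin_suppM _ (fin_supp_jacobi _ _ _ fx))).
  by rewrite le_eqVlt; apply/orP; left; apply/eqP; apply: eq_normZ => j; rewrite /rep_op /jacobi; ring.
have e1 : normZ (jacobi a a' (fun j => pdiag (theta * j%:~R + t) - lam) xi) <= (2 * M + 2 * M) * normZ xi.
  apply: jacobi_upper => // j; rewrite /pdiag.
  set u := theta * _ + t.
  have h1 : cabs (b * expi2pi u) <= M by rewrite cabsM cabs_expi2pi mulr1.
  have h2 : cabs (b' * expi2pi (- u)) <= M by rewrite cabsM cabs_expi2pi mulr1.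
  have h3 := cabsB (- (b * expi2pi u)) (b' * expi2pi (- u)).
  rewrite cabsN in h3.
  by rewrite (_ : _ - lam = - (b * expi2pi u) - b' * expi2pi (- u)); [lra|ring].
move: e0; rewrite normZ_scale; lra.
Qed.

Lemma lower_matrix_le p q c : (0 < q)%N ->
  (forall x, periodic_by q x -> c * l2 (iotaz q) x <= l2 (iotaz q) (per_op p q x)) ->
  c <= cabs lam + 4 * M.
Proof.
move=> q0 /(_ (fun=> 1) (fun=> erefl)) h.
have l1 : 0 < l2 (iotaz q) (fun=> 1 : R[i]).
  rewrite sqrtr_gt0 cabs1 expr1n sum_iotaz sumr_const card_ord; by rewrite ltr0n.
rewrite -(ler_pM2r l1) (le_trans h)//.
have -> : (cabs lam + 4 * M) * l2 (iotaz q) (fun=> 1 : R[i]) = l2 (iotaz q) (fun=> (cabs lam + 4 * M)%:C%C * 1 : R[i]).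
  by rewrite l2_scale cabs_real ger0_norm// addr_ge0// mulr_ge0.
apply: l2_le => j _; rewrite mulr1 cabs_real ger0_norm ?addr_ge0 ?mulr_ge0//.
rewrite /per_op /jacobi /= !mulr1.
set u := p%:R * _ / _; have h1 := pdiag_upper u; have := aM; have := a'M; have h2 := cabsB (pdiag u - a) a'.
have h3 := cabsB (pdiag u) a; lra.
Qed.

Lemma supp_in_jacobi d n xi : supp_in n xi -> supp_in n.+1 (jacobi a a' d xi).
Proof.
move=> xn j jn; rewrite /jacobi.
by rewrite (xn j) ?(xn (j + 1)) ?(xn (j - 1)) ?mulr0 ?subr0//; lia.
Qed.

Lemma l2_zball_shift n m (h : int -> R[i]) (k : int) : supp_in n h ->
  (n + `|k| <= m)%N -> l2 (zball m) (fun w => h (w + k)) = l2 (zball m) h.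
Proof.
move=> hn km; rewrite -!normZ_zball ?normZ_shift//.
  by apply: supp_inW hn; lia.
by apply: supp_inW (supp_in_shift (k := k) hn).
Qed.

Let room n L k : (k <= L.+1)%N -> (n.+1 + k <= n + L + 3)%N.
Proof. lia. Qed.

(** Cut by tents narrower than q and fold each piece onto the circle.  The
    rotation s is chosen with p s congruent to the integer part of q (theta
    w + t), so that the clock phase matches the true one up to 1/q at the
    centre w of the tent and up to 2/q on the tent.  For q <= 25 the claim
    holds for reasons of size, as both operators are within 4 M of the
    scalar lam. *)
Lemma matrix_to_rep theta p q c : (0 < q)%N -> coprime p q ->
  `|theta - p%:R / q%:R| <= (q%:R ^+ 2)^-1 ->
  (forall x, periodic_by q x -> c * l2 (iotaz q) x <= l2 (iotaz q) (per_op p q x)) ->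
  forall t xi, fin_supp xi -> (c - 204 * M / q%:R) * normZ xi <= normZ (rep_op theta t xi).
Proof.
move=> q0 cpq thq hyp t xi fx.
have Q0 : 0 < q%:R :> R by rewrite ltr0n.
have iQ : 0 <= M / q%:R by rewrite divr_ge0.
(* From q = 26 on, the tent of half-width (q - 1)/2 costs at most 13 M / q. *)
have [q25|q26] := leqP q 25.
  apply: le_trans (rep_op_lower _ _ fx); rewrite ler_wpM2r ?normZ_ge0//.
  have cl := lower_matrix_le q0 hyp.
  have : 8 * M <= 204 * M / q%:R.
    rewrite ler_pdivlMr//; have : q%:R <= 25 :> R by rewrite ler_nat.
    by have := M0; nra.
  lra.
pose L := q.-1./2.
have L0 : (0 < L)%N by rewrite /L; lia.
have Lq : (L.*2 < q)%N by rewrite /L; lia.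
have L26 : (26 * L >= 12 * q)%N by rewrite /L; lia.
have LqW : (L <= q)%N by rewrite (leq_trans _ (ltnW Lq))// -addnn leq_addr.
clearbody L.
have Lr : 0 < L%:R :> R by rewrite ltr0n.
have LM : 6 * M / L%:R <= 13 * M / q%:R.
  rewrite ler_pdivrMr// mulrAC ler_pdivlMr//.
  have : 12 * q%:R <= 26 * L%:R :> R by rewrite -!natrM ler_nat.
  by have := M0; nra.
have [n xn] := fx.
have fr : fin_supp (rep_op theta t xi) by exact: fin_supp_jacobi.
pose r := zball (n + L + 3).
have sr : supp_in n.+1 (rep_op theta t xi) by exact: supp_in_jacobi.
have E : (c - 64 * M / q%:R - 6 * M / L%:R) * l2 r xi <= l2 r (rep_op theta t xi).
  apply: tent_average => //.
  - move=> k kL; apply: (l2_zball_shift xn).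
    by rewrite (leq_trans _ (room n kL))// leq_add2r.
  - by move=> k kL; apply: (l2_zball_shift sr); exact: room.
  move=> w _; set f := fun j => _.
  have ff : fin_supp f by exact: fin_supp_tent.
  have f0 (j : int) : (L <= `|j|)%N -> f j = 0 by move=> jL; rewrite /f tent_out ?mul0r.
  pose u := theta * w%:~R + t.
  pose r0 := Num.floor (q%:R * u).
  (* By Bezout, the multiples of p represent every class modulo q. *)
  have [s [k sE]] : exists s k : int, p%:Z * s = r0 + k * q%:Z.
    have [x [y xy]] := Bezoutz p%:Z q%:Z.
    have g1 : gcdz p%:Z q%:Z = 1 by rewrite /gcdz /=; move/eqP: cpq => ->.
    exists (r0 * x), (- (r0 * y)); rewrite g1 in xy.
    have -> : p%:Z * (r0 * x) = r0 * (x * p%:Z + y * q%:Z) - r0 * y * q%:Z by ring.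
    by rewrite xy; ring.
  rewrite mulrBl lerBlDr.
  apply: le_trans (fold_lower s q0 Lq hyp f0) _.
  apply: jacobi_diag_pert => // j /tent_neq0 jL.
  rewrite -(pdiagDint (theta * _ + t) k) cabs_distC.
  apply: le_trans (pdiag_lip _ _) _.
  have -> : 64 * M / q%:R = 32 * M * (2 / q%:R) by ring.
  rewrite ler_wpM2l ?mulr_ge0//.
  have sR : p%:R * s%:~R = r0%:~R + k%:~R * q%:R :> R.
    by have := congr1 (fun m : int => m%:~R : R) sE; rewrite !(intrD, intrM) -!pmulrn.
  have -> : theta * (j + w)%:~R + t + k%:~R - p%:R * (j + s)%:~R / q%:R =
     (u - r0%:~R / q%:R) + (theta - p%:R / q%:R) * j%:~R.
    have -> : p%:R * (j + s)%:~R / q%:R = p%:R * j%:~R / q%:R + (p%:R * s%:~R) / q%:R :> R.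
      by rewrite intrD mulrDr mulrDl.
    by rewrite sR /u intrD; field; rewrite gt_eqF.
  have h1 : `|u - r0%:~R / q%:R| <= q%:R^-1.
    have -> : u - r0%:~R / q%:R = (q%:R * u - r0%:~R) / q%:R by field; rewrite gt_eqF.
    have fl : r0%:~R <= q%:R * u by exact: floor_le.
    have fg : q%:R * u < (r0 + 1)%:~R by exact: floorD1_gt.
    rewrite normrM normfV normr_nat ler_piMl ?invr_ge0//.
    by rewrite intrD in fg; rewrite ger0_norm; lra.
  have h2 : `|(theta - p%:R / q%:R) * j%:~R| <= q%:R^-1.
    have jq : (`|j| <= q)%N by apply: leq_trans (ltnW jL) _.
    rewrite normrM (le_trans (ler_pM _ _ thq (natz_absz_le jq)))//.
    by rewrite expr2 invfM -mulrA mulVf ?mulr1// gt_eqF.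
  by rewrite (le_trans (ler_normD _ _))//; lra.
rewrite (normZ_zball (b := n + L + 3)) ?(normZ_zball (b := n + L + 3) (x := rep_op _ _ _)) -/r; last 2 first.
- by apply: supp_inW sr; rewrite -[n.+1]addn0; exact: room.
- by apply: supp_inW xn; rewrite -addnA leq_addr.
apply: le_trans E; rewrite ler_wpM2r ?l2_ge0//.
rewrite (_ : 204 * M / q%:R = 204 * (M / q%:R)) ?mulrA//.
rewrite -mulrA in LM; rewrite -mulrA; lra.
Qed.

End Transfer.

(** * Norm and inverses in a C*-algebra *)

Section CStarBasics.
Context {R : realType} {A : cstarAlgType R}.
Implicit Types (x y u : A) (c : R[i]) (r e : R).

Lemma conj1 : (1 : R[i])^* = 1. Proof. exact: conjC1. Qed.

Lemma starD x y : star (x + y) = star x + star y.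
Proof. by have := star_antilinear 1 x y; rewrite conj1 !scale1r. Qed.
Lemma star0 : star (0 : A) = 0.
Proof. by apply: (addrI (star 0)); rewrite -starD !addr0. Qed.
Lemma starZ c x : star (c *: x) = c^* *: star x.
Proof. by have := star_antilinear c x 0; rewrite !addr0 star0 addr0. Qed.
Lemma starN x : star (- x) = - star x.
Proof. by apply/eqP; rewrite -addr_eq0 -starD addNr star0. Qed.
Lemma starB x y : star (x - y) = star x - star y.
Proof. by rewrite starD starN. Qed.
Lemma star1 : star (1 : A) = 1.
Proof. by rewrite -[LHS]mulr1 -[X in _ * X]starK -starM mulr1 starK. Qed.

Lemma cnorm0 : cnorm (0 : A) = 0.
Proof. by rewrite -(scale0r 0) cnormZ cabs0 mul0r. Qed.
Lemma cnormN x : cnorm (- x) = cnorm x.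
Proof. by rewrite -scaleN1r cnormZ cabsN cabs1 mul1r. Qed.
Lemma cnorm_ge0 x : 0 <= cnorm x.
Proof. by have := cnormD x (- x); rewrite subrr cnorm0 cnormN; lra. Qed.
Hint Resolve cnorm_ge0 : core.
Lemma cnormB x y : cnorm (x - y) <= cnorm x + cnorm y.
Proof. by rewrite -(cnormN y) cnormD. Qed.
Lemma cnorm_distC x y : cnorm (x - y) = cnorm (y - x).
Proof. by rewrite -cnormN opprB. Qed.
Lemma cnorm_gt0 x : x != 0 -> 0 < cnorm x.
Proof. by move=> x0; rewrite lt_def cnorm_ge0 andbT; apply: contra x0 => /eqP/cnorm0_eq0->. Qed.
Lemma cnorm1 : cnorm (1 : A) = 1.
Proof.
have := cnorm_cstar (1 : A); rewrite star1 mulr1.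
by have := cnorm_gt0 (oner_neq0 A); nra.
Qed.
Lemma cnorm_star x : cnorm (star x) = cnorm x.
Proof.
have H y : cnorm y <= cnorm (star y).
  have := cnorm_cstar y; have := cnormM (star y) y.
  have := cnorm_ge0 y; have := cnorm_ge0 (star y); nra.
by apply/eqP; rewrite eq_le H -{2}[x]starK H.
Qed.
Lemma cnorm_unitary u : cunitary u -> cnorm u = 1.
Proof.
move=> [u1 _]; have := cnorm_cstar u; rewrite u1 cnorm1.
by have := cnorm_ge0 u; nra.
Qed.
Lemma cnorm_sum I (s : seq I) (F : I -> A) :
  cnorm (\sum_(i <- s) F i) <= \sum_(i <- s) cnorm (F i).
Proof.
elim: s => [|i s IH]; first by rewrite !big_nil cnorm0.
by rewrite !big_cons (le_trans (cnormD _ _))// lerD2l.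
Qed.
Lemma cnormX x n : cnorm (x ^+ n) <= cnorm x ^+ n.
Proof.
elim: n => [|n IH]; first by rewrite !expr0 cnorm1.
by rewrite !exprS (le_trans (cnormM _ _))// ler_wpM2l.
Qed.

Lemma unit_lr x y z : y * x = 1 -> x * z = 1 -> x \is a GRing.unit /\ x^-1 = y.
Proof.
move=> yx xz; have yz : y = z by rewrite -[y]mulr1 -xz mulrA yx mul1r.
have ux : x \is a GRing.unit by apply/unitrP; exists y; rewrite yx {1}yz xz.
by split=> //; rewrite -[y]mulr1 -(mulrV ux) mulrA yx mul1r.
Qed.

Lemma expr_small r e : 0 <= r < 1 -> 0 < e -> exists N, forall n, (N <= n)%N -> r ^+ n < e.
Proof.
move=> /andP[r0 r1] e0.
have /cvgr0Pnorm_lt/(_ _ e0)[N _ NP] : (fun n => r ^+ n) @ \oo --> (0 : R).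
  by apply: cvg_expr; rewrite ger0_norm.
by exists N => n /NP; rewrite ger0_norm// exprn_ge0.
Qed.

Lemma cnorm_le0_eq x : (forall e, 0 < e -> cnorm x <= e) -> x = 0.
Proof.
move=> h; apply: cnorm0_eq0; apply/eqP; rewrite eq_le cnorm_ge0 andbT.
by apply/ler_addgt0Pl => e /h; rewrite addr0.
Qed.

(** The geometric series for the inverse converges by completeness. *)
Lemma neumann x : cnorm (1 - x) < 1 ->
  x \is a GRing.unit /\ cnorm x^-1 <= (1 - cnorm (1 - x))^-1.
Proof.
set y := 1 - x; set r := cnorm y => r1.
have r0 : 0 <= r by exact: cnorm_ge0.
pose s n : A := \sum_(i < n) y ^+ i.
have sd m n : (n <= m)%N -> cnorm (s m - s n) <= r ^+ n / (1 - r).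
  move=> /subnKC <-; elim: (m - n)%N => [|k IH].
    by rewrite addn0 subrr cnorm0 divr_ge0 ?exprn_ge0//; lra.
  suff : cnorm (s (n + k.+1)%N - s n) <= (r ^+ n - r ^+ (n + k.+1)) / (1 - r).
    move=> /le_trans; apply; rewrite ler_wpM2r ?invr_ge0 ?lerBlDr ?lerDl ?exprn_ge0//; lra.
  elim: k.+1 => [|j IHj]; first by rewrite addn0 !subrr cnorm0 mul0r.
  rewrite addnS /s big_ord_recr /= addrAC (le_trans (cnormD _ _))//.
  apply: le_trans (lerD IHj (cnormX _ _)) _; rewrite -/r exprS.
  have h : 0 < 1 - r by lra.
  by rewrite ler_pdivlMr// mulrDl divfK ?gt_eqF//; lra.
have [l ll] : exists l, (fun n => cnorm (s n - l)) @ \oo --> (0 : R).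
  apply: cnorm_complete => e e0.
  have e1 : 0 < e * (1 - r) by rewrite mulr_gt0//; lra.
  have r01 : 0 <= r < 1 by rewrite r0.
  have [N NP] := expr_small r01 e1.
  exists N => m n Nm Nn.
  wlog nm : m n Nm Nn / (n <= m)%N.
    move=> H; case: (leqP n m) => [/H|/ltnW/H]; first by apply.
    by rewrite cnorm_distC; apply.
  apply: le_lt_trans (sd _ _ nm) _.
  by rewrite ltr_pdivrMr ?NP//; lra.
have xs n : x * s n = 1 - y ^+ n /\ s n * x = 1 - y ^+ n.
  have xy : x = 1 - y by rewrite /y subKr.
  elim: n => [|n [IH1 IH2]]; first by rewrite /s big_ord0 mulr0 mul0r expr0 subrr.
  have ys : y ^+ n * y = y ^+ n.+1 by rewrite exprSr.
  have sy : y * y ^+ n = y ^+ n.+1 by rewrite exprS.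
  rewrite /s big_ord_recr /= -/(s n) mulrDr mulrDl IH1 IH2 xy mulrBl mulrBr mul1r mulr1 ys sy.
  by split; rewrite addrA subrK.
have lim e : 0 < e -> exists n, cnorm (s n - l) < e /\ r ^+ n < e.
  move=> e0; have r01 : 0 <= r < 1 by rewrite r0.
  have [N NP] := expr_small r01 e0.
  have /cvgr0Pnorm_lt/(_ _ e0)[N' _ NP'] := ll.
  exists (maxn N N'); split; last by apply: NP; exact: leq_maxl.
  by have := NP' (maxn N N') (leq_maxr _ _); rewrite /= ger0_norm.
have xl : x * l = 1.
  apply/eqP; rewrite -subr_eq0; apply/eqP/cnorm_le0_eq => e e0.
  have d0 : 0 < e / (cnorm x + 1) by rewrite divr_gt0// ltr_pwDr.
  have [n [n1 n2]] := lim _ d0.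
  have -> : x * l - 1 = - (x * (s n - l)) - y ^+ n.
    by rewrite mulrBr (proj1 (xs n)) !opprB addrA addrAC addrK.
  apply: le_trans (cnormB _ _) _; rewrite cnormN.
  apply: le_trans (lerD (cnormM _ _) (cnormX _ _)) _.
  have := ler_wpM2l (cnorm_ge0 x) (ltW n1); rewrite -/r.
  have : e = cnorm x * (e / (cnorm x + 1)) + e / (cnorm x + 1).
    by field; rewrite gt_eqF// ltr_pwDr.
  lra.
have lx : l * x = 1.
  apply/eqP; rewrite -subr_eq0; apply/eqP/cnorm_le0_eq => e e0.
  have d0 : 0 < e / (cnorm x + 1) by rewrite divr_gt0// ltr_pwDr.
  have [n [n1 n2]] := lim _ d0.
  have -> : l * x - 1 = - ((s n - l) * x) - y ^+ n.
    by rewrite mulrBl (proj2 (xs n)) !opprB addrA addrAC addrK.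
  apply: le_trans (cnormB _ _) _; rewrite cnormN.
  apply: le_trans (lerD (cnormM _ _) (cnormX _ _)) _.
  have := ler_wpM2r (cnorm_ge0 x) (ltW n1); rewrite -/r.
  have : e = e / (cnorm x + 1) * cnorm x + e / (cnorm x + 1).
    by field; rewrite gt_eqF// ltr_pwDr.
  lra.
have [ux xE] := unit_lr lx xl; split=> //.
have h : 0 < 1 - r by lra.
rewrite -[leRHS]div1r ler_pdivlMr//.
have e : x^-1 = 1 + y * x^-1 by rewrite /y mulrBl mul1r mulrV// addrCA subrr addr0.
have h1 : cnorm x^-1 <= cnorm (1 + y * x^-1) by rewrite -e.
have := cnormD 1 (y * x^-1); rewrite cnorm1; have := cnormM y x^-1; rewrite -/r.
lra.
Qed.

Lemma star_inv x : x \is a GRing.unit -> star x \is a GRing.unit /\ (star x)^-1 = star x^-1.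
Proof.
move=> ux; apply: (@unit_lr _ _ (star x^-1)).
  by rewrite -starM mulrV// star1.
by rewrite -starM mulVr// star1.
Qed.

Lemma shift_inverse (K rho : R) x : 0 < K -> rho < K -> cnorm (K%:C%C%:A - x) <= rho ->
  x \is a GRing.unit /\ cnorm x^-1 <= (K - rho)^-1.
Proof.
move=> K0 rK xr.
have KC : K%:C%C != 0 by rewrite fmorph_eq0 gt_eqF.
have uK : K%:C%C \is a GRing.unit by rewrite unitfE.
have E : cnorm (1 - K%:C%C^-1 *: x) <= rho / K.
  have -> : 1 - K%:C%C^-1 *: x = K%:C%C^-1 *: (K%:C%C%:A - x).
    by rewrite scalerBr scalerA mulVf// scale1r.
  rewrite cnormZ cabsV cabs_real gtr0_norm// mulrC ler_wpM2r// invr_ge0 ltW//.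
have rK1 : rho / K < 1 by rewrite ltr_pdivrMr// mul1r.
have [uy yb] := neumann (le_lt_trans E rK1).
have ux : x \is a GRing.unit by move: uy; rewrite scaler_unit// unitrV.
split=> //.
have -> : x^-1 = K%:C%C^-1 *: (K%:C%C^-1 *: x)^-1.
  by rewrite invrZ ?unitrV// invrK scalerA mulVf// scale1r.
rewrite cnormZ cabsV cabs_real gtr0_norm//.
have h : 0 < 1 - rho / K by lra.
have -> : (K - rho)^-1 = K^-1 * (1 - rho / K)^-1.
  by rewrite -invfM mulrBr mulr1 mulrCA divff ?mulr1// gt_eqF.
apply: ler_wpM2l; first by rewrite invr_ge0 ltW.
by apply: le_trans yb _; rewrite lef_pV2 ?posrE//; lra.
Qed.

(** The hypotheses say that star x * x and x * star x are bounded below by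
    c^2, in a form that avoids positivity: the spectrum of K - star x * x
    lies between K - m^2 and K - c^2 when x is bounded below by c and above
    by m, and the right-hand side is (K - c^2)^2 up to a term that is
    bounded in K.  Letting K tend to infinity gives the sharp bound on the
    inverse. *)
Lemma cstar_inverse_bound (c m : R) x : 0 < c ->
  (forall K, m ^+ 2 <= K ->
     cnorm (K%:C%C%:A - star x * x) ^+ 2 <= K ^+ 2 - (2 * K - m ^+ 2) * c ^+ 2) ->
  (forall K, m ^+ 2 <= K ->
     cnorm (K%:C%C%:A - x * star x) ^+ 2 <= K ^+ 2 - (2 * K - m ^+ 2) * c ^+ 2) ->
  x \is a GRing.unit /\ cnorm x^-1 <= c^-1.
Proof.
move=> c0 h1 h2.
have bound (y : A) K : m ^+ 2 <= K -> 0 < K ->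
   cnorm (K%:C%C%:A - y) ^+ 2 <= K ^+ 2 - (2 * K - m ^+ 2) * c ^+ 2 ->
   y \is a GRing.unit /\ cnorm y^-1 * ((2 * K - m ^+ 2) * c ^+ 2) <= 2 * K.
  move=> mK K0; set rho := cnorm _ => hr.
  have c2 : 0 < c ^+ 2 by rewrite exprn_gt0.
  have r0 : 0 <= rho by exact: cnorm_ge0.
  have rK : rho < K by nra.
  have [uy yb] := shift_inverse K0 rK (lexx _).
  split=> //; have : cnorm y^-1 * (K - rho) <= 1 by rewrite -ler_pdivlMr ?div1r// subr_gt0.
  have := cnorm_ge0 y^-1; nra.
have mK : m ^+ 2 <= m ^+ 2 + 1 by lra.
have K0 : 0 < m ^+ 2 + 1 by have := sqr_ge0 m; lra.
have [u1 _] := bound _ _ mK K0 (h1 _ mK).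
have [u2 _] := bound _ _ mK K0 (h2 _ mK).
have [ux xE] : x \is a GRing.unit /\ x^-1 = (star x * x)^-1 * star x.
  apply: (@unit_lr _ _ (star x * (x * star x)^-1)).
    by rewrite -mulrA mulVr.
  by rewrite mulrA mulrV.
split=> //.
have [us sE] := star_inv ux.
have nE : cnorm x^-1 ^+ 2 = cnorm (star x * x)^-1.
  rewrite -(cnorm_star x^-1) -cnorm_cstar starK -sE; congr cnorm.
  by rewrite invrM.
rewrite -ler_sqr ?nnegrE ?invr_ge0 ?(ltW c0)// exprVn.
set g := cnorm x^-1 ^+ 2.
have c2 : 0 < c ^+ 2 by rewrite exprn_gt0.
rewrite -div1r ler_pdivlMr// leNgt; apply/negP => g1.
set G := g * c ^+ 2 in g1.
have big K : m ^+ 2 <= K -> 0 < K -> G * (2 * K - m ^+ 2) <= 2 * K.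
  move=> mK' K0'; have [_] := bound _ _ mK' K0' (h1 _ mK').
  by rewrite -nE /G /g; lra.
pose K := m ^+ 2 + 1 + G * m ^+ 2 / (G - 1).
have d0 : 0 < G - 1 by lra.
have K1 : 0 <= G * m ^+ 2 / (G - 1).
  by apply: divr_ge0; [apply: mulr_ge0; [lra|exact: sqr_ge0]|lra].
have kE : (G - 1) * (G * m ^+ 2 / (G - 1)) = G * m ^+ 2 by rewrite mulrC divfK// gt_eqF.
have s0 := sqr_ge0 m.
have mK' : m ^+ 2 <= K by rewrite /K; lra.
have K0' : 0 < K by rewrite /K; lra.
have := big K mK' K0'; rewrite /K.
move: kE K1 d0; set Q := G * m ^+ 2 / (G - 1); move: (m ^+ 2) s0 => s s0 kE K1 d0.
have : 0 <= (G - 1) * s by rewrite mulr_ge0// ltW.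
nra.
Qed.

End CStarBasics.
#[global] Hint Extern 0 (is_true (0 <= cnorm _)) => exact: cnorm_ge0 : core.

(** * Inverses of normal elements *)

Section NormalResolvent.
Context {R : realType} {A : cstarAlgType R}.
Implicit Types (x y u : A) (z w : R[i]) (r e c : R).

(** The C*-identity, applied to x and to star x * x. *)
Lemma cnormal_sqr x : cnormal x -> cnormal (x * x) /\ cnorm (x * x) = cnorm x ^+ 2.
Proof.
move=> nx; have sx : star x * x = x * star x by [].
split.
  have cx : GRing.comm (star x * star x) x by apply/commr_sym/commrM; exact/commr_sym.
  by rewrite /cnormal starM; exact: commrM.
have h : cnorm (x * x) ^+ 2 = (cnorm x ^+ 2) ^+ 2.
  rewrite -cnorm_cstar -(cnorm_cstar x) -[RHS]cnorm_cstar !starM starK -!mulrA.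
  by congr (cnorm (_ * _)); rewrite !mulrA sx.
have c2 : 0 <= cnorm x ^+ 2 by exact: exprn_ge0.
by have := cnorm_ge0 (x * x); nra.
Qed.

Lemma cnormal_pow2 x k : cnormal x -> cnorm (x ^+ (2 ^ k)) = cnorm x ^+ (2 ^ k).
Proof.
move=> nx.
suff [] : cnormal (x ^+ (2 ^ k)) /\ cnorm (x ^+ (2 ^ k)) = cnorm x ^+ (2 ^ k) by [].
elim: k => [|k [IH1 IH2]]; first by rewrite !expr1.
have [n2 e2] := cnormal_sqr IH1.
by rewrite expnS mulnC !exprM expr2 -IH2; split.
Qed.

Section Ball.
Variables (y : A) (c : R).
Hypothesis c0 : 0 < c.
Hypothesis uy : forall w, cabs w <= c -> y - w%:A \is a GRing.unit.

Let res w : A := (y - w%:A)^-1.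

Let resB w w' : cabs w <= c -> cabs w' <= c ->
  res w - res w' = (w - w') *: (res w * res w').
Proof.
move=> wc w'c; have u1 := uy wc; have u2 := uy w'c.
have -> : (w - w') *: (res w * res w') = res w * ((y - w'%:A) - (y - w%:A)) * res w'.
  have -> : (y - w'%:A) - (y - w%:A) = (w - w')%:A.
    by rewrite scalerBl opprB addrC addrA subrK.
  by rewrite -!scalerAr mulr1 -scalerAl.
by rewrite mulrBr mulrBl mulVr// mul1r -mulrA mulrV// mulr1.
Qed.

(** The norm of the resolvent is locally bounded, and the disc is compact. *)
Lemma resolvent_bounded : exists2 B, 0 < B & forall w, cabs w <= c -> cnorm (res w) <= B.
Proof.
have cpt : compact (`[(- c), c]%classic `*` `[(- c), c]%classic : set (R * R)).
  by apply: compact_setX; exact: segment_compact.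
pose P (B : R) (p : R * R) := cabs (p.1 +i* p.2)%C <= c -> cnorm (res (p.1 +i* p.2)%C) <= B.
have near1 (p : R * R) d : 0 < d -> \forall p' \near p, cabs ((p'.1 +i* p'.2)%C - (p.1 +i* p.2)%C) < d.
  move=> d0; have d2 : 0 < d / 2 by lra.
  exists (ball p.1 (d / 2), ball p.2 (d / 2)); first by split; exact: nbhsx_ballx.
  move=> [x1 x2] [/=]; rewrite /ball /= => h1 h2; simpc.
  by apply: le_lt_trans (cabs_le_ReIm _ _) _; rewrite distrC [X in _ + X]distrC; lra.
have := (compact_near_coveringP _).1 cpt R (pinfty_nbhs R) P _.
case.
  move=> [x1 x2] _ /=; set w := (x1 +i* x2)%C.
  have [wc|wc] := leP (cabs w) c.
    set N := cnorm (res w).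
    have N0 : 0 < N.
      apply: cnorm_gt0; apply: contraTneq (oner_neq0 A) => r0.
      by rewrite -(mulVr (uy wc)) -/(res w) r0 mul0r eqxx.
    have d0 : 0 < (2 * N)^-1 by rewrite invr_gt0; lra.
    near=> p B; rewrite /P => w'c.
    have ww : cabs ((p.1 +i* p.2)%C - w) < (2 * N)^-1 by near: p; exact: near1.
    set w' := (_ +i* _)%C in w'c ww *.
    have NB : 2 * N <= B by near: B; apply: nbhs_pinfty_ge; exact: num_real.
    apply: le_trans NB.
    have hN : cnorm (res w') <= N + cabs (w' - w) * (cnorm (res w') * N).
      rewrite -{1}(subrK (res w) (res w')) addrC (le_trans (cnormD _ _))// lerD2l.
      by rewrite resB// cnormZ ler_wpM2l// cnormM.
    have : cabs (w' - w) * (cnorm (res w') * N) <= (2 * N)^-1 * (cnorm (res w') * N).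
      by rewrite ler_wpM2r ?mulr_ge0 ?(ltW ww)// ltW.
    have -> : (2 * N)^-1 * (cnorm (res w') * N) = cnorm (res w') / 2.
      by field; rewrite gt_eqF.
    lra.
  near=> p B; rewrite /P => w'c.
  have ww : cabs ((p.1 +i* p.2)%C - w) < cabs w - c by near: p; apply: near1; rewrite subr_gt0.
  set w' := (_ +i* _)%C in w'c ww *.
  have := cabs_lerB w w'; rewrite cabs_distC; lra.
move=> N [Nr NP].
exists (Num.max (N + 1) 1); first by rewrite lt_max ltr01 orbT.
move=> w wc; case: w wc => x1 x2 wc.
apply: (NP (Num.max (N + 1) 1) _ (x1, x2)) => //=.
  by rewrite lt_max ltrDl ltr01.
have : `|x1| <= c /\ `|x2| <= c.
  split; apply: le_trans wc; rewrite /cabs /= -sqrtr_sqr ler_wsqrtr// ?lerDl ?lerDr sqr_ge0//.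
by rewrite !in_itv /= => -[]; rewrite !ler_norml => -> ->.
Unshelve. all: by end_near.
Qed.

Hypothesis ny : cnormal y.

Let y_unit : y \is a GRing.unit.
Proof. by have := @uy 0; rewrite cabs0 scale0r subr0; apply; exact: ltW. Qed.

Let a := y^-1.

Lemma cnormal_inv : cnormal a.
Proof.
have [us sE] := star_inv y_unit.
by rewrite /cnormal /a -sE -!invrM// ny.
Qed.

(* This is (1 - w a)^-1. *)
Let f w : A := y * res w.

Let fE w : cabs w <= c -> (1 - w *: a) * f w = 1.
Proof.
move=> wc; have -> : 1 - w *: a = a * (y - w%:A).
  by rewrite mulrBr mulVr// -scalerAr mulr1.
have cy : (y - w%:A) * y = y * (y - w%:A).
  by rewrite mulrBl mulrBr -scalerAl -scalerAr mul1r mulr1.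
by rewrite /f /res mulrA -(mulrA a) cy mulrA mulVr// mul1r mulrV// uy.
Qed.

Let f_lip : exists2 B, 0 < B &
  forall w w', cabs w <= c -> cabs w' <= c -> cnorm (f w - f w') <= B * cabs (w - w').
Proof.
have [B B0 rB] := resolvent_bounded.
exists (cnorm y * (B * B) + 1) => [|w w' wc w'c].
  by rewrite ltr_pwDr// mulr_ge0// mulr_ge0// ltW.
rewrite /f -mulrBr resB// -scalerAr cnormZ mulrC ler_wpM2r//.
have h : cnorm (res w * res w') <= B * B.
  by apply: le_trans (cnormM _ _) _; apply: ler_pM => //; exact: rB.
apply: le_trans (cnormM _ _) _.
by have := ler_wpM2l (cnorm_ge0 y) h; lra.
Qed.

Let avg (n : nat) r : A := n%:R^-1%:C%C *: \sum_(k < n) f (expi2pi (k%:R / n%:R) * r%:C%C).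

Let cabs_root (k n : nat) r : 0 <= r <= c -> cabs (expi2pi (k%:R / n%:R) * r%:C%C) <= c.
Proof. by move=> /andP[r0 rc]; rewrite cabsM cabs_expi2pi mul1r cabs_real ger0_norm. Qed.

Let avgE n r : (0 < n)%N -> 0 <= r <= c -> (1 - (r%:C%C *: a) ^+ n) * avg n r = 1.
Proof.
move=> n0 rc; have nR : n%:R != 0 :> R by rewrite pnatr_eq0 -lt0n.
have term (k : 'I_n) : (1 - (r%:C%C *: a) ^+ n) * f (expi2pi (k%:R / n%:R) * r%:C%C) =
    \sum_(j < n) (expi2pi (k%:R / n%:R) ^+ j) *: (r%:C%C *: a) ^+ j.
  set z := expi2pi _; pose x := z *: (r%:C%C *: a).
  have -> : (r%:C%C *: a) ^+ n = x ^+ n.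
    rewrite /x [RHS]exprZn -expi2piMn divfK// -[k%:R]/(k%:Z%:~R : R).
    by rewrite expi2pi_int scale1r.
  have -> : 1 - x ^+ n = (\sum_(i < n) x ^+ i) * (1 - x).
    have cx : GRing.comm (\sum_(i < n) x ^+ i) (1 - x).
      apply: commrB; first exact: commr1.
      apply/commr_sym/commr_sum => i _; exact: commrX.
    by rewrite cx -[LHS]opprB subrX1 -mulNr opprB.
  rewrite -mulrA /x scalerA fE ?cabs_root// mulr1.
  by apply: eq_bigr => j _; rewrite -scalerA exprZn.
rewrite /avg -scalerAr mulr_sumr (eq_bigr _ (fun k _ => term k)) exchange_big /=.
rewrite (bigD1 (Ordinal n0))//= [X in _ *: (_ + X)]big1 ?addr0.
  rewrite (eq_bigr (fun=> 1)) => [|k _]; last by rewrite ?expr0 scale1r.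
  rewrite sumr_const card_ord -(scaler_nat n (1 : A)) scalerA -(rmorph_nat (@real_complex R)).
  by rewrite -rmorphM /= mulVf// scale1r.
move=> j j0; rewrite -scaler_suml root_sum ?scale0r// ltn_ord andbT lt0n.
by apply: contra j0 => /eqP jE; apply/eqP/val_inj.
Qed.

(** Rickart's argument.  Suppose r = 1 / |a| < c.  The averages of f over
    the circle of radius s are the inverses of 1 - (s a)^n, and they are
    Lipschitz in s uniformly in n.  For s slightly below r they tend to 1 as
    n grows, hence at s = r they are close to 1 for large n; but |(r a)^n| =
    1 when n is a power of 2, since a is normal. *)
Lemma normal_inverse_bound : cnorm a <= c^-1.
Proof.
rewrite leNgt; apply/negP => ac.
have ci : 0 < c^-1 by rewrite invr_gt0.
have a0 : 0 < cnorm a by exact: lt_trans ac.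
have [B B0 lip] := f_lip.
pose r := (cnorm a)^-1.
have r0 : 0 < r by rewrite invr_gt0.
have rc : r <= c by rewrite -[c]invrK lef_pV2 ?posrE ?(ltW ac).
(* The radius r - d is close enough to r for the averages to differ by 1/8. *)
pose d := Num.min r (8 * B)^-1.
have d0 : 0 < d by rewrite lt_min r0 invr_gt0 mulr_gt0.
have dr : d <= r by rewrite ge_min lexx.
have dB : B * d <= 1 / 8.
  have : d <= (8 * B)^-1 by rewrite ge_min lexx orbT.
  move=> /(ler_wpM2l (ltW B0)) /le_trans; apply.
  by rewrite le_eqVlt; apply/orP; left; apply/eqP; field; rewrite gt_eqF.
pose r' := r - d.
have r'0 : 0 <= r' by rewrite /r'; lra.
have r'c : r' <= c by rewrite /r'; lra.
have qlt : 0 <= r' * cnorm a < 1.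
  rewrite mulr_ge0//= -ltr_pdivlMr// div1r -/r /r'; lra.
have [N NP] := expr_small qlt (ltac:(lra) : (0 : R) < 1 / 16).
pose n := (2 ^ N)%N.
have n0 : (0 < n)%N by rewrite expn_gt0.
have qn : (r' * cnorm a) ^+ n < 1 / 16 by apply: NP; exact/ltnW/ltn_expl.
have nR : (n%:R : R) != 0 by rewrite pnatr_eq0 -lt0n.
have dist : cnorm (avg n r - avg n r') <= 1 / 8.
  rewrite /avg -scalerBr -sumrB cnormZ cabs_real ger0_norm ?invr_ge0//.
  rewrite mulrC ler_pdivrMr ?ltr0n//.
  apply: le_trans (cnorm_sum _ _) _.
  apply: (@le_trans _ _ (\sum_(k < n) (1 / 8 : R))); last first.
    by rewrite sumr_const card_ord mulr_natr.
  apply: ler_sum => k _; apply: le_trans dB.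
  have i1 : 0 <= r <= c by rewrite (ltW r0).
  have i2 : 0 <= r' <= c by rewrite r'0.
  apply: le_trans (lip _ _ (cabs_root k n i1) (cabs_root k n i2)) _.
  rewrite -mulrBr cabsM cabs_expi2pi mul1r -(rmorphB (@real_complex R)) cabs_real.
  by rewrite ler_wpM2l ?(ltW B0)// /r' ger0_norm; lra.
have E1 := avgE n0 (ltac:(by rewrite r'0) : 0 <= r' <= c).
have E2 := avgE n0 (ltac:(by rewrite (ltW r0)) : 0 <= r <= c).
set b := (r%:C%C *: a) ^+ n in E2.
set b' := (r'%:C%C *: a) ^+ n in E1.
have b1 : cnorm b = 1.
  rewrite /b exprZn cnormZ cabsX cabs_real (ger0_norm (ltW r0)) cnormal_pow2; last exact: cnormal_inv.
  by rewrite -exprMn /r mulVf ?expr1n// gt_eqF.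
have b'1 : cnorm b' < 1 / 16.
  rewrite /b' exprZn cnormZ cabsX cabs_real (ger0_norm r'0) cnormal_pow2; last exact: cnormal_inv.
  by rewrite -exprMn.
have V' : avg n r' = 1 + b' * avg n r' by rewrite -[X in _ = X + _]E1 mulrBl mul1r subrK.
have V : avg n r = 1 + b * avg n r by rewrite -[X in _ = X + _]E2 mulrBl mul1r subrK.
have h1 : cnorm (avg n r') <= 1 + 1 / 16 * cnorm (avg n r').
  rewrite {1}V' (le_trans (cnormD _ _))// cnorm1 lerD2l (le_trans (cnormM _ _))//.
  by rewrite ler_wpM2r// ltW.
have h2 : cnorm (avg n r' - 1) <= 1 / 16 * cnorm (avg n r').
  by rewrite {1}V' addrC addKr (le_trans (cnormM _ _))// ler_wpM2r// ltW.
have h3 : cnorm (avg n r - 1) <= cnorm (avg n r - avg n r') + cnorm (avg n r' - 1).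
  by rewrite (le_trans _ (cnormD _ _))// addrA subrK.
have h4 : cnorm b <= cnorm (avg n r - 1) + cnorm b * cnorm (avg n r - 1).
  have e : cnorm b = cnorm ((avg n r - 1) - b * (avg n r - 1)).
    have p : avg n r - 1 = b * avg n r by rewrite {1}V addrC addKr.
    by congr cnorm; rewrite mulrBr mulr1 p subKr.
  by rewrite {1}e (le_trans (cnormB _ _))// lerD2l cnormM.
rewrite b1 in h4; lra.
Qed.

End Ball.
End NormalResolvent.

(** * Noncommutative Laurent polynomials in a rotation pair *)

Section LaurentExpressions.
Context {R : realType}.
Local Notation C := (R[i]).

(** Polynomials in U, V and their adjoints are kept as syntax, because they
    are evaluated both in the algebra and on sequences and have to carry the
    same coefficients in both. *)
Inductive lexpr : Type :=
  | LU | LUs | LV | LVs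
  | Lc of C
  | Ladd of lexpr & lexpr
  | Lmul of lexpr & lexpr.

Fixpoint lstar e := match e with
  | LU => LUs | LUs => LU | LV => LVs | LVs => LV
  | Lc c => Lc c^*
  | Ladd e f => Ladd (lstar e) (lstar f)
  | Lmul e f => Lmul (lstar f) (lstar e)
  end.

Lemma lstarK : involutive lstar.
Proof. by elim=> //= [c|e -> f ->|e -> f ->]//; rewrite conjCK. Qed.

Fixpoint ldeg e : nat := match e with
  | Lc _ => 0
  | Ladd e f => maxn (ldeg e) (ldeg f)
  | Lmul e f => ldeg e + ldeg f
  | _ => 1
  end.

Fixpoint lpow e n := if n is n'.+1 then Lmul e (lpow e n') else Lc 1.

Lemma ldeg_pow e n : ldeg (lpow e n) = (n * ldeg e)%N.
Proof. by elim: n => //= n ->; rewrite mulSn. Qed.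

Fixpoint evalA (A : cstarAlgType R) (U V : A) e : A := match e with
  | LU => U | LUs => star U | LV => V | LVs => star V
  | Lc c => c%:A
  | Ladd e f => evalA U V e + evalA U V f
  | Lmul e f => evalA U V e * evalA U V f
  end.

Variable theta : R.

Fixpoint evalZ (t : R) e (xi : int -> C) : int -> C := match e with
  | LU => fun j => xi (j + 1)
  | LUs => fun j => xi (j - 1)
  | LV => fun j => expi2pi (theta * j%:~R + t) * xi j
  | LVs => fun j => expi2pi (- (theta * j%:~R + t)) * xi j
  | Lc c => fun j => c * xi j
  | Ladd e f => fun j => evalZ t e xi j + evalZ t f xi j
  | Lmul e f => evalZ t e (evalZ t f xi)
  end.

Lemma fin_supp_evalZ t e xi : fin_supp xi -> fin_supp (evalZ t e xi).
Proof.
elim: e xi => [||||c|e IHe f IHf|e IHe f IHf] xi fx /=; try exact: fin_suppM;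
  try exact: fin_supp_shift.
- by apply: fin_suppD; [exact: IHe|exact: IHf].
- by apply/IHe/IHf.
Qed.

Lemma dotZ_evalZ t e xi eta : fin_supp xi -> fin_supp eta ->
  dotZ (evalZ t e xi) eta = dotZ xi (evalZ t (lstar e) eta).
Proof.
elim: e xi eta => [||||c|e IHe f IHf|e IHe f IHf] xi eta fx fe /=.
- exact: dotZ_shift.
- by rewrite dotZ_shift; apply: eq_dotZ => // j; rewrite opprK.
- by rewrite dotZ_mul; apply: eq_dotZ => // j; rewrite conj_expi2pi.
- by rewrite dotZ_mul; apply: eq_dotZ => // j; rewrite conj_expi2pi opprK.
- exact: dotZ_mul.
- rewrite dotZDl ?dotZDr ?IHe ?IHf//; exact: fin_supp_evalZ.
- by rewrite IHe ?IHf//; exact: fin_supp_evalZ.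
Qed.

Lemma evalZ_pow t e n xi : evalZ t (lpow e n) xi = iter n (evalZ t e) xi.
Proof.
elim: n => [|n IH] /=; last by rewrite IH.
by apply: funext => j; rewrite mul1r.
Qed.

(** The pair (c, (m, n)) stands for the monomial c U^m V^n. *)
Definition mono : Type := (C * (int * int))%type.

(** Left multiplication by e, monomial by monomial.  The scalars come from
    moving V past U^m. *)
Fixpoint mono_act e (l : seq mono) : seq mono := match e with
  | LU => [seq (w.1, (w.2.1 + 1, w.2.2)) | w <- l]
  | LUs => [seq (w.1, (w.2.1 - 1, w.2.2)) | w <- l]
  | LV => [seq (expi2pi (- (theta * w.2.1%:~R)) * w.1, (w.2.1, w.2.2 + 1)) | w <- l]
  | LVs => [seq (expi2pi (theta * w.2.1%:~R) * w.1, (w.2.1, w.2.2 - 1)) | w <- l]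
  | Lc c => [seq (c * w.1, w.2) | w <- l]
  | Ladd e f => mono_act e l ++ mono_act f l
  | Lmul e f => mono_act e (mono_act f l)
  end.

Definition monos e := mono_act e [:: (1, (0, 0))].

Definition deg_le d (l : seq mono) :=
  forall w, w \in l -> (`|w.2.1| <= d)%N && (`|w.2.2| <= d)%N.

Lemma deg_le_act e l d : deg_le d l -> deg_le (d + ldeg e) (mono_act e l).
Proof.
elim: e l d => [||||c|e IHe f IHf|e IHe f IHf] l d ld /=.
1-5: by move=> w /mapP[[v [m n]] /ld/andP[/= v1 v2] ->] /=; apply/andP; split; lia.
- move=> [v [m n]]; rewrite mem_cat => /orP[/(IHe _ _ ld)|/(IHf _ _ ld)] /andP[/= w1 w2];
    by apply/andP; split; lia.
- by rewrite [(ldeg e + _)%N]addnC addnA; apply/IHe/IHf.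
Qed.

Lemma deg_le_mon e : deg_le (ldeg e) (monos e).
Proof. by apply: (@deg_le_act _ _ 0) => w; rewrite inE => /eqP->. Qed.

Definition evalZ_mon t (l : seq mono) (xi : int -> C) : int -> C := fun j =>
  \sum_(w <- l) w.1 * (expi2pi (w.2.2%:~R * (theta * (j + w.2.1)%:~R + t)) * xi (j + w.2.1)).

Lemma evalZ_act t e l xi : evalZ t e (evalZ_mon t l xi) = evalZ_mon t (mono_act e l) xi.
Proof.
elim: e l => [||||c|e IHe f IHf|e IHe f IHf] l /=; apply: funext => j; last 2 first.
- by rewrite IHe IHf /evalZ_mon big_cat.
- by rewrite IHf IHe.
all: rewrite /evalZ_mon.
- by rewrite big_map; apply: eq_bigr => w _ /=; rewrite -addrA [1 + _]addrC.
- by rewrite big_map; apply: eq_bigr => w _ /=; rewrite -addrA [-1 + _]addrC.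
- rewrite big_map mulr_sumr; apply: eq_bigr => -[c [m n]] _ /=.
  set X := theta * (j + m)%:~R + t.
  have -> : expi2pi ((n + 1)%:~R * X) =
      expi2pi (n%:~R * X) * (expi2pi (theta * j%:~R + t) * expi2pi (theta * m%:~R)).
    by rewrite -!expi2piD /X !intrD; congr expi2pi; ring.
  have k : expi2pi (- (theta * m%:~R)) * expi2pi (theta * m%:~R) = 1.
    by rewrite -expi2piD addNr expi2pi0.
  by rewrite -[LHS]mul1r -k; ring.
- rewrite big_map mulr_sumr; apply: eq_bigr => -[c [m n]] _ /=.
  set X := theta * (j + m)%:~R + t.
  have -> : expi2pi ((n - 1)%:~R * X) =
      expi2pi (n%:~R * X) * (expi2pi (- (theta * j%:~R + t)) * expi2pi (- (theta * m%:~R))).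
    by rewrite -!expi2piD /X !intrD; congr expi2pi; rewrite mulrNz; ring.
  have k : expi2pi (- (theta * m%:~R)) * expi2pi (theta * m%:~R) = 1.
    by rewrite -expi2piD addNr expi2pi0.
  by rewrite -[LHS]mul1r -k; ring.
- by rewrite big_map mulr_sumr; apply: eq_bigr => w _ /=; rewrite mulrA.
Qed.

Lemma evalZ_monosE t e xi : evalZ t e xi = evalZ_mon t (monos e) xi.
Proof.
rewrite /monos -evalZ_act; congr evalZ; apply: funext => j.
by rewrite /evalZ_mon big_seq1 /= mul0r expi2pi0 addr0 !mul1r.
Qed.

Section InAlgebra.
Variables (A : cstarAlgType R) (U V : A).
Hypothesis UV : rotation_pair theta U V.

Let uU : cunitary U. Proof. by case: UV. Qed.
Let uV : cunitary V. Proof. by case: UV. Qed.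

Lemma cunitary_unit (u : A) : cunitary u -> u \is a GRing.unit /\ u^-1 = star u.
Proof. by move=> [h1 h2]; exact: (unit_lr h1 h2). Qed.

Lemma cunitary_star (u : A) : cunitary u -> cunitary (star u).
Proof. by move=> [h1 h2]; split; rewrite starK. Qed.

Lemma cunitaryM (u v : A) : cunitary u -> cunitary v -> cunitary (u * v).
Proof.
move=> [u1 u2] [v1 v2]; split; rewrite starM !mulrA.
  by rewrite -(mulrA (star v)) u1 mulr1.
by rewrite -(mulrA u) v2 mulr1.
Qed.

Lemma cunitary_expz (u : A) (m : int) : cunitary u -> cunitary (u ^ m).
Proof.
move=> uu; have H (n : nat) : cunitary (u ^+ n).
  elim: n => [|n IH]; first by split; rewrite expr0 star1 mulr1.
  by rewrite exprS; exact: cunitaryM.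
case: m => n; first exact: H.
have -> : u ^ (Negz n) = star (u ^+ n.+1) by rewrite -(proj2 (cunitary_unit (H n.+1))).
exact/cunitary_star.
Qed.

(** The Weyl commutation relation, kept in terms of s because s is additive
    in products. *)
Definition qcomm (s : R) (x y : A) := x * y = expi2pi s *: (y * x).

Lemma qcomm_sym s x y : qcomm s x y -> qcomm (- s) y x.
Proof. by move=> h; rewrite /qcomm h scalerA -expi2piD addNr expi2pi0 scale1r. Qed.

Lemma qcommM s s' x x' y : qcomm s x y -> qcomm s' x' y -> qcomm (s + s') (x * x') y.
Proof.
rewrite /qcomm => h h'; rewrite -mulrA h' -scalerAr (mulrA x y) h -scalerAl -(mulrA y).
by rewrite scalerA mulrC -expi2piD addrC.
Qed.

Lemma qcomm1 y : qcomm 0 1 y.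
Proof. by rewrite /qcomm mul1r mulr1 expi2pi0 scale1r. Qed.

Lemma qcommX s x y (n : nat) : qcomm s x y -> qcomm (s * n%:R) (x ^+ n) y.
Proof.
move=> h; elim: n => [|n IH]; first by rewrite mulr0; exact: qcomm1.
by rewrite -natr1 mulrDr mulr1 exprSr; exact: qcommM.
Qed.

Lemma qcommV s x y : x \is a GRing.unit -> qcomm s x y -> qcomm (- s) x^-1 y.
Proof.
move=> ux h; rewrite /qcomm.
apply: (mulrI ux); apply: (mulIr ux).
rewrite mulrA mulrV// mul1r -scalerAr -scalerAl mulrA -(mulrA (x * y)) mulVr// mulr1 h.
by rewrite scalerA -expi2piD addNr expi2pi0 scale1r.
Qed.

Lemma qcommXz s x y (n : int) : x \is a GRing.unit -> qcomm s x y ->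
  qcomm (s * n%:~R) (x ^ n) y.
Proof.
move=> ux h; case: n => n; first exact: qcommX.
by rewrite NegzE mulrNz mulrN; apply: qcommV; [exact: unitrX|exact: qcommX].
Qed.

Let unU : U \is a GRing.unit. Proof. by case: (cunitary_unit uU). Qed.
Let unV : V \is a GRing.unit. Proof. by case: (cunitary_unit uV). Qed.

Lemma qcommUV (m n : int) : qcomm (theta * m%:~R * n%:~R) (U ^ m) (V ^ n).
Proof.
have h : qcomm theta U V by case: UV.
rewrite -[theta * _ * _]opprK; apply/qcomm_sym; rewrite -mulNr; apply: qcommXz => //.
by apply/qcomm_sym/qcommXz.
Qed.

Definition evalA_mon (l : seq mono) : A := \sum_(w <- l) w.1 *: (U ^ w.2.1 * V ^ w.2.2).

Lemma evalA_act e l : evalA U V e * evalA_mon l = evalA_mon (mono_act e l).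
Proof.
have sU : star U = U ^ (-1) by rewrite -(proj2 (cunitary_unit uU)).
have sV : star V = V ^ (-1) by rewrite -(proj2 (cunitary_unit uV)).
elim: e l => [||||c|e IHe f IHf|e IHe f IHf] l /=; last 2 first.
- by rewrite mulrDl IHe IHf /evalA_mon big_cat.
- by rewrite -mulrA IHf IHe.
all: rewrite /evalA_mon big_map mulr_sumr; apply: eq_bigr => -[c' [m n]] _ /=; rewrite -?scalerAr.
- by rewrite mulrA -{1}[U]expr1z -exprzDr// addrC.
- by rewrite mulrA sU -exprzDr// addrC.
- have := qcomm_sym (qcommUV m 1); rewrite /qcomm mulr1 expr1z => h.
  have VS : V * V ^ n = V ^ (n + 1) by rewrite -{1}[V]expr1z -exprzDr// addrC.
  by rewrite mulrA h -scalerAl scalerA -mulrA VS [c' * _]mulrC.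
- have := qcomm_sym (qcommUV m (-1)); rewrite /qcomm mulrN1z mulrN1 opprK => h.
  have VS : V ^ (-1) * V ^ n = V ^ (n - 1) by rewrite -exprzDr// addrC.
  by rewrite mulrA sV h -scalerAl scalerA -mulrA VS [c' * _]mulrC.
- by rewrite mulr_algl scalerA mulrC.
Qed.

Lemma evalA_monosE e : evalA U V e = evalA_mon (monos e).
Proof. by rewrite /monos -evalA_act /evalA_mon big_seq1 /= scale1r !expr0z !mulr1. Qed.

Lemma evalA_star e : evalA U V (lstar e) = star (evalA U V e).
Proof.
elim: e => [||||c|e IHe f IHf|e IHe f IHf] /=; rewrite ?starK//.
- by rewrite starZ star1.
- by rewrite starD IHe IHf.
- by rewrite starM IHe IHf.
Qed.

Lemma evalA_pow e n : evalA U V (lpow e n) = evalA U V e ^+ n.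
Proof. by elim: n => [|n IH] /=; rewrite ?scale1r// IH exprS. Qed.

End InAlgebra.

End LaurentExpressions.

(** * Coefficients of Laurent polynomials as averages *)

Section Averages.
Context {R : realType}.
Local Notation C := (R[i]).
Variable theta : R.

(** As K grows this tends to 1 for r = 0 and to 0 otherwise, if theta is
    irrational. *)
Definition gmean (K : nat) (r : int) : C := (K%:R^-1)%:C%C * \sum_(k < K) expi2pi (theta * r%:~R) ^+ k.

Lemma gmean0 K : (0 < K)%N -> gmean K 0 = 1.
Proof.
move=> K0; rewrite /gmean mulr0 expi2pi0.
rewrite (eq_bigr (fun=> 1)) => [|k _]; last by rewrite expr1n.
rewrite sumr_const card_ord -(rmorph_nat (@real_complex R)) -rmorphM /= mulVf//.
by rewrite pnatr_eq0 -lt0n.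
Qed.

Hypothesis irr : irrational theta.

Lemma gmean_le K (r : int) : r != 0 ->
  cabs (gmean K r) <= 2 / cabs (expi2pi (theta * r%:~R) - 1) / K%:R.
Proof.
move=> r0; set z := expi2pi _.
have z1 : 0 < cabs (z - 1) by apply: cabs_gt0; rewrite subr_eq0; exact: expi2pi_irr.
rewrite /gmean -/z cabsM cabs_real ger0_norm ?invr_ge0// mulrC ler_wpM2r ?invr_ge0//.
rewrite ler_pdivlMr// mulrC -cabsM -subrX1.
by apply: le_trans (cabsB _ _) _; rewrite cabsX cabs_expi2pi expr1n cabs1.
Qed.

Lemma le_vanish (x y D : R) : (forall K : nat, (0 < K)%N -> x <= y + D / K%:R) -> x <= y.
Proof.
move=> h; rewrite leNgt; apply/negP => yx.
have d0 : 0 < x - y by lra.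
pose K := (Num.truncn (`|D| / (x - y))).+1.
have K0 : 0 < K%:R :> R by rewrite ltr0n.
have := h K isT; apply/negP; rewrite -ltNge.
have : `|D| / (x - y) < K%:R by exact: truncnS_gt.
rewrite ltr_pdivrMr// => hD; rewrite -ltrBrDl ltr_pdivrMr//.
by have := ler_norm D; nra.
Qed.

(** The weights tend to the indicator of r = 0, so a bound on all the
    weighted sums passes to the sum over r = 0. *)
Lemma mean_limit (W : lmodType C) (N : W -> R) (I : Type) (l : seq I) (F : I -> W) (r : I -> int) (rho : R) :
  (forall x y, N (x + y) <= N x + N y) -> (forall c x, N (c *: x) = cabs c * N x) ->
  (forall K, (0 < K)%N -> N (\sum_(i <- l) gmean K (r i) *: F i) <= rho) ->
  N (\sum_(i <- l | r i == 0) F i) <= rho.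
Proof.
move=> ND NZ h.
have N0 : N 0 = 0 by rewrite -(scale0r 0) NZ cabs0 mul0r.
have NN x : N (- x) = N x by rewrite -scaleN1r NZ cabsN cabs1 mul1r.
have Nge0 x : 0 <= N x by have := ND x (- x); rewrite subrr N0 NN; lra.
have Nsum (P : pred I) (G : I -> W) : N (\sum_(i <- l | P i) G i) <= \sum_(i <- l | P i) N (G i).
  elim: l {h} => [|i s IH]; first by rewrite !big_nil N0.
  by rewrite !big_cons; case: ifP => // _; rewrite (le_trans (ND _ _))// lerD2l.
pose D := \sum_(i <- l | r i != 0) 2 / cabs (expi2pi (theta * (r i)%:~R) - 1) * N (F i).
apply: (@le_vanish _ _ D) => K K0.
have e : \sum_(i <- l | r i == 0) F i = \sum_(i <- l) gmean K (r i) *: F i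
     - \sum_(i <- l | r i != 0) gmean K (r i) *: F i.
  rewrite [X in _ = X - _](bigID (fun i => r i == 0)) /= addrK.
  by apply: eq_bigr => i /eqP->; rewrite gmean0// scale1r.
rewrite e; apply: le_trans (ND _ _) _; rewrite NN lerD ?h//.
apply: le_trans (Nsum _ _) _; rewrite /D mulr_suml ler_sum// => i ri.
by rewrite NZ mulrAC ler_wpM2r// gmean_le.
Qed.

Definition coef (l : seq (mono (R := R))) (p : int * int) : C := \sum_(w <- l | w.2 == p) w.1.

Section InAlgebra.
Variables (A : cstarAlgType R) (U V : A).
Hypothesis UV : rotation_pair theta U V.

Let uU : cunitary U. Proof. by case: UV. Qed.
Let uV : cunitary V. Proof. by case: UV. Qed.

Lemma mean_conj (u x : A) (K : nat) (phi : nat -> C) : (0 < K)%N -> cunitary u ->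
  (forall k, cabs (phi k) = 1) ->
  cnorm ((K%:R^-1)%:C%C *: \sum_(k < K) phi k *: (u ^+ k * x * star (u ^+ k))) <= cnorm x.
Proof.
move=> K0 uu ph.
rewrite cnormZ cabs_real ger0_norm ?invr_ge0// mulrC ler_pdivrMr ?ltr0n//.
apply: le_trans (cnorm_sum _ _) _.
apply: (@le_trans _ _ (\sum_(k < K) cnorm x)); last by rewrite sumr_const card_ord mulr_natr.
apply: ler_sum => k _; rewrite cnormZ ph mul1r.
have uk : cunitary (u ^+ k) by exact: (cunitary_expz k%:Z uu).
apply: le_trans (cnormM _ _) _; rewrite cnorm_star (cnorm_unitary uk) mulr1.
by apply: le_trans (cnormM _ _) _; rewrite (cnorm_unitary uk) mul1r.
Qed.

(** Conjugation by V^k multiplies U^m by e(- k theta m), so averaging over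
    k, with the weights e(k theta m0), keeps the monomials with m = m0 only.
    Conjugation by powers of U then isolates n = n0. *)
Lemma coef_le_cnorm l p : cabs (coef l p) <= cnorm (evalA_mon U V l).
Proof.
case: p => m0 n0.
have step1 : cnorm (\sum_(w <- l | m0 - w.2.1 == 0) w.1 *: (U ^ w.2.1 * V ^ w.2.2)) <= cnorm (evalA_mon U V l).
  apply: (mean_limit (N := @cnorm _ A) (F := fun w => w.1 *: (U ^ w.2.1 * V ^ w.2.2)) (r := fun w => m0 - w.2.1)) => [x y|c x|K K0].
  - exact: cnormD.
  - exact: cnormZ.
  apply: le_trans (mean_conj (phi := fun k => expi2pi (theta * m0%:~R) ^+ k) _ K0 uV _).
    rewrite le_eqVlt; apply/orP; left; apply/eqP; congr cnorm.
    under [in RHS]eq_bigr do rewrite /evalA_mon mulr_sumr mulr_suml scaler_sumr.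
    rewrite exchange_big /= scaler_sumr; apply: eq_bigr => -[c [m n]] _ /=.
    rewrite /gmean -scalerA scaler_suml; congr (_ *: _); apply: eq_bigr => k _.
    have := qcomm_sym (qcommUV UV m k%:Z); rewrite /qcomm -exprnP => h.
    rewrite -scalerAr mulrA h -!scalerAl -!mulrA.
    have -> : V ^+ k * (V ^ n * star (V ^+ k)) = V ^ n.
      have -> : star (V ^+ k) = V ^ (- k%:Z).
        by rewrite -(proj2 (cunitary_unit (cunitary_expz k%:Z uV))) -exprnN.
      have uv := proj1 (cunitary_unit uV).
      by rewrite exprnP -!exprzDr// addrCA subrr addr0.
    rewrite !scalerA; congr (_ *: _).
    rewrite -[_ *: _]/(theta * m%:~R * k%:R) -mulNr expi2piMn.
    have -> : expi2pi (theta * (m0 - m)%:~R) = expi2pi (theta * m0%:~R) * expi2pi (- (theta * m%:~R)).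
      by rewrite -expi2piD intrB; congr expi2pi; ring.
    by rewrite exprMn; ring.
  by move=> k; rewrite cabsX cabs_expi2pi expr1n.
apply: le_trans step1.
set y := \sum_(w <- l | _) _.
have yE : y = evalA_mon U V [seq w <- l | m0 - w.2.1 == 0] by rewrite /evalA_mon big_filter.
have step2 : cnorm (\sum_(w <- [seq w <- l | m0 - w.2.1 == 0] | w.2.2 - n0 == 0) w.1 *: (U ^ w.2.1 * V ^ w.2.2)) <= cnorm y.
  apply: (mean_limit (N := @cnorm _ A) (F := fun w => w.1 *: (U ^ w.2.1 * V ^ w.2.2)) (r := fun w => w.2.2 - n0)) => [x' y'|c x|K K0].
  - exact: cnormD.
  - exact: cnormZ.
  apply: le_trans (mean_conj (phi := fun k => expi2pi (- (theta * n0%:~R)) ^+ k) _ K0 uU _).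
    rewrite le_eqVlt; apply/orP; left; apply/eqP; congr cnorm.
    under [in RHS]eq_bigr do rewrite yE /evalA_mon mulr_sumr mulr_suml scaler_sumr.
    rewrite exchange_big /= scaler_sumr; apply: eq_bigr => -[c [m n]] _ /=.
    rewrite /gmean -scalerA scaler_suml; congr (_ *: _); apply: eq_bigr => k _.
    have uu := proj1 (cunitary_unit uU).
    have sU : star (U ^+ k) = U ^ (- k%:Z).
      by rewrite -(proj2 (cunitary_unit (cunitary_expz k%:Z uU))) -exprnN.
    have := qcomm_sym (qcommUV UV (- k%:Z) n); rewrite /qcomm => h.
    rewrite -scalerAr -scalerAl sU mulrA -[_ * V ^ n * _]mulrA h -scalerAr mulrA.
    rewrite (exprnP U) -!exprzDr// addrAC subrr add0r.
    rewrite !scalerA; congr (_ *: _).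
    have -> : - (theta * (- k%:Z)%:~R * n%:~R) = (theta * n%:~R) * k%:R.
      by rewrite mulrNz -[k%:Z%:~R]/(k%:R : R); ring.
    rewrite expi2piMn.
    have -> : expi2pi (theta * (n - n0)%:~R) = expi2pi (theta * n%:~R) * expi2pi (- (theta * n0%:~R)).
      by rewrite -expi2piD intrB; congr expi2pi; ring.
    by rewrite exprMn; ring.
  by move=> k; rewrite cabsX cabs_expi2pi expr1n.
apply: le_trans step2.
have -> : \sum_(w <- [seq w <- l | m0 - w.2.1 == 0] | w.2.2 - n0 == 0) w.1 *: (U ^ w.2.1 * V ^ w.2.2)
    = coef l (m0, n0) *: (U ^ m0 * V ^ n0).
  rewrite big_filter_cond /coef scaler_suml; apply: eq_big => [[c [m n]]|[c [m n]] /andP[/= h1 h2]].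
    by rewrite xpair_eqE /=; apply/andP/andP => -[/eqP h1 /eqP h2]; split; apply/eqP; lia.
  by congr (_ *: (_ ^ _ * _ ^ _)); lia.
rewrite cnormZ (cnorm_unitary (cunitaryM _ _)) ?mulr1//; exact: cunitary_expz.
Qed.

End InAlgebra.
End Averages.

(** * The C*-norm is the norm on sequences *)

Section NormEquality.
Context {R : realType}.
Local Notation C := (R[i]).
Variable theta : R.
Hypothesis irr : irrational theta.
Local Notation mono := (mono (R := R)).

Definition delta0 (j : int) : C := (j == 0)%:R.

Lemma fin_supp_delta0 : fin_supp delta0.
Proof. by exists 0%N => j; rewrite /delta0; case: eqP => // ->. Qed.

Lemma normZ_delta0 : normZ delta0 = 1.
Proof.
rewrite (@normZ_zball _ 0); first by rewrite zball0 /l2 big_seq1 /delta0 eqxx cabs1 expr1n sqrtr1.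
by move=> j; rewrite /delta0; case: eqP => // ->.
Qed.

Lemma cabs_le_normZ (xi : int -> C) j : fin_supp xi -> cabs (xi j) <= normZ xi.
Proof.
move=> [b xb]; have [jb|/xb ->] := leqP `|j| b; last by rewrite cabs0 normZ_ge0.
rewrite (normZ_zball xb) -ler_sqr ?nnegrE ?l2_ge0// l2_sqr (bigD1_seq j) ?uniq_zball ?mem_zball//=.
by rewrite lerDl sumr_ge0// => i _; exact: sqr_ge0.
Qed.

(** On the unit vector at 0 the monomials c U^m V^n with m = m0 are read off
    at the site - m0, where they give the trigonometric polynomial with
    terms c e(n t); averaging over t = k theta isolates n = n0. *)
Lemma coef_le_normZ (l : seq mono) (p : int * int) rho :
  (forall t, normZ (evalZ_mon theta t l delta0) <= rho) ->
  (forall t, fin_supp (evalZ_mon theta t l delta0)) -> cabs (coef l p) <= rho.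
Proof.
case: p => m0 n0 h fin.
pose F (w : mono) : C^o := if w.2.1 == m0 then w.1 else 0.
have : cabs (\sum_(w <- l | w.2.2 - n0 == 0) F w) <= rho.
  apply: (mean_limit irr (N := @cabs R : C^o -> R)) => [x y|c x|K K0].
  - exact: cabsD.
  - exact: cabsM.
  have E k : evalZ_mon theta (theta * k%:R) l delta0 (- m0) =
     \sum_(w <- l) expi2pi (theta * w.2.2%:~R) ^+ k * F w.
    apply: eq_bigr => -[c [m n]] _ /=; rewrite /F /= /delta0.
    have -> : (- m0 + m == 0) = (m == m0) by rewrite addrC subr_eq0.
    case: eqP => [->|_]; last by rewrite !mulr0.
    rewrite addNr mulr0 add0r mulr1 mulrC -expi2piMn; congr (expi2pi _ * _); ring.
  have -> : \sum_(w <- l) gmean theta K (w.2.2 - n0) *: F w =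
    (K%:R^-1)%:C%C * \sum_(k < K) expi2pi (- (theta * n0%:~R)) ^+ k * evalZ_mon theta (theta * k%:R) l delta0 (- m0).
    under [in RHS]eq_bigr do rewrite E mulr_sumr.
    rewrite exchange_big /= mulr_sumr; apply: eq_bigr => w _.
    rewrite /gmean -[_ *: _]/(_ * _) -mulrA mulr_suml; congr (_ * _); apply: eq_bigr => k _.
    have -> : expi2pi (theta * (w.2.2 - n0)%:~R) = expi2pi (theta * w.2.2%:~R) * expi2pi (- (theta * n0%:~R)).
      by rewrite -expi2piD intrB; congr expi2pi; ring.
    by rewrite exprMn; ring.
  rewrite cabsM cabs_real ger0_norm ?invr_ge0// mulrC ler_pdivrMr ?ltr0n//.
  apply: le_trans (cabs_sum _ _) _.
  apply: (@le_trans _ _ (\sum_(k < K) rho)); last by rewrite sumr_const card_ord mulr_natr.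
  apply: ler_sum => k _; rewrite cabsM cabsX cabs_expi2pi expr1n mul1r.
  by apply: le_trans (cabs_le_normZ _ (fin _)) (h _).
congr (cabs _ <= _); rewrite /coef [RHS]big_mkcond [LHS]big_mkcond; apply: eq_bigr => -[c [m n]] _.
rewrite /F xpair_eqE subr_eq0 [(_, (_, _)).2.1]/= [(_, (_, _)).2.2]/=.
by case: (m == m0); case: (n == n0).
Qed.

Definition box d : seq (int * int) := [seq (m, n) | m <- zball d, n <- zball d].

Lemma size_box d : size (box d) = (d.*2.+1 * d.*2.+1)%N.
Proof. by rewrite size_allpairs size_zball. Qed.

Lemma regroup (W : lmodType C) d (l : seq mono) (G : int * int -> W) : deg_le d l ->
  \sum_(w <- l) w.1 *: G w.2 = \sum_(p <- box d) coef l p *: G p.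
Proof.
move=> ld; have ub : uniq (box d) by apply: allpairs_uniq; rewrite ?uniq_zball// => -[? ?] [? ?].
under [RHS]eq_bigr do rewrite /coef scaler_suml big_mkcond /=.
rewrite exchange_big /= big_seq [RHS]big_seq; apply: eq_bigr => w wl.
have wb : w.2 \in box d.
  by case: w wl => c [m n] /ld /= mn; apply/allpairsP; exists (m, n); rewrite /= !mem_zball; case/andP: mn.
rewrite (bigD1_seq w.2)//= eqxx big1 ?addr0// => p; by rewrite eq_sym => /negbTE->.
Qed.

Lemma sum_const_seq (W : nmodType) I (s : seq I) (x : W) : \sum_(i <- s) x = x *+ size s.
Proof. by rewrite big_const_seq count_predT iter_addr_0. Qed.

Lemma cnorm_regroup (A : cstarAlgType R) (U V : A) d (l : seq mono) rho :
  rotation_pair theta U V -> deg_le d l -> (forall p, cabs (coef l p) <= rho) ->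
  cnorm (evalA_mon U V l) <= (d.*2.+1 * d.*2.+1)%:R * rho.
Proof.
move=> UV ld h; rewrite /evalA_mon (regroup (fun p => U ^ p.1 * V ^ p.2) ld).
apply: le_trans (cnorm_sum _ _) _.
rewrite mulr_natl -size_box -sum_const_seq ler_sum// => p _.
rewrite cnormZ (cnorm_unitary (cunitaryM _ _)) ?mulr1//; apply: cunitary_expz; by case: UV.
Qed.

Lemma normZ_sum I (s : seq I) (c : I -> C) (G : I -> int -> C) :
  (forall i, fin_supp (G i)) -> fin_supp (fun j => \sum_(i <- s) c i * G i j) /\
  normZ (fun j => \sum_(i <- s) c i * G i j) <= \sum_(i <- s) cabs (c i) * normZ (G i).
Proof.
move=> fG; elim: s => [|i s [IHf IH]].
  have -> : (fun j : int => \sum_(i <- [::]) c i * G i j) = (fun=> 0).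
    by apply: funext => j; rewrite big_nil.
  split; first by exists 0%N.
  by rewrite (@normZ_zball _ 0) // big_nil zball0 /l2 big_seq1 cabs0 expr0n sqrtr0.
have -> : (fun j : int => \sum_(i <- i :: s) c i * G i j) = (fun j => c i * G i j + \sum_(i <- s) c i * G i j).
  by apply: funext => j; rewrite big_cons.
have f1 : fin_supp (fun j => c i * G i j) by exact: fin_suppM.
split; first exact: fin_suppD.
by rewrite big_cons (le_trans (normZ_triangle f1 IHf))// normZ_scale lerD2l.
Qed.

Lemma normZ_regroup t d (l : seq mono) rho xi : fin_supp xi ->
  deg_le d l -> (forall p, cabs (coef l p) <= rho) ->
  normZ (evalZ_mon theta t l xi) <= (d.*2.+1 * d.*2.+1)%:R * rho * normZ xi.
Proof.
move=> fx ld h.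
pose G (p : int * int) (j : int) : C := expi2pi (p.2%:~R * (theta * (j + p.1)%:~R + t)) * xi (j + p.1).
have fG p : fin_supp (G p) by apply: fin_suppM; exact: fin_supp_shift.
have nG p : normZ (G p) = normZ xi.
  rewrite -[RHS](normZ_shift _ p.1); apply: eq_cabs_normZ => j.
  by rewrite cabsM cabs_expi2pi mul1r.
have -> : evalZ_mon theta t l xi = (fun j => \sum_(p <- box d) coef l p * G p j).
  by apply: funext => j; exact: (@regroup C^o d l (fun p => G p j)).
apply: le_trans (proj2 (normZ_sum _ _ fG)) _.
rewrite -mulrA mulr_natl -size_box -sum_const_seq ler_sum// => p _.
by rewrite nG ler_wpM2r ?normZ_ge0.
Qed.

(** A factor polynomial in the exponent does not survive the root.
    Bernoulli's inequality makes the fourth power of 1 + n x a lower bound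
    for (1 + x)^(4n), which beats a quadratic polynomial in n. *)
Lemma pow_growth (a b c : R) : 0 <= a -> 0 <= b -> 0 <= c ->
  (forall k : nat, a ^+ (2 ^ k) <= (c * (2 ^ k)%:R + 1) ^+ 2 * b ^+ (2 ^ k)) -> a <= b.
Proof.
move=> a0 b0 c0 h; rewrite leNgt; apply/negP => ab.
have [b00|bn0] := eqVneq b 0.
  have := h 0%N; rewrite b00 expn0 !expr1 mulr0; lra.
have bp : 0 < b by rewrite lt_def bn0.
pose x := a / b - 1.
have x0 : 0 < x by rewrite subr_gt0 ltr_pdivlMr// mul1r.
have hx k : (1 + x) ^+ (2 ^ k) <= (c * (2 ^ k)%:R + 1) ^+ 2.
  by rewrite /x addrC subrK expr_div_n ler_pdivrMr ?exprn_gt0.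
have bern n : 1 + n%:R * x <= (1 + x) ^+ n.
  elim: n => [|n IH]; first by rewrite mul0r addr0 expr0.
  rewrite exprS -natr1; have : 0 <= n%:R * x * x by rewrite !mulr_ge0// ltW.
  nra.
have hb k : (1 + (2 ^ k)%:R * x) ^+ 4 <= (4 * c * (2 ^ k)%:R + 1) ^+ 2.
  have -> : 4 * c * (2 ^ k)%:R + 1 = c * (2 ^ (k + 2))%:R + 1 :> R.
    by rewrite expnD natrM; ring.
  apply: le_trans (hx (k + 2)%N).
  rewrite expnD exprM lerXn2r ?nnegrE//; first by rewrite addr_ge0// mulr_ge0// ltW.
  by rewrite exprn_ge0// addr_ge0// ltW.
have hc k : (1 + (2 ^ k)%:R * x) ^+ 2 <= 4 * c * (2 ^ k)%:R + 1.
  have d0 : 0 <= 4 * c * (2 ^ k)%:R + 1 by rewrite addr_ge0// !mulr_ge0.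
  have := hb k; rewrite -[4%N]/(2 * 2)%N exprM.
  by rewrite ler_sqr ?nnegrE ?sqr_ge0.
have hd k : (2 ^ k)%:R * (x * x) <= 4 * c.
  have := hc k; have : 0 < (2 ^ k)%:R :> R by rewrite ltr0n expn_gt0.
  move: ((2 ^ k)%:R) => K K0 hK.
  have : K * (K * (x * x)) <= K * (4 * c) by nra.
  by rewrite ler_pM2l.
pose K := (Num.truncn (4 * c / (x * x))).+1.
have xx : 0 < x * x by rewrite mulr_gt0.
have : 4 * c / (x * x) < K%:R by exact: truncnS_gt.
rewrite ltr_pdivrMr// => hK.
have : K%:R <= (2 ^ K)%:R :> R by rewrite ler_nat ltnW// ltn_expl.
have := hd K; nra.
Qed.

Section InAlgebra.
Variables (A : cstarAlgType R) (U V : A).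
Hypothesis UV : rotation_pair theta U V.

Lemma evalZ_crude t e xi : fin_supp xi ->
  normZ (evalZ theta t e xi) <= ((ldeg e).*2.+1 * (ldeg e).*2.+1)%:R * cnorm (evalA U V e) * normZ xi.
Proof.
move=> fx; rewrite evalZ_monosE (evalA_monosE UV); apply: normZ_regroup => //; first exact: deg_le_mon.
by move=> p; exact: (coef_le_cnorm irr UV).
Qed.

Lemma evalA_crude e rho : (forall t, normZ (evalZ theta t e delta0) <= rho) ->
  cnorm (evalA U V e) <= ((ldeg e).*2.+1 * (ldeg e).*2.+1)%:R * rho.
Proof.
move=> h; rewrite (evalA_monosE UV); apply: cnorm_regroup => //; first exact: deg_le_mon.
move=> p; apply: coef_le_normZ => t; rewrite -evalZ_monosE//.
by apply: fin_supp_evalZ; exact: fin_supp_delta0.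
Qed.

Let boxsize (e : lexpr (R := R)) k : ((ldeg (lpow e (2 ^ k))).*2.+1 * (ldeg (lpow e (2 ^ k))).*2.+1)%:R
   = ((2 * ldeg e)%:R * (2 ^ k)%:R + 1) ^+ 2 :> R.
Proof. by rewrite ldeg_pow natrM -expr2 -natr1 -muln2 !natrM; congr (_ ^+ 2); ring. Qed.

(** Since the element is normal its 2^k-th power has norm |e|^(2^k), which
    is at most a polynomial in 2^k times the largest coefficient, hence
    times rho^(2^k). *)
Lemma evalA_le_evalZ e rho : cnormal (evalA U V e) -> 0 <= rho ->
  (forall t xi, fin_supp xi -> normZ (evalZ theta t e xi) <= rho * normZ xi) ->
  cnorm (evalA U V e) <= rho.
Proof.
move=> ne rho0 h; apply: (@pow_growth _ _ (2 * ldeg e)%:R) => // k.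
rewrite -cnormal_pow2// -evalA_pow -boxsize; apply: evalA_crude => t.
rewrite evalZ_pow; elim: (2 ^ k)%N => [|n IH] /=; first by rewrite normZ_delta0 expr0.
have fi m : fin_supp (iter m (evalZ theta t e) delta0).
  by elim: m => [|m IHm]; [exact: fin_supp_delta0|exact: fin_supp_evalZ].
by rewrite exprS (le_trans (h _ _ (fi n)))// ler_wpM2l.
Qed.

(** For S = lstar e * e the Cauchy-Schwarz inequality gives |S^n xi|^2 <=
    |xi| |S^(2n) xi|, so that (|S xi| / |xi|)^(2^k) is at most the norm of
    S^(2^k) on sequences, which the coefficients bound by a polynomial in
    2^k times |S|^(2^k). *)
Lemma evalZ_le_evalA t e xi : fin_supp xi -> normZ (evalZ theta t e xi) <= cnorm (evalA U V e) * normZ xi.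
Proof.
move=> fx; have [x0|xn0] := eqVneq (normZ xi) 0.
  by have := evalZ_crude t e fx; rewrite x0 !mulr0.
have xp : 0 < normZ xi by rewrite lt_def xn0 normZ_ge0.
pose S := Lmul (lstar e) e.
have fI n z : fin_supp z -> fin_supp (iter n (evalZ theta t S) z).
  by move=> fz; elim: n => [//|n IH]; rewrite iterS; exact: fin_supp_evalZ.
have fS n := fI n _ fx.
have step f z : fin_supp z -> normZ (evalZ theta t f z) ^+ 2 <= normZ z * normZ (evalZ theta t (Lmul (lstar f) f) z).
  move=> fz; have ff := fin_supp_evalZ theta t f fz.
  rewrite -[leLHS]ger0_norm ?sqr_ge0// -cabs_real -dotZ_self// dotZ_evalZ//.
  by apply: dotZ_CS => //; exact: fin_supp_evalZ.
have symm n z z' : fin_supp z -> fin_supp z' ->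
   dotZ (iter n (evalZ theta t S) z) z' = dotZ z (iter n (evalZ theta t S) z').
  have SS w w' : fin_supp w -> fin_supp w' -> dotZ (evalZ theta t S w) w' = dotZ w (evalZ theta t S w').
    by move=> fw fw'; rewrite dotZ_evalZ// /S /= lstarK.
  elim: n z z' => [//|n IH] z z' fz fz'.
  rewrite iterS SS//; last exact: fI.
  rewrite IH//; last exact: fin_supp_evalZ.
  by rewrite -iterSr.
have dbl n : normZ (iter n (evalZ theta t S) xi) ^+ 2 <= normZ xi * normZ (iter (n * 2) (evalZ theta t S) xi).
  rewrite -[leLHS]ger0_norm ?sqr_ge0// -cabs_real -dotZ_self// symm// -iterD addnn -muln2.
  exact: dotZ_CS.
pose b := normZ (evalZ theta t S xi) / normZ xi.
have b0 : 0 <= b by rewrite divr_ge0 ?normZ_ge0.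
have bk k : b ^+ (2 ^ k) <= normZ (iter (2 ^ k) (evalZ theta t S) xi) / normZ xi.
  elim: k => [|k IH]; first by rewrite expr1.
  rewrite expnS mulnC exprM; have := dbl (2 ^ k)%N; set y := normZ (iter (_ * 2) _ _).
  move=> hy; apply: (@le_trans _ _ ((normZ (iter (2 ^ k) (evalZ theta t S) xi) / normZ xi) ^+ 2)).
    by rewrite ler_sqr ?nnegrE ?exprn_ge0// divr_ge0 ?normZ_ge0.
  rewrite expr_div_n ler_pdivrMr ?exprn_gt0// (le_trans hy)//.
  by rewrite le_eqVlt; apply/orP; left; apply/eqP; field.
have bS : b <= cnorm (evalA U V S).
  apply: (@pow_growth _ _ (2 * ldeg S)%:R) => // k.
  apply: le_trans (bk k) _; rewrite ler_pdivrMr// -evalZ_pow.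
  apply: le_trans (evalZ_crude _ _ fx) _; rewrite ler_wpM2r ?normZ_ge0//.
  by rewrite boxsize ler_wpM2l ?sqr_ge0// evalA_pow cnormX.
have nS : cnorm (evalA U V S) = cnorm (evalA U V e) ^+ 2 by rewrite /= evalA_star cnorm_cstar.
rewrite nS in bS.
rewrite -ler_sqr ?nnegrE ?mulr_ge0 ?normZ_ge0// exprMn.
apply: le_trans (step e _ fx) _.
move: bS; rewrite /b ler_pdivrMr// => bS.
by rewrite expr2 mulrA mulrC ler_wpM2r ?normZ_ge0.
Qed.

End InAlgebra.
End NormEquality.

(** * Invertibility in the algebra and lower bounds on sequences *)

Section Bridge.
Context {R : realType}.
Local Notation C := (R[i]).
Variable theta : R.
Hypothesis irr : irrational theta.
Variables (A : cstarAlgType R) (U V : A).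
Hypothesis UV : rotation_pair theta U V.
Local Notation lexpr := (lexpr (R := R)).

Lemma dotZ_conj (x y : int -> C) : fin_supp x -> dotZ y x = (dotZ x y)^*.
Proof.
move=> [b xb]; rewrite (dotZ_zball _ xb) (dotZ_rngr _ xb) rmorph_sum /=.
by apply: eq_bigr => j _; rewrite rmorphM /= conjCK mulrC.
Qed.

Lemma conj_realC (r : R) : (r%:C%C : C)^* = r%:C%C.
Proof. by apply/CrealP; rewrite complex_real. Qed.

Lemma normZ_affine_sqr (k s : R) (x y : int -> C) : fin_supp x -> fin_supp y ->
  dotZ x y = s%:C%C ->
  normZ (fun j => k%:C%C * x j + -1 * y j) ^+ 2 = k ^+ 2 * normZ x ^+ 2 - 2 * k * s + normZ y ^+ 2.
Proof.
move=> fx fy xy.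
have yx : dotZ y x = s%:C%C by rewrite dotZ_conj// xy conj_realC.
have f1 : fin_supp (fun j => k%:C%C * x j) by exact: fin_suppM.
have f2 : fin_supp (fun j => -1 * y j) by exact: fin_suppM.
apply: complexI; rewrite -dotZ_self; last exact: fin_suppD.
rewrite dotZDl// !dotZDr//.
have ipr (c : C) (z w : int -> C) : dotZ z (fun j => c * w j) = c * dotZ z w.
  by rewrite /dotZ mulr_fsumr; apply: eq_fsbigr => j _; rewrite mulrCA.
have ipl (c : C) (z w : int -> C) : dotZ (fun j => c * z j) w = c^* * dotZ z w.
  by rewrite /dotZ mulr_fsumr; apply: eq_fsbigr => j _; rewrite rmorphM /= mulrA.
rewrite !ipl !ipr xy yx !dotZ_self// conj_realC (rmorphN1 (@Num.conj C)).
rewrite !rmorphD !rmorphN !rmorphM /= ; ring.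
Qed.

(** On sequences, |(K - S) xi|^2 = K^2 |xi|^2 - 2 K |e xi|^2 + |S xi|^2 with
    S = lstar e * e and |S xi| <= m |e xi|; the lower bound of e concludes,
    and the estimate passes to the algebra because K - S is self-adjoint. *)
Lemma gap_norm (e : lexpr) (c m : R) : 0 < c ->
  (forall t xi, fin_supp xi -> c * normZ xi <= normZ (evalZ theta t e xi)) ->
  cnorm (evalA U V e) <= m ->
  forall K, m ^+ 2 <= K ->
  cnorm (K%:C%C%:A - star (evalA U V e) * evalA U V e) ^+ 2 <= K ^+ 2 - (2 * K - m ^+ 2) * c ^+ 2.
Proof.
move=> c0 low em K mK.
have m0 : 0 <= m by apply: le_trans em.
have up f t xi : fin_supp xi -> cnorm (evalA U V f) <= m -> normZ (evalZ theta t f xi) <= m * normZ xi.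
  move=> fx fm; apply: le_trans (evalZ_le_evalA irr UV t f fx) _.
  by rewrite ler_wpM2r ?normZ_ge0.
have cm : c <= m.
  have := low 0 _ (fin_supp_delta0 (R := R)); have := up e 0 _ (fin_supp_delta0 (R := R)) em.
  by rewrite normZ_delta0; lra.
have c2 : c ^+ 2 <= m ^+ 2 by rewrite ler_sqr ?nnegrE// ltW.
set rho2 := K ^+ 2 - _.
have rho0 : 0 <= rho2.
  have : 0 <= (K - c ^+ 2) ^+ 2 by exact: sqr_ge0.
  have : 0 <= c ^+ 2 * (m ^+ 2 - c ^+ 2) by rewrite mulr_ge0 ?sqr_ge0// subr_ge0.
  rewrite /rho2; nra.
pose P := Ladd (Lc K%:C%C) (Lmul (Lc (-1)) (Lmul (lstar e) e)).
have PE : evalA U V P = K%:C%C%:A - star (evalA U V e) * evalA U V e.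
  by rewrite /= (evalA_star U V) scaleN1r mulN1r.
rewrite -PE -(sqr_sqrtr rho0) ler_sqr ?nnegrE ?sqrtr_ge0//.
apply: (evalA_le_evalZ irr UV).
- by rewrite PE /cnormal starB starM starK starZ star1 conj_realC.
- exact: sqrtr_ge0.
move=> t xi fx.
have fe : fin_supp (evalZ theta t e xi) by exact: fin_supp_evalZ.
have fs : fin_supp (evalZ theta t (lstar e) (evalZ theta t e xi)) by exact: fin_supp_evalZ.
have ipE : dotZ xi (evalZ theta t (lstar e) (evalZ theta t e xi)) = (normZ (evalZ theta t e xi) ^+ 2)%:C%C.
  by rewrite -dotZ_evalZ// dotZ_self.
rewrite -ler_sqr ?nnegrE ?mulr_ge0 ?sqrtr_ge0 ?normZ_ge0// exprMn (sqr_sqrtr rho0).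
have -> : normZ (evalZ theta t P xi) ^+ 2 = K ^+ 2 * normZ xi ^+ 2
    - 2 * K * normZ (evalZ theta t e xi) ^+ 2 + normZ (evalZ theta t (lstar e) (evalZ theta t e xi)) ^+ 2.
  exact: (normZ_affine_sqr K fx fs ipE).
have h1 : normZ (evalZ theta t (lstar e) (evalZ theta t e xi)) <= m * normZ (evalZ theta t e xi).
  by apply: up => //; rewrite (evalA_star U V) cnorm_star.
have h2 := low t xi fx.
move: h1 h2 (normZ_ge0 (evalZ theta t (lstar e) (evalZ theta t e xi))) (normZ_ge0 (evalZ theta t e xi)) (normZ_ge0 xi).
rewrite /rho2.
set s := normZ (evalZ theta t (lstar e) _); set y := normZ (evalZ _ _ _ _); set x := normZ xi => h1 h2 s0 y0 x0.
have s2 : s ^+ 2 <= m ^+ 2 * y ^+ 2 by rewrite -exprMn ler_sqr ?nnegrE ?mulr_ge0.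
have y2 : c ^+ 2 * x ^+ 2 <= y ^+ 2 by rewrite -exprMn ler_sqr ?nnegrE ?mulr_ge0// ltW.
have K2 : 0 <= 2 * K - m ^+ 2 by have := sqr_ge0 m; lra.
have := ler_wpM2l K2 y2; lra.
Qed.

Lemma lower_to_inverse (e : lexpr) (c : R) : 0 < c ->
  (forall t xi, fin_supp xi -> c * normZ xi <= normZ (evalZ theta t e xi)) ->
  (forall t xi, fin_supp xi -> c * normZ xi <= normZ (evalZ theta t (lstar e) xi)) ->
  evalA U V e \is a GRing.unit /\ cnorm (evalA U V e)^-1 <= c^-1.
Proof.
move=> c0 h1 h2.
apply: (@cstar_inverse_bound _ _ c (cnorm (evalA U V e))) => // K mK.
  exact: gap_norm.
rewrite -{1}(starK (evalA U V e)) -(evalA_star U V).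
apply: gap_norm => //; by rewrite (evalA_star U V) cnorm_star.
Qed.

Hypothesis gen : forall S : set A, star_subalgebra S -> S U -> S V -> norm_dense S.

(** The inverse is a limit of polynomials f in U and V; on sequences f is
    almost a left inverse of e, of norm almost c^-1. *)
Lemma inverse_to_lower (e : lexpr) (c : R) t xi : 0 < c ->
  evalA U V e \is a GRing.unit -> cnorm (evalA U V e)^-1 <= c^-1 ->
  fin_supp xi -> c * normZ xi <= normZ (evalZ theta t e xi).
Proof.
move=> c0; set X := evalA U V e => uX Xc fx.
have dense : norm_dense [set x : A | exists f, x = evalA U V f].
  apply: gen; [split|by exists LU|by exists LV].
  - by exists (Lc 1); rewrite /= scale1r.
  - move=> k x y [f ->] [g ->]; exists (Ladd (Lmul (Lc k) f) g).
    by rewrite /= mulr_algl.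
  - by move=> x y [f ->] [g ->]; exists (Lmul f g).
  - by move=> x [f ->]; exists (lstar f); rewrite evalA_star.
have fX : fin_supp (evalZ theta t e xi) by exact: fin_supp_evalZ.
suff : normZ xi <= c^-1 * normZ (evalZ theta t e xi) by rewrite ler_pdivlMl.
apply/ler_addgt0Pl => d d0.
set D := normZ (evalZ theta t e xi) + cnorm X * normZ xi + 1.
have D0 : 0 < D by rewrite /D ltr_pwDr// addr_ge0 ?normZ_ge0// mulr_ge0 ?normZ_ge0.
have dD : 0 < d / D by rewrite divr_gt0.
have [y [f yf] Xy] := dense X^-1 _ dD; subst y.
have fy : cnorm (evalA U V f) <= c^-1 + d / D.
  rewrite -[evalA U V f](subrK X^-1) addrC (le_trans (cnormD _ _))//.
  by rewrite lerD// cnorm_distC ltW.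
pose g := Ladd (Lc 1) (Lmul (Lc (-1)) (Lmul f e)).
have ng : cnorm (evalA U V g) <= d / D * cnorm X.
  have -> : evalA U V g = (X^-1 - evalA U V f) * X.
    by rewrite /= mulrBl mulVr// scale1r scaleN1r mulN1r.
  by apply: le_trans (cnormM _ _) _; rewrite ler_wpM2r// ltW.
have h1 : normZ (evalZ theta t (Lmul f e) xi) <= (c^-1 + d / D) * normZ (evalZ theta t e xi).
  apply: le_trans (evalZ_le_evalA irr UV t f fX) _.
  by rewrite ler_wpM2r ?normZ_ge0.
have h2 : normZ (evalZ theta t g xi) <= d / D * cnorm X * normZ xi.
  apply: le_trans (evalZ_le_evalA irr UV t g fx) _.
  by rewrite ler_wpM2r ?normZ_ge0.
have h3 : normZ xi <= normZ (evalZ theta t (Lmul f e) xi) + normZ (evalZ theta t g xi).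
  have -> : normZ xi = normZ (fun j => evalZ theta t (Lmul f e) xi j + evalZ theta t g xi j).
    by apply: eq_normZ => j /=; ring.
  by apply: normZ_triangle; exact: fin_supp_evalZ.
have dE : d = d / D * normZ (evalZ theta t e xi) + d / D * cnorm X * normZ xi + d / D.
  have uD : d / D * D = d by rewrite divfK// gt_eqF.
  by rewrite -{1}uD; set u := d / D; rewrite /D; ring.
lra.
Qed.

End Bridge.

(** * Rotation matrices acting on periodic sequences *)

Section Matrices.
Context {R : realType}.
Local Notation C := (R[i]).
Local Open Scope sesquilinear_scope.

(** Vectors of size q are handled as q-periodic sequences, on which the
    shift and clock matrices have translation invariant formulas. *)
Definition vec q (x : int -> C) : 'cV[C]_q := \col_i x (i : nat)%:Z.

Lemma l2norm_vec q x : l2norm (vec q x) = l2 (iotaz q) x.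
Proof. by rewrite /l2norm /l2 sum_iotaz; congr Num.sqrt; apply: eq_bigr => i _; rewrite mxE. Qed.

Lemma vec_ext q (v : 'cV[C]_q) : (0 < q)%N ->
  exists2 x, periodic_by q x & v = vec q x.
Proof.
case: q v => // q v _.
exists (fun m => v (inord (absz (m %% q.+1%:Z)%Z)) ord0) => [m|].
  by rewrite modzDr.
apply/matrixP => i j; rewrite mxE ord1; congr (v _ _); apply: val_inj.
by rewrite /= modz_small ?inordK//; have := ltn_ord i; lia.
Qed.

Lemma shift_vec q x : periodic_by q x -> shift_mx q *m vec q x = vec q (fun m => x (m + 1)).
Proof.
move=> xq; apply/matrixP => i j; rewrite !mxE (bigD1 (ordS i))//= big1 ?addr0.
  rewrite !mxE eqxx mul1r; have := ltn_ord i.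
  rewrite leq_eqVlt => /orP[/eqP iq|iq].
    by rewrite /= iq modnn -[LHS]xq; congr x; lia.
  by rewrite /= modn_small//; congr x; lia.
by move=> k /negbTE ki; rewrite !mxE ki mul0r.
Qed.

Lemma shiftc_vec q x : periodic_by q x ->
  (shift_mx q)^t* *m vec q x = vec q (fun m => x (m - 1)).
Proof.
move=> xq; apply/matrixP => i j; rewrite !mxE (bigD1 (ord_pred i))//= big1 ?addr0.
  rewrite !mxE ord_predK eqxx conjC1 mul1r; have := ltn_ord i.
  case: (posnP i) => [i0|i0] iq.
    by rewrite /= i0 add0n modn_small; [rewrite -[RHS]xq; congr x; lia|lia].
  rewrite /= (_ : (i + q).-1 = (i.-1 + q)%N); last lia.
  by rewrite modnDr modn_small; [congr x; lia|lia].
move=> k ki; rewrite !mxE; case: eqP => [iE|]; last by rewrite conjC0 mul0r.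
by rewrite iE ordSK eqxx in ki.
Qed.

Lemma clock_vec p q x :
  clock_mx p q *m vec q x = vec q (fun m => expi2pi (p%:R * m%:~R / q%:R) * x m).
Proof.
apply/matrixP => i j; rewrite mul_diag_mx !mxE -expi2piMn; congr (expi2pi _ * _).
by rewrite mulrAC.
Qed.

Lemma clockc_vec p q x :
  (clock_mx p q)^t* *m vec q x = vec q (fun m => expi2pi (- (p%:R * m%:~R / q%:R)) * x m).
Proof.
rewrite /clock_mx tr_diag_mx map_diag_mx.
apply/matrixP => i j; rewrite mul_diag_mx !mxE -expi2piMn /= conj_expi2pi; congr (expi2pi _ * _).
by rewrite mulrAC.
Qed.

Lemma rotation_vec a a' b b' lam p q x : periodic_by q x ->
  (lam%:M - rotation_mx a a' b b' p q) *m vec q x = vec q (per_op a a' b b' lam p q x).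
Proof.
move=> xq; rewrite mulmxBl mul_scalar_mx !mulmxDl -!scalemxAl.
rewrite shift_vec// shiftc_vec// clock_vec clockc_vec.
by apply/matrixP => i j; rewrite !mxE /per_op /jacobi /pdiag; ring.
Qed.

Definition mxlower q (Y : 'M[C]_q) c := forall x : 'cV[C]_q, c * l2norm x <= l2norm (Y *m x).

Lemma mxlower_per a a' b b' lam p q c : (0 < q)%N ->
  mxlower (lam%:M - rotation_mx a a' b b' p q) c <->
  forall x, periodic_by q x -> c * l2 (iotaz q) x <= l2 (iotaz q) (per_op a a' b b' lam p q x).
Proof.
move=> q0; split=> h x.
  by move=> xq; have := h (vec q x); rewrite rotation_vec// !l2norm_vec.
by have [y yq ->] := vec_ext x q0; rewrite rotation_vec// !l2norm_vec; exact: h.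
Qed.

Lemma l2norm_ge0 q (x : 'cV[C]_q) : 0 <= l2norm x. Proof. exact: sqrtr_ge0. Qed.

Lemma l2normE q (x : 'cV[C]_q) : l2norm x = l2 (index_enum 'I_q) (fun j => x j ord0).
Proof. by []. Qed.

Lemma l2normZ q (c : C) (x : 'cV[C]_q) : l2norm (c *: x) = cabs c * l2norm x.
Proof. by rewrite !l2normE -l2_scale; apply: eq_l2 => j _; rewrite mxE. Qed.

Lemma l2norm0 q : l2norm (0 : 'cV[C]_q) = 0.
Proof. by rewrite -(scale0r 0) l2normZ cabs0 mul0r. Qed.

Lemma l2norm_eq0 q (x : 'cV[C]_q) : l2norm x = 0 -> x = 0.
Proof.
move=> x0; apply/matrixP => i j; rewrite mxE ord1; apply/cabs_eq0/eqP.
have := l2_sqr (index_enum 'I_q) (fun j => x j ord0); rewrite -l2normE x0 expr0n /=.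
move=> /esym/eqP; rewrite psumr_eq0 => [/allP/(_ i (mem_index_enum i))|k _]; last exact: sqr_ge0.
by rewrite /= expf_eq0.
Qed.

Lemma mul_trC_self q (x : 'cV[C]_q) : (x^t* *m x) ord0 ord0 = (l2norm x ^+ 2)%:C%C.
Proof.
rewrite !mxE l2normE l2_sqr rmorph_sum /=; apply: eq_bigr => i _.
by rewrite !mxE cabs_sqr.
Qed.

Lemma mul_trC_CS q (x y : 'cV[C]_q) : cabs ((x^t* *m y) ord0 ord0) <= l2norm x * l2norm y.
Proof.
rewrite !mxE; apply: le_trans (cabs_sum _ _) _; rewrite !l2normE; apply: le_trans (l2_CS _ _ _).
by apply: ler_sum => i _; rewrite !mxE cabsM cabs_conj.
Qed.

Lemma mxlower_unit q (Y : 'M[C]_q) c : 0 < c -> mxlower Y c -> Y \in unitmx.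
Proof.
move=> c0 h; rewrite -unitmx_tr unitmxE unitfE; apply/det0P => -[v v0 vY].
have : Y *m v^T = 0 by rewrite -[Y]trmxK -trmx_mul vY trmx0.
move=> Yv; have := h v^T; rewrite Yv l2norm0 pmulr_rle0// => n0.
have : v^T = 0 by apply: l2norm_eq0; apply/eqP; rewrite eq_le n0 l2norm_ge0.
by move/(congr1 trmx); rewrite trmxK trmx0 => ve; rewrite ve eqxx in v0.
Qed.

(** If x = Y z, then |x|^2 is the inner product of z with the adjoint of Y
    applied to x. *)
Lemma mxlower_adj q (Y : 'M[C]_q) c : 0 < c -> mxlower Y c -> mxlower (Y^t*) c.
Proof.
move=> c0 h x; have uY := mxlower_unit c0 h.
have [x0|xn0] := eqVneq (l2norm x) 0; first by rewrite x0 mulr0 l2norm_ge0.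
have xp : 0 < l2norm x by rewrite lt_def xn0 l2norm_ge0.
pose z := invmx Y *m x.
have xE : x = Y *m z by rewrite /z mulKVmx.
have hz : c * l2norm z <= l2norm x by rewrite [x in leRHS]xE; exact: h.
have : l2norm x ^+ 2 <= l2norm z * l2norm (Y^t* *m x).
  rewrite -[leLHS]ger0_norm ?sqr_ge0// -cabs_real -mul_trC_self {1}xE.
  rewrite trmx_mul map_mxM -mulmxA; exact: mul_trC_CS.
have := l2norm_ge0 (Y^t* *m x); move: hz xp; set n := l2norm x; set w := l2norm _; set m := l2norm _.
move=> hz np m0 hx.
rewrite -(ler_pM2l np); nra.
Qed.

Lemma opnorm_has_sup q (X : 'M[C]_q) :
  has_sup [set l2norm (X *m x) | x in [set x : 'cV[C]_q | l2norm x <= 1]].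
Proof.
split; first by exists (l2norm (X *m 0)), 0 => //=; rewrite l2norm0.
exists (l2 (index_enum 'I_q) (fun i => (\sum_j cabs (X i j))%:C%C)) => _ [x /= x1 <-].
rewrite l2normE; apply: l2_le => i _; rewrite mxE cabs_real ger0_norm ?sumr_ge0//.
apply: le_trans (cabs_sum _ _) _; apply: ler_sum => j _; rewrite cabsM ler_piMr//.
apply: le_trans x1; rewrite l2normE -ler_sqr ?nnegrE ?l2_ge0// l2_sqr (bigD1 j)//= lerDl.
by rewrite sumr_ge0// => k _; exact: sqr_ge0.
Qed.

Lemma opnorm_ub q (X : 'M[C]_q) x : l2norm (X *m x) <= opnorm X * l2norm x.
Proof.
have [x0|xn0] := eqVneq (l2norm x) 0.
  by rewrite (l2norm_eq0 x0) mulmx0 l2norm0 mulr0.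
have xp : 0 < l2norm x by rewrite lt_def xn0 l2norm_ge0.
rewrite -ler_pdivrMr//.
have -> : l2norm (X *m x) / l2norm x = l2norm (X *m ((l2norm x)^-1%:C%C *: x)).
  by rewrite -scalemxAr l2normZ cabs_real ger0_norm ?invr_ge0 ?(ltW xp)// mulrC.
apply: ub_le_sup; first by have [] := opnorm_has_sup X.
exists ((l2norm x)^-1%:C%C *: x) => //.
by rewrite /= l2normZ cabs_real ger0_norm ?invr_ge0 ?(ltW xp)// mulVf// lexx.
Qed.

Lemma mxpseudoP q (X : 'M[C]_q) e lam : (0 < e) ->
  ~ mxpseudospectrum e X lam <-> exists2 c, e < c & mxlower (lam%:M - X) c.
Proof.
move=> e0; split.
  move/not_orP => [/negP]; rewrite negbK => uY /negP; rewrite -ltNge; set Y := lam%:M - X in uY *.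
  set o := opnorm _ => oe.
  have ei : 0 < e^-1 by rewrite invr_gt0.
  pose o' := (Num.max o 0 + e^-1) / 2.
  have mx : Num.max o 0 < e^-1 by rewrite gt_max oe ei.
  have mx0 : 0 <= Num.max o 0 by rewrite le_max lexx orbT.
  have mxo : o <= Num.max o 0 by rewrite le_max lexx.
  have o'0 : 0 < o' by rewrite /o'; lra.
  exists o'^-1; first by rewrite -[e]invrK ltf_pV2 ?posrE// /o'; lra.
  move=> x; rewrite ler_pdivrMl//.
  have := opnorm_ub (invmx Y) (Y *m x); rewrite mulKmx// -/o => /le_trans; apply.
  by rewrite ler_wpM2r ?l2norm_ge0// /o'; lra.
move=> [c ec low]; have c0 : 0 < c by exact: lt_trans ec.
have uY := mxlower_unit c0 low.
move=> [|]; first by rewrite uY.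
apply/negP; rewrite -ltNge; apply: (@le_lt_trans _ _ c^-1); last by rewrite ltf_pV2 ?posrE.
apply: ge_sup; first by have [] := opnorm_has_sup (invmx (lam%:M - X)).
move=> _ [x /= x1 <-]; rewrite -[leRHS]mulr1 ler_pdivlMl//.
by apply: le_trans (low _) _; rewrite mulKVmx.
Qed.

Lemma l2norm_unitary q (P : 'M[C]_q) x : P \is unitarymx -> l2norm (P *m x) = l2norm x.
Proof.
move=> uP; have PP : P^t* *m P = 1%:M.
  by rewrite -(invmx_unitary uP) mulVmx// unitarymx_unit.
have : l2norm (P *m x) ^+ 2 = l2norm x ^+ 2.
  apply: complexI; rewrite -!mul_trC_self trmx_mul map_mxM mulmxA -(mulmxA _ _ P) PP.
  by rewrite mulmx1.
by move/eqP; rewrite eqrXn2 ?l2norm_ge0// => /eqP.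
Qed.

Lemma normal_mxlower q (X : 'M[C]_q) lam c : X \is normalmx ->
  (forall mu, mxspectrum X mu -> c <= cabs (lam - mu)) -> mxlower (lam%:M - X) c.
Proof.
move=> /orthomx_spectralP; set P := spectralmx X; set sp := spectral_diag X => XE h x.
have uP : P \is unitarymx by exact: spectral_unitarymx.
have UP : P \in unitmx by exact: unitarymx_unit.
have YE m : m%:M - X = invmx P *m (m%:M - diag_mx sp) *m P.
  by rewrite mulmxBr mulmxBl -XE mul_mx_scalar -scalemxAl mulVmx// scalemx1.
have uiP : invmx P \is unitarymx by rewrite (invmx_unitary uP) trmxC_unitary.
have [c0|c0] := leP c 0.
  by apply: le_trans (l2norm_ge0 _); rewrite mulr_le0_ge0 ?l2norm_ge0.
have sp_spec i : mxspectrum X (sp ord0 i).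
  rewrite /mxspectrum /= YE; apply/negP; rewrite !unitmx_mul unitmx_inv UP /= andbT.
  rewrite -diag_const_mx -linearB /= unitmxE det_diag unitfE.
  rewrite prodf_seq_neq0 => /allP/(_ i (mem_index_enum i)) /=.
  by rewrite !mxE subrr eqxx.
rewrite YE -!mulmxA l2norm_unitary// -(l2norm_unitary x uP).
rewrite -[c in leLHS]ger0_norm ?(ltW c0)// -cabs_real -l2normZ !l2normE.
apply: (@l2_le _ 'I_q _ (fun i => (c%:C%C *: (P *m x)) i ord0)
  (fun i => ((lam%:M - diag_mx sp) *m (P *m x)) i ord0)) => i _.
move: (P *m x) => y; rewrite [in leLHS]mxE [in leRHS]mxE.
have -> : \sum_j (lam%:M - diag_mx sp) i j * y j ord0 = (lam - sp ord0 i) * y i ord0.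
  rewrite (bigD1 i)//= big1 ?addr0; first by rewrite !mxE eqxx !mulr1n.
  by move=> j ji; rewrite !mxE [i == j]eq_sym (negbTE ji) !mulr0n subrr mul0r.
by rewrite !cabsM cabs_real ger0_norm ?(ltW c0)// ler_wpM2r// h.
Qed.

End Matrices.

(** * Convergents of a continued fraction *)

Section ContinuedFractions.
Context {R : realType}.
Variable a : nat -> nat.
Hypothesis a_pos : forall k, (0 < k)%N -> (0 < a k)%N.

(** The continued fraction with t added to its last partial quotient, as a
    function of the remainder t. *)
Fixpoint cfrac_tail (s : seq nat) (t : R) : R :=
  if s is x :: s' then (x%:R + cfrac_tail s' t)^-1 else t.

Lemma cfrac_cat s1 s2 : cfrac R (s1 ++ s2) = cfrac_tail s1 (cfrac R s2).
Proof. by elim: s1 => //= x s ->. Qed.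

Lemma cfrac_tail_rcons s x t : cfrac_tail (rcons s x) t = cfrac_tail s (x%:R + t)^-1.
Proof. by elim: s => //= y s ->. Qed.

Lemma cfrac01 s : all (fun x => 0 < x)%N s -> 0 <= cfrac R s <= 1.
Proof.
elim: s => [|x s IH] /=; first by rewrite lexx ler01.
move=> /andP[x0 /IH/andP[s0 s1]].
have x1 : 1 <= x%:R :> R by rewrite ler1n.
by rewrite invr_ge0 addr_ge0//= invf_le1; lra.
Qed.

(** The numerator and the denominator of index n - 1, started with 1 and 0
    for n = 0: the recurrences then hold from n = 0 on. *)
Definition cf_p' n := if n is m.+1 then cf_p a m else 1%N.
Definition cf_q' n := if n is m.+1 then cf_q a m else 0%N.

Lemma cf_pS n : cf_p a n.+1 = (a n.+1 * cf_p a n + cf_p' n)%N.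
Proof. by case: n => [|n] //=; rewrite muln0. Qed.

Lemma cf_qS n : cf_q a n.+1 = (a n.+1 * cf_q a n + cf_q' n)%N.
Proof. by case: n => [|n] //=; rewrite muln1 addn0. Qed.

Lemma cf_q_gt0 n : (0 < cf_q a n)%N.
Proof. by elim: n => // n IH; rewrite cf_qS addn_gt0 muln_gt0 a_pos ?IH. Qed.

(** The determinant of two consecutive convergents is 1 or -1; naturals have
    no sign, whence the two cases. *)
Lemma cf_det n : (cf_p a n * cf_q' n = (cf_p' n * cf_q a n).+1)%N \/
  (cf_p' n * cf_q a n = (cf_p a n * cf_q' n).+1)%N.
Proof.
elim: n => [|n IH]; first by right.
rewrite cf_pS cf_qS [cf_p' n.+1]/= [cf_q' n.+1]/= !mulnDl !mulnDr; case: IH => IH; nia.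
Qed.

Lemma cf_coprime n : coprime (cf_p a n) (cf_q a n).
Proof.
rewrite /coprime -dvdn1; set g := gcdn _ _.
have gp : (g %| cf_p a n * cf_q' n)%N by rewrite dvdn_mulr// dvdn_gcdl.
have gq : (g %| cf_p' n * cf_q a n)%N by rewrite dvdn_mull// dvdn_gcdr.
case: (cf_det n) => E.
  by rewrite -(dvdn_addr 1 gq) addn1 -E.
by rewrite -(dvdn_addr 1 gp) addn1 -E.
Qed.

(** A continued fraction is a Moebius transform of its remainder, and the
    convergents are the columns of its matrix. *)
Lemma cfrac_tailE n t : 0 <= t -> cfrac_tail [seq a k | k <- iota 1 n] t =
  ((cf_p a n)%:R + (cf_p' n)%:R * t) / ((cf_q a n)%:R + (cf_q' n)%:R * t).
Proof.
elim: n t => [|n IH] t t0; first by rewrite /= mul1r mul0r add0r addr0 divr1.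
rewrite -[n.+1]addn1 iotaD map_cat /= cats1 cfrac_tail_rcons add1n addn1.
have a1 : 0 < (a n.+1)%:R + t :> R by rewrite ltr_pwDl// ltr0n a_pos.
rewrite IH ?invr_ge0 ?ltW// cf_pS cf_qS [cf_p' n.+1]/= [cf_q' n.+1]/=.
have q0 : 0 < (cf_q a n)%:R :> R by rewrite ltr0n cf_q_gt0.
have q'0 : 0 <= (cf_q' n)%:R :> R by [].
rewrite !natrD !natrM; field; apply/andP; split; apply: lt0r_neq0.
  by have := mulr_gt0 a1 q0; nra.
by have := mulr_gt0 a1 q0; nra.
Qed.

(** The Moebius transform at t and at 0 differ by t / (q (q + q' t)),
    because its determinant is 1 or -1. *)
Lemma cfrac_error n t : 0 <= t <= 1 ->
  `|cfrac_tail [seq a k | k <- iota 1 n] t - (cf_p a n)%:R / (cf_q a n)%:R|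
    <= ((cf_q a n)%:R ^+ 2)^-1.
Proof.
move=> /andP[t0 t1]; rewrite cfrac_tailE//.
have q0 : 1 <= (cf_q a n)%:R :> R by rewrite ler1n cf_q_gt0.
have q'0 : 0 <= (cf_q' n)%:R :> R by [].
have D : `|(cf_p' n)%:R * (cf_q a n)%:R - (cf_p a n)%:R * (cf_q' n)%:R| = 1 :> R.
  rewrite -!natrM; case: (cf_det n) => ->; rewrite -natr1.
    by rewrite opprD addrA subrr sub0r normrN normr1.
  by rewrite addrAC subrr add0r normr1.
move: D q0 q'0; move: (cf_p a n)%:R (cf_q a n)%:R (cf_p' n)%:R (cf_q' n)%:R => p q p' q' D q0 q'0.
have qp : 0 < q by lra.
have qt : 0 < q + q' * t by rewrite ltr_wpDr ?mulr_ge0.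
have qq : 0 < q * (q + q' * t) by rewrite mulr_gt0.
have -> : (p + p' * t) / (q + q' * t) - p / q = t * (p' * q - p * q') / (q * (q + q' * t)).
  by field; rewrite !gt_eqF.
rewrite normrM normrM D mulr1 ger0_norm// gtr0_norm ?invr_gt0//.
have h : (q * (q + q' * t))^-1 <= (q ^+ 2)^-1.
  rewrite lef_pV2 ?posrE// ?exprn_gt0//.
  have : 0 <= q * (q' * t) by rewrite !mulr_ge0// ltW.
  lra.
by apply: le_trans h; rewrite ler_piMl// invr_ge0 ltW.
Qed.

End ContinuedFractions.

Lemma convergent_error (R : realType) (theta : R) (a : nat -> nat) n : cf_expansion theta a ->
  `|theta - (cf_p a n)%:R / (cf_q a n)%:R| <= ((cf_q a n)%:R ^+ 2)^-1.
Proof.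
move=> [a_pos lim]; apply/ler_addgt0Pl => e e0.
have /cvgrPdist_lt/(_ _ e0)[N _ NP] := lim.
pose m := (n + N)%N.
have hm : `|cfrac R [seq a k | k <- iota 1 m] - (cf_p a n)%:R / (cf_q a n)%:R| <= ((cf_q a n)%:R ^+ 2)^-1.
  rewrite /m iotaD map_cat cfrac_cat; apply: cfrac_error => //.
  apply: cfrac01; rewrite all_map; apply/allP => k; rewrite mem_iota => kn /=.
  by apply: a_pos; lia.
have := NP m (leq_addl _ _) => /= hd.
have := ler_normD (theta - cfrac R [seq a k | k <- iota 1 m])
  (cfrac R [seq a k | k <- iota 1 m] - (cf_p a n)%:R / (cf_q a n)%:R).
rewrite addrA subrK; lra.
Qed.

(** * From matrices to the rotation algebra and back *)

Section Comparison.
Context {R : realType}.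
Local Notation C := (R[i]).
Local Open Scope sesquilinear_scope.

Lemma adj_four_terms n (c c' d d' : C) (S T : 'M[C]_n) :
  (c *: S + c' *: S^t* + d *: T + d' *: T^t*)^t* =
  c'^* *: S + c^* *: S^t* + d'^* *: T + d^* *: T^t*.
Proof.
by apply/matrixP => i j; rewrite !mxE !rmorphD !rmorphM /= !conjCK; ring.
Qed.

Variables (theta : R) (al1 alm1 be1 bem1 : C) (M : R) (p q : nat).
Variables (A : cstarAlgType R) (U V : A).
Hypotheses (irr : irrational theta) (A_theta : is_rotation_algebra theta U V).
Hypotheses (aM : cabs al1 <= M) (a'M : cabs alm1 <= M) (bM : cabs be1 <= M) (b'M : cabs bem1 <= M).
Hypotheses (q0 : (0 < q)%N) (pq : coprime p q).
Hypothesis thq : `|theta - p%:R / q%:R| <= (q%:R ^+ 2)^-1.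

Local Notation H := (rotation_elt al1 alm1 be1 bem1 U V).
Local Notation h := (rotation_mx al1 alm1 be1 bem1 p q).

Let M0 : 0 <= M. Proof. exact: le_trans aM. Qed.
Let UV : rotation_pair theta U V. Proof. by case: A_theta. Qed.

Definition lin_expr (lam c c' d d' : C) : lexpr (R := R) :=
  Ladd (Lc lam) (Lmul (Lc (-1)) (Ladd (Ladd (Ladd (Lmul (Lc c) LU) (Lmul (Lc c') LUs))
     (Lmul (Lc d) LV)) (Lmul (Lc d') LVs))).

Lemma evalA_lin_expr lam : evalA U V (lin_expr lam al1 alm1 be1 bem1) = lam%:A - H.
Proof. by rewrite /= !mulr_algl scaleN1r. Qed.

Lemma evalZ_lin_expr lam c c' d d' t xi :
  evalZ theta t (lin_expr lam c c' d d') xi = rep_op c c' d d' lam theta t xi.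
Proof. by apply: funext => j; rewrite /= /rep_op /jacobi /pdiag; ring. Qed.

(** The adjoint has the same shape, with the coefficients conjugated and
    exchanged in pairs; this lets the comparison be applied to it as well. *)
Lemma evalZ_lstar_lin_expr lam t xi :
  evalZ theta t (lstar (lin_expr lam al1 alm1 be1 bem1)) xi =
  rep_op alm1^* al1^* bem1^* be1^* lam^* theta t xi.
Proof.
by apply: funext => j; rewrite /= /rep_op /jacobi /pdiag (rmorphN1 (@Num.conj C)); ring.
Qed.

Lemma algebra_to_matrix lam c : 0 < c ->
  lam%:A - H \is a GRing.unit -> cnorm (lam%:A - H)^-1 <= c^-1 ->
  mxlower (lam%:M - h) (c - 204 * M / q%:R).
Proof.
move=> c0 uX Xc x.
have [_ gen _] := A_theta.
have low : mxlower (lam%:M - h) (c - 38 * M / q%:R).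
  apply/mxlower_per => //; apply: (rep_to_matrix aM a'M bM b'M q0 thq) => t xi fx.
  rewrite -evalZ_lin_expr; apply: (inverse_to_lower irr UV gen) => //; rewrite evalA_lin_expr//.
apply: le_trans (low x); rewrite ler_wpM2r ?l2norm_ge0//.
have : 0 <= M / q%:R by rewrite divr_ge0.
rewrite -!mulrA; lra.
Qed.

Lemma adj_rotation_mx : h^t* = rotation_mx alm1^* al1^* bem1^* be1^* p q.
Proof. exact: adj_four_terms. Qed.

(** On sequences an inverse needs a lower bound of the adjoint too; it comes
    from the adjoint matrix, which has the same lower bound as the matrix. *)
Lemma matrix_to_algebra lam c : 204 * M / q%:R < c ->
  mxlower (lam%:M - h) c ->
  lam%:A - H \is a GRing.unit /\ cnorm (lam%:A - H)^-1 <= (c - 204 * M / q%:R)^-1.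
Proof.
move=> cM low; have d0 : 0 < c - 204 * M / q%:R by rewrite subr_gt0.
have c0 : 0 < c by apply: le_lt_trans cM; rewrite divr_ge0// mulr_ge0.
rewrite -evalA_lin_expr; apply: (lower_to_inverse irr UV) => // t xi fx.
  rewrite evalZ_lin_expr.
  by apply: (matrix_to_rep aM a'M bM b'M q0 pq thq) fx; apply/mxlower_per.
rewrite evalZ_lstar_lin_expr; apply: (matrix_to_rep _ _ _ _ q0 pq thq) fx; rewrite ?cabs_conj//.
apply/(mxlower_per _ _ _ _ _ _ _ q0); rewrite -adj_rotation_mx.
have -> : lam^*%:M - h^t* = (lam%:M - h)^t*.
  by rewrite linearB /= tr_scalar_mx map_mxB map_scalar_mx.
exact: mxlower_adj.
Qed.

End Comparison.

Section Spectra.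
Context {R : realType}.
Local Notation C := (R[i]).

Lemma pseudospectrumP (A : cstarAlgType R) (x : A) e lam : 0 < e ->
  ~ cpseudospectrum e x lam <->
  exists2 c, e < c & lam%:A - x \is a GRing.unit /\ cnorm (lam%:A - x)^-1 <= c^-1.
Proof.
move=> e0; split.
  move/not_orP => [/negP]; rewrite negbK => uY /negP; rewrite -ltNge => h.
  have n0 : 0 < cnorm (lam%:A - x)^-1.
    by apply: cnorm_gt0; apply: contraTneq uY => Y0; rewrite -unitrV Y0 unitr0.
  exists (cnorm (lam%:A - x)^-1)^-1; last by rewrite invrK.
  by rewrite -[e]invrK ltf_pV2 ?posrE ?invr_gt0.
move=> [c ec [uY Yc]] []; first by rewrite uY.
apply/negP; rewrite -ltNge (le_lt_trans Yc)// ltf_pV2 ?posrE//; exact: lt_trans ec.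
Qed.

Lemma cnormal_resolvent (A : cstarAlgType R) (x : A) (lam : C) : cnormal x -> cnormal (lam%:A - x).
Proof.
move=> nx; have cs k (y : A) : GRing.comm y k%:A.
  by rewrite /GRing.comm -scalerAr -scalerAl mulr1 mul1r.
rewrite /cnormal starB starZ star1; apply: commrB; first exact: cs.
by apply/commr_sym/commrB; [exact: cs|exact/commr_sym].
Qed.

(** The disc of radius c around lam misses the spectrum, so that every
    translate of lam - x by a scalar of modulus at most c is invertible. *)
Lemma normal_dist_spectrum (A : cstarAlgType R) (x : A) lam c : 0 < c -> cnormal x ->
  (forall mu, cspectrum x mu -> c < cabs (lam - mu)) ->
  lam%:A - x \is a GRing.unit /\ cnorm (lam%:A - x)^-1 <= c^-1.
Proof.
move=> c0 nx h.
have u w : cabs w <= c -> (lam%:A - x) - w%:A \is a GRing.unit.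
  move=> wc; apply/negPn/negP => nu.
  have : cspectrum x (lam - w).
    rewrite /cspectrum /=; have -> : (lam - w)%:A - x = lam%:A - x - w%:A.
      by rewrite scalerBl addrAC.
    exact: nu.
  by move/h; rewrite subKr ltNge wc.
split; last by apply: normal_inverse_bound => //; exact: cnormal_resolvent.
by have := u 0; rewrite cabs0 scale0r subr0; apply; exact: ltW.
Qed.

Lemma dist_to_le (z : C) (T : set C) e :
  (forall c, e < c -> exists2 w, T w & cabs (z - w) <= c) -> (dist_to z T <= e%:E)%E.
Proof.
move=> h; apply/lee_addgt0Pr => d d0.
have [w Tw zw] := h (e + d) (ltac:(by rewrite ltrDl)).
apply: (@le_trans _ _ (cabs (z - w))%:E); last by rewrite -EFinD lee_fin.
by apply: ereal_inf_lbound; exists w.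
Qed.

Lemma hausdorff_le (S T : set C) e :
  (forall z c, S z -> e < c -> exists2 w, T w & cabs (z - w) <= c) ->
  (forall z c, T z -> e < c -> exists2 w, S w & cabs (z - w) <= c) ->
  (hausdorff_dist S T <= e%:E)%E.
Proof.
move=> h1 h2; rewrite /hausdorff_dist ge_max; apply/andP; split.
  by apply: ge_ereal_sup => _ [z Sz <-]; apply: dist_to_le => c; exact: h1.
by apply: ge_ereal_sup => _ [z Sz <-]; apply: dist_to_le => c; exact: h2.
Qed.

End Spectra.

Theorem theorem4p1 (R : realType) (theta : R) (a : nat -> nat)
    (al1 alm1 be1 bem1 : R[i])
    (A : cstarAlgType R) (U V : A)
    (theta01 : 0 < theta < 1) (theta_irr : irrational theta)
    (a_theta : cf_expansion theta a)
    (A_theta : is_rotation_algebra theta U V) :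
  let M := Num.max (Num.max (cabs al1) (cabs alm1))
                   (Num.max (cabs be1) (cabs bem1)) in
  let H := rotation_elt al1 alm1 be1 bem1 U V in
  let h k := rotation_mx al1 alm1 be1 bem1 (cf_p a k) (cf_q a k) in
  forall n : nat, (1 <= n)%N ->
  let eps_n := 204 * M * ((cf_q a n.-1)%:R^-1 + (cf_q a n)%:R^-1) in
  (forall eps : R, 0 < eps ->
     mxpseudospectrum eps (h n.-1) `|` mxpseudospectrum eps (h n)
       `<=` cpseudospectrum (eps + eps_n) H /\
     cpseudospectrum (eps + eps_n) H
       `<=` mxpseudospectrum (eps + 2 * eps_n) (h n.-1)
            `|` mxpseudospectrum (eps + 2 * eps_n) (h n)) /\
  (h n.-1 \is normalmx -> h n \is normalmx -> cnormal H ->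
   (hausdorff_dist (mxspectrum (h n.-1) `|` mxspectrum (h n)) (cspectrum H)
      <= eps_n%:E)%E).
Proof.
move=> M H h n n1 eps_n.
have [a_pos _] := a_theta.
have aM : cabs al1 <= M by rewrite /M !le_max lexx.
have a'M : cabs alm1 <= M by rewrite /M !le_max lexx orbT.
have bM : cabs be1 <= M by rewrite /M !le_max lexx orbT.
have b'M : cabs bem1 <= M by rewrite /M !le_max lexx !orbT.
have M0 : 0 <= M by exact: le_trans aM.
have q0 k : (0 < cf_q a k)%N by exact: cf_q_gt0.
pose d k := 204 * M / (cf_q a k)%:R.
have d0 k : 0 <= d k by rewrite /d divr_ge0// mulr_ge0.
have dn : d n.-1 <= eps_n /\ d n <= eps_n.
  have -> : eps_n = d n.-1 + d n by rewrite /eps_n mulrDr.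
  by rewrite lerDl lerDr !d0.
have dk k : (k = n.-1) \/ (k = n) -> d k <= eps_n by case=> ->; case: dn.
have e0 : 0 <= eps_n by exact: le_trans (d0 n) (proj2 dn).
have toM k lam c : 0 < c -> lam%:A - H \is a GRing.unit -> cnorm (lam%:A - H)^-1 <= c^-1 ->
    mxlower (lam%:M - h k) (c - d k).
  exact: (algebra_to_matrix theta_irr A_theta aM a'M bM b'M (q0 k) (convergent_error k a_theta)).
have toA k lam c : d k < c -> mxlower (lam%:M - h k) c ->
    lam%:A - H \is a GRing.unit /\ cnorm (lam%:A - H)^-1 <= (c - d k)^-1.
  exact: (matrix_to_algebra theta_irr A_theta aM a'M bM b'M (q0 k)
    (cf_coprime a k) (convergent_error k a_theta)).
split.
  move=> eps eps0; split.
    have incl k : k = n.-1 \/ k = n -> mxpseudospectrum eps (h k) `<=` cpseudospectrum (eps + eps_n) H.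
      move=> /dk dkn lam sp; apply: contrapT => np.
      have [c ec [uX Xc]] := (pseudospectrumP H lam (ltr_pwDl eps0 e0)).1 np.
      apply: (mxpseudoP (h k) lam eps0).2 sp; exists (c - d k); first lra.
      by apply: toM => //; lra.
    by move=> lam [|]; apply: incl; [left|right].
  have e1 : 0 < eps + eps_n by lra.
  have e2 : 0 < eps + 2 * eps_n by lra.
  move=> lam sp; right; apply: contrapT => np.
  have [c ec low] := (mxpseudoP (h n) lam e2).1 np.
  have [_ dnn] := dn.
  apply: (pseudospectrumP H lam e1).2 sp; exists (c - d n); first lra.
  by apply: toA => //; lra.
move=> nh' nh nH; apply: hausdorff_le => lam c.
  have incl k : k = n.-1 \/ k = n -> mxspectrum (h k) lam -> eps_n < c ->
      exists2 w, cspectrum H w & cabs (lam - w) <= c.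
    move=> /dk dkn sp ec; apply: contrapT => /forall2NP no.
    have c0 : 0 < c by exact: le_lt_trans ec.
    have [uX Xc] : lam%:A - H \is a GRing.unit /\ cnorm (lam%:A - H)^-1 <= c^-1.
      apply: normal_dist_spectrum => // mu smu.
      by case: (no mu) => // /negP; rewrite -ltNge.
    have low := toM k _ _ c0 uX Xc.
    by move: sp; rewrite /mxspectrum /= (mxlower_unit _ low)// subr_gt0; lra.
  by move=> [|] sp; apply: incl sp; [left|right].
move=> sp ec; apply: contrapT => /forall2NP no.
have [_ dnn] := dn.
have low : mxlower (lam%:M - h n) c.
  apply: normal_mxlower => // mu smu.
  by case: (no mu) => [[]|/negP]; [right|rewrite -ltNge => /ltW].
have [uX _] := toA n _ _ (le_lt_trans dnn ec) low.
by move: sp; rewrite /cspectrum /= uX.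
Qed.
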